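(* Let $\delta>0$ and assume that $\sigma_t=\sigma>0$ is constant. Suppose that the pairs $(\eta_t,a_t)\in\mathbb{R}\times\{0,1\}$ are independent over $t$; that $E(\eta_t\mid a_t=1)=0$ and $E(\eta_t^2\mid a_t=1)=1$; that the conditional distribution of $\eta_t$ given $a_t=1$ does not depend on $t$; and that $P(a_t=1)=g(t/n)$, where $g$ is a measurable non-constant deterministic function with $0<g(u)<1$ for $u\in(0,1]$, satisfying a piecewise Lipschitz condition on $(0,1]$. Suppose also that $E(|\eta_t|^{4\delta})<\infty$. Then, for any integer $m\ge1$, $\sqrt n\,\widehat{\Gamma}_{ns}^{(\delta)}(m)$ converges in distribution to $\mathcal{N}(0,\varsigma I_m)$ as $n\to\infty$, where $I_m$ is the $m\times m$ identity matrix and $\varsigma=\tilde\varsigma/\dot\varsigma$ with $$\tilde\varsigma=E\{|r_t|^{2\delta}|a_t=1\}^2\int_0^1g^2(s)ds-2E\{|r_t|^{2\delta}|a_t=1\}E\{|r_t|^{\delta}|a_t=1\}^2\int_0^1g^3(s)ds+E\{|r_t|^{\delta}|a_t=1\}^4\int_0^1g^4(s)ds,$$ $$\dot\varsigma=E\{|r_t|^{2\delta}|a_t=1\}^2\left(\int_0^1g(s)ds\right)^2-2E\{|r_t|^{2\delta}|a_t=1\}E\{|r_t|^{\delta}|a_t=1\}^2\left(\int_0^1g^2(s)ds\right)\left(\int_0^1g(s)ds\right)+E\{|r_t|^{\delta}|a_t=1\}^4\left(\int_0^1g^2(s)ds\right)^2.$$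
   Context: The latent returns are $\widetilde r_t=\sigma_t\eta_t$ with $\sigma_t>0$, and the observed returns are $r_t=a_t\widetilde r_t$, $t=1,\dots,n$, with $a_t\in\{0,1\}$. Since $P(a_t=1)=g(t/n)$ depends on $n$, the variables form a triangular array; the double subscript is suppressed. For $u\le0$, $g(u)$ is set equal to $g(0)=\lim_{u\downarrow0}g(u)$. Piecewise Lipschitz condition: there exist a positive integer $p$ and mutually disjoint intervals $I_1,\dots,I_p$ with $I_1\cup\dots\cup I_p=(0,1]$ such that $g(u)=\sum_{l=1}^p g_l(u)\mathbf{1}_{\{u\in I_l\}}$, $u\in(0,1]$, where each $g_l$ is Lipschitz on $I_l$. The moments $E\{|r_t|^{\delta}|a_t=1\}$ and $E\{|r_t|^{2\delta}|a_t=1\}$ do not depend on $t$. The corrected power autocorrelations (with $P(a_t=1)$ treated as known) are $$\widehat{\Gamma}_{ns}^{(\delta)}(m)=\left(\hat\rho_{ns}^{(\delta)}(1),\dots,\hat\rho_{ns}^{(\delta)}(m)\right)',\qquad \hat\rho_{ns}^{(\delta)}(h)=\hat\gamma_{ns}^{(\delta)}(h)\,\hat\gamma_{ns}^{(\delta)}(0)^{-1},$$ $$\hat\gamma_{ns}^{(\delta)}(h)=n^{-1}\sum_{t=1+h}^{n}\left(|r_t|^\delta-\bar r^{(\delta)}\frac{P(a_t=1)}{\bar a}\right)\left(|r_{t-h}|^\delta-\bar r^{(\delta)}\frac{P(a_{t-h}=1)}{\bar a}\right),$$ with $\bar r^{(\delta)}=n^{-1}\sum_{t=1}^n|r_t|^\delta$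 and $\bar a=n^{-1}\sum_{t=1}^nP(a_t=1)$. *)

(* Defs.v *)
From HB Require Import structures.
From mathcomp Require Import all_boot all_order all_algebra.
From mathcomp Require Import all_classical all_reals all_analysis.
From mathcomp Require Import measurable_realfun.

Set Implicit Arguments.
Unset Strict Implicit.
Unset Printing Implicit Defensive.

Import Order.TTheory GRing.Theory Num.Theory.
Import numFieldNormedType.Exports.

Local Open Scope classical_set_scope.
Local Open Scope ring_scope.

Section conditioning.
Context d (T : measurableType d) (R : realType) (P : probability T R).

Definition cond_prob (B A : set T) : R := fine (P (B `&` A)) / fine (P A).

(* E(X | A) = E(X 1_A) / P(A), for an event A with P(A) > 0 *)
Definition cond_expectation (X : T -> R) (A : set T) : \bar R :=
  ((fine (P A))^-1%:E * \int[P]_(w in A) (X w)%:E)%E.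

Definition mutually_independent d' (E : measurableType d') (D : set nat)
    (X : nat -> T -> E) : Prop :=
  forall (J : seq nat) (B : nat -> set E),
    uniq J -> (forall t, t \in J -> D t) -> (forall t, measurable (B t)) ->
    P (\bigcap_(t in [set` J]) X t @^-1` B t) =
    (\prod_(t <- J) P (X t @^-1` B t))%E.

End conditioning.

Section iid_law.
Context d (T : measurableType d) (R : realType) (P : probability T R).

Definition tuple_cons m (x : T * m.-tuple T) : m.+1.-tuple T :=
  [the m.+1.-tuple T of x.1 :: x.2].

Lemma measurable_tuple_cons m :
  measurable_fun [set: T * m.-tuple T] (@tuple_cons m).
Proof. exact: measurable_cons. Qed.

HB.instance Definition _ m :=
  isMeasurableFun.Build _ _ _ _ (@tuple_cons m) (@measurable_tuple_cons m).

(* the m-fold product measure of P, see iid_lawE *)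
Fixpoint iid_law m : probability (m.-tuple T) R :=
  match m with
  | 0 => dirac [tuple of [::]]
  | m'.+1 => distribution (P \x iid_law m')%E (@tuple_cons m')
  end.

Lemma iid_lawE m (B : 'I_m -> set T) : (forall i, measurable (B i)) ->
  iid_law m [set y | forall i, B i (tnth y i)] = (\prod_(i < m) P (B i))%E.
Proof.
elim: m B => [|m IH] B mB.
  rewrite big_ord0 /= diracE mem_set//= => i; by have := ltn_ord i.
rewrite big_ord_recl -IH//= /distribution /pushforward.
rewrite -[RHS]product_measure1E//; last first.
  rewrite (_ : [set _ | _] = \bigcap_(i in [set: 'I_m])
      ((@tnth _ T)^~ i @^-1` B (lift ord0 i))); last first.
    by apply/seteqP; split => y /= yB i; [move=> _|]; exact: yB.
  apply: fin_bigcap_measurable => // i _.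
  by rewrite -[X in measurable X]setTI; exact: measurable_tnth.
congr ((P \x iid_law m)%E _); apply/seteqP; split => -[x y] /=.
  by move=> xyB; split=> [|i]; [exact: (xyB ord0)|have := xyB (lift ord0 i); rewrite tnthS].
move=> [xB yB] i; case: (unliftP ord0 i) => [j|] ->//.
by rewrite tnthS; exact: yB.
Qed.

End iid_law.

Section multivariate_normal.
Context (R : realType) (m : nat).

(* normal_prob lives on measurableTypeR R, an alias of R with the same
   measurable sets. *)
Definition affine_tuple (mu : 'rV[R]_m) (A : 'M[R]_m)
    (z : m.-tuple (measurableTypeR R)) : m.-tuple R :=
  [tuple mu ord0 i + \sum_(j < m) A i j * (tnth z j : R) | i < m].

Lemma measurable_affine_tuple mu A :
  measurable_fun [set: m.-tuple (measurableTypeR R)] (affine_tuple mu A).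
Proof.
apply/measurable_fun_tnthP => i.
rewrite (_ : _ \o _ =
    fun z => mu ord0 i + \sum_(j < m) A i j * (tnth z j : R)); last first.
  by apply/funext => z /=; rewrite tnth_mktuple.
apply: measurable_funD => //; apply: measurable_sum => j.
by apply: measurable_funM => //; exact: measurable_tnth.
Qed.

HB.instance Definition _ mu A := isMeasurableFun.Build _ _ _ _
  (affine_tuple mu A) (measurable_affine_tuple mu A).

(* N(mu, A A^T), as the law of mu + A Z where Z has independent standard normal
   coordinates. In particular N(0, v I_m) is mvnormal 0 (Num.sqrt v)%:M. *)
Definition mvnormal (mu : 'rV[R]_m) (A : 'M[R]_m) :
    probability (m.-tuple R) R :=
  distribution (iid_law (normal_prob 0 1) m) (affine_tuple mu A).

End multivariate_normal.

Section convergence_in_distribution.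
Context (R : realType) (m : nat).

Definition joint_cdf (nu : probability (m.-tuple R) R) (x : 'rV[R]_m) : R :=
  fine (nu [set y | forall i, tnth y i <= x ord0 i]).

(* Convergence of the joint distribution functions at all the continuity points
   of the limit; the X n may live on different probability spaces. *)
Definition cvg_in_distribution (d : nat -> measure_display)
    (T : forall n, measurableType (d n)) (P : forall n, probability (T n) R)
    (X : forall n, {RV (P n) >-> m.-tuple R})
    (nu : probability (m.-tuple R) R) : Prop :=
  forall x : 'rV[R]_m, {for x, continuous (joint_cdf nu)} ->
    joint_cdf (distribution (P n) (X n)) x @[n --> \oo] --> joint_cdf nu x.

End convergence_in_distribution.
Arguments cvg_in_distribution {R m d T} P X nu.

Section piecewise_lipschitz.
Context (R : realType).

Definition piecewise_lipschitz (g : R -> R) : Prop :=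
  exists (p : nat) (I : 'I_p -> set R) (gl : 'I_p -> R -> R),
    [/\ (0 < p)%N,
        (forall l, is_interval (I l)) /\ trivIset setT I,
        \bigcup_l I l = `]0, 1]%classic,
        forall l, [lipschitz (gl l u) | u in I l] &
        forall u, u \in `]0, 1] -> g u = \sum_(l < p) gl l u * \1_(I l) u].

End piecewise_lipschitz.

Section returns.
Context d (T : measurableType d) (R : realType).

Definition latent_return (sigma : nat -> R) (eta : nat -> {mfun T >-> R})
    (t : nat) (w : T) : R := sigma t * eta t w.

Definition observed_return (sigma : nat -> R) (eta : nat -> {mfun T >-> R})
    (a : nat -> {mfun T >-> bool}) (t : nat) (w : T) : R :=
  (a t w)%:R * latent_return sigma eta t w.

Lemma measurable_observed_return sigma eta a t :
  measurable_fun [set: T] (observed_return sigma eta a t).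
Proof.
apply: measurable_funM; last exact: measurable_funM.
exact: (measurableT_comp (f := fun b : bool => b%:R : R)).
Qed.

HB.instance Definition _ sigma eta a t := isMeasurableFun.Build _ _ _ _
  (observed_return sigma eta a t) (measurable_observed_return sigma eta a t).

End returns.

(* In this section q t stands for P(a_t = 1). *)
Section corrected_autocorrelations.
Context d (T : measurableType d) (R : realType).
Variables (delta : R) (r : nat -> {mfun T >-> R}) (q : nat -> R) (n : nat).

Definition power_mean (w : T) : R :=
  n%:R^-1 * \sum_(1 <= t < n.+1) `|r t w| `^ delta.

Definition a_mean : R := n%:R^-1 * \sum_(1 <= t < n.+1) q t.

Definition corrected_power (t : nat) (w : T) : R :=
  `|r t w| `^ delta - power_mean w * (q t / a_mean).

Definition gamma_ns (h : nat) (w : T) : R :=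
  n%:R^-1 *
  \sum_(h.+1 <= t < n.+1) corrected_power t w * corrected_power (t - h) w.

(* equal to 0, by convention, on the event gamma_ns 0 w = 0 *)
Definition rho_ns (h : nat) (w : T) : R := gamma_ns h w * (gamma_ns 0 w)^-1.

Definition sqrtn_Gamma_ns (m : nat) (w : T) : m.-tuple R :=
  [tuple Num.sqrt n%:R * rho_ns i.+1 w | i < m].

Lemma measurable_corrected_power t : measurable_fun [set: T] (corrected_power t).
Proof.
have mp s : measurable_fun [set: T] (fun w => `|r s w| `^ delta).
  apply: (measurableT_comp (measurable_powR delta)).
  exact: measurableT_comp.
apply: measurable_funB => //; apply: measurable_funM => //.
by apply: measurable_funM => //; exact: measurable_sum.
Qed.

Lemma measurable_gamma_ns h : measurable_fun [set: T] (gamma_ns h).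
Proof.
apply: measurable_funM => //; apply: measurable_sum => t.
by apply: measurable_funM; exact: measurable_corrected_power.
Qed.

Lemma measurable_rho_ns h : measurable_fun [set: T] (rho_ns h).
Proof.
have mg := measurable_gamma_ns.
apply: measurable_funM => //.
rewrite (_ : (fun w => _) =
    fun w => gamma_ns 0 w * (gamma_ns 0 w ^+ 2) `^ (-1)); last first.
  apply/funext => w; rewrite powR_inv1 ?sqr_ge0//.
  have [->|g0] := eqVneq (gamma_ns 0 w) 0; first by rewrite invr0 mul0r.
  by rewrite expr2 (invfM (gamma_ns 0 w)) mulVKf.
apply: measurable_funM => //.
by apply: (measurableT_comp (measurable_powR (-1))); exact: measurable_funX.
Qed.

Lemma measurable_sqrtn_Gamma_ns m :
  measurable_fun [set: T] (sqrtn_Gamma_ns m).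
Proof.
apply/measurable_fun_tnthP => i.
rewrite (_ : _ \o _ = fun w => Num.sqrt n%:R * rho_ns i.+1 w); last first.
  by apply/funext => w /=; rewrite tnth_mktuple.
by apply: measurable_funM => //; exact: measurable_rho_ns.
Qed.

HB.instance Definition _ m := isMeasurableFun.Build _ _ _ _
  (sqrtn_Gamma_ns m) (@measurable_sqrtn_Gamma_ns m).

End corrected_autocorrelations.

(* M1 and M2 stand for E(|r_t|^delta | a_t = 1) and
   E(|r_t|^(2 delta) | a_t = 1). *)
Section asymptotic_variance.
Context (R : realType) (M1 M2 : R) (g : R -> R).

Let I (k : nat) : R :=
  (\int[@lebesgue_measure R]_(s in `[0%R, 1%R]) (g s ^+ k))%R.

Definition avar_num : R :=
  M2 ^+ 2 * I 2 - 2 * M2 * M1 ^+ 2 * I 3 + M1 ^+ 4 * I 4.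

Definition avar_den : R :=
  M2 ^+ 2 * I 1 ^+ 2 - 2 * M2 * M1 ^+ 2 * I 2 * I 1 + M1 ^+ 4 * I 2 ^+ 2.

Definition avar : R := avar_num / avar_den.

End asymptotic_variance.

(* Main.v *)
Require Import Defs.
From HB Require Import structures.
From mathcomp Require Import all_boot all_order all_algebra.
From mathcomp Require Import all_classical all_reals all_analysis.
From mathcomp Require Import measurable_realfun ring lra zify.


(* Put Y_t = |r_t|^delta - M1 P(a_t = 1), a centred independent array, and
   Y_0 = 0. Replacing the empirical mean costs O(1/n) in L^1, so that
   sqrt n gamma_ns(h) is close to S_n(h) = n^(-1/2) sum_t Y_t Y_(t-h), and
   gamma_ns(0) tends to the integral D of M2 g - M1^2 g^2.

   The central limit theorem for the vector S_n is proved by Lindeberg's method,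
   with test functions u(s, y) = prod_i Phi((x_i - y_i) / sqrt s_i). They solve the
   heat equation, so that no Gaussian variables have to be adjoined: adding the
   term indexed by t to S_(t-1) is compensated, up to O(n^(-3/2)), by decreasing
   the time s by the variances E Y_t^2 E Y_(t-i)^2 / n. The first order term vanishes
   since Y_t is centred and independent of the past; in the second order term,
   the second derivative of u at S_(t-1) is replaced by its value at S_(t-1-m),
   which is independent of the lagged values that multiply it.

   As u(eps^2, y) is a smoothed version of the indicator of y <= x, this gives the
   convergence of the joint distribution functions. The variances are Riemann
   sums of functions that are continuous off a finite set; they converge to the
   integral V of (M2 g - M1^2 g^2)^2, and V / D^2 is the asymptotic variance. *)

Set Implicit Arguments.
Unset Strict Implicit.
Unset Printing Implicit Defensive.

Import Order.TTheory GRing.Theory Num.Theory.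
Import numFieldNormedType.Exports.

Local Open Scope classical_set_scope.
Local Open Scope ring_scope.

(** * The normal distribution function *)

Section mean_value_bounds.
Context {R : realType}.
Implicit Types (f df : R -> R) (a b M : R).

(** The products [Y t Y (t - i)] are martingale differences rather than independent variables: given
    the past, the covariance of two coordinates of a step is a multiple of [Y (k - i) Y (k - j)],
    which is random and correlated with the current sum, whereas the time in the heat equation can
    only be lowered by a deterministic amount. Freezing the second derivative removes this obstacle.
    Its price is a moment of a product of four values of [Y], which is where the moment of order
    [4 delta] enters, together with the law of large numbers for [Y t ^ 2].

    The probability space changes with [n], so every estimate is explicit and uniform in [n]: a
    single number [kappa], computed from the conditional moments, bounds all [E (1 + Y t ^ 4)], and
    a single [K] bounds the test function as long as the time stays above [s0].

    The weight [q t / a_mean] makes the unknown [M1] cancel exactly, since the empirical mean of the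
    powers is that of [Y] plus [M1 a_mean]. What remains is quadratic in sums of centred independent
    variables, hence small enough to survive multiplication by [sqrt n]. *)

Lemma mean_value_bound f df a b M :
  (forall x, Num.min a b <= x <= Num.max a b -> is_derive x 1 f (df x)) ->
  (forall x, Num.min a b <= x <= Num.max a b -> `|df x| <= M) ->
  `|f b - f a| <= M * `|b - a|.
Proof.
wlog ab : a b / a <= b.
  move=> H; have [/H//|] := boolP (a <= b); rewrite -ltNge => /ltW ba.
  move=> fdf dfM; rewrite distrC (distrC b).
  by apply: H => // x; rewrite minC maxC; [exact: fdf|exact: dfM].
rewrite (min_idPl ab) (max_idPr ab) => fdf dfM.
have [c cab ->] : exists2 c, c \in `[a, b]%R & f b - f a = df c * (b - a).
  apply: MVT_segment => // [x|].
    by rewrite in_itv/= => /andP[ax xb]; apply: fdf; rewrite !ltW.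
  apply: derivable_within_continuous => x; rewrite in_itv/= => xab.
  by have /fdf[] := xab.
by rewrite normrM ler_wpM2r//; apply: dfM; rewrite in_itv/= in cab.
Qed.

(** Apply the mean value bound to [x |-> f x - df a (x - a)]. A Lipschitz bound for [df] at [a]
    replaces a second derivative, at the price of the constant [M] instead of [M / 2]. *)
Lemma taylor1_bound f df a b M : 0 <= M ->
  (forall x, Num.min a b <= x <= Num.max a b -> is_derive x 1 f (df x)) ->
  (forall x, Num.min a b <= x <= Num.max a b ->
    `|df x - df a| <= M * `|x - a|) ->
  `|f b - f a - df a * (b - a)| <= M * `|b - a| ^+ 2.
Proof.
move=> M0 fdf dfM.
pose h x := f x - df a * (x - a).
have -> : f b - f a - df a * (b - a) = h b - h a by rewrite /h; ring.
rewrite expr2 mulrA.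
apply: (@mean_value_bound _ (fun x => df x - df a)) => x xab.
  have fx := fdf _ xab; rewrite /h.
  by apply: is_derive_eq; rewrite subr0 scaler1.
apply: le_trans (dfM _ xab) _; rewrite ler_wpM2l//.
move: xab; have [ab|/ltW ba] := leP a b => /andP[ax xb].
  by rewrite !ger0_norm ?subr_ge0// lerD2r.
by rewrite !ler0_norm ?subr_le0// lerN2 lerD2r.
Qed.

Lemma taylor2_bound f df (d2f : R -> R) a b M : 0 <= M ->
  (forall x, Num.min a b <= x <= Num.max a b -> is_derive x 1 f (df x)) ->
  (forall x, Num.min a b <= x <= Num.max a b -> is_derive x 1 df (d2f x)) ->
  (forall x, Num.min a b <= x <= Num.max a b ->
    `|d2f x - d2f a| <= M * `|x - a|) ->
  `|f b - f a - df a * (b - a) - d2f a / 2 * (b - a) ^+ 2|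
    <= M * `|b - a| ^+ 3.
Proof.
move=> M0 fdf dfd dfM.
pose h x := f x - df a * (x - a) - d2f a / 2 * (x - a) ^+ 2.
have -> : f b - f a - df a * (b - a) - d2f a / 2 * (b - a) ^+ 2 = h b - h a.
  by rewrite /h; ring.
rewrite exprSr mulrA.
apply: (@mean_value_bound _ (fun x => df x - df a - d2f a * (x - a))) => x xab.
  have fx := fdf _ xab; rewrite /h.
  apply: is_derive_eq.
  by rewrite subr0 /GRing.scale/=; field.

have mm : forall y, Num.min a x <= y <= Num.max a x ->
    Num.min a b <= y <= Num.max a b.
  move: xab; have [ab|/ltW ba] := leP a b => /andP[ax xb] y.
    by rewrite (min_idPl ax) (max_idPr ax) => /andP[-> /le_trans]; exact.
  rewrite (min_idPr xb) (max_idPl xb) => /andP[xy ->]; rewrite andbT.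
  exact: le_trans xy.
apply: le_trans (@taylor1_bound df d2f a x M M0 _ _) _.
- by move=> y /mm; exact: dfd.
- by move=> y /mm; exact: dfM.
rewrite ler_wpM2l// lerXn2r ?nnegrE//.
move: xab; have [ab|/ltW ba] := leP a b => /andP[ax xb].
  by rewrite !ger0_norm ?subr_ge0// lerD2r.
by rewrite !ler0_norm ?subr_le0// lerN2 lerD2r.
Qed.

End mean_value_bounds.

Section normal_cdf.
Context {R : realType}.
Implicit Types x y z : R.

Definition gauss : R -> R := normal_pdf 0 1.

Definition normal_cdf x : R := fine (normal_prob (0 : R) 1 `]-oo, x]).

Lemma gaussE : gauss = fun x => normal_peak 1 * expR (- (x * x) / 2).
Proof.
rewrite /gauss normal_pdfE ?oner_eq0//; apply/funext => x.
by rewrite /normal_fun subr0 expr1n expr2.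
Qed.

Lemma gauss_ge0 x : 0 <= gauss x. Proof. exact: normal_pdf_ge0. Qed.

Lemma normal_cdf_ge0 x : 0 <= normal_cdf x. Proof. by rewrite fine_ge0. Qed.

Lemma normal_cdf_le1 x : normal_cdf x <= 1.
Proof.
rewrite -lee_fin fineK ?fin_num_measure//.
exact: probability_le1.
Qed.

#[global] Instance is_derive_gauss x : is_derive x 1 gauss (- (x * gauss x)).
Proof.
rewrite gaussE.
pose f := fun y : R => - (y * y) / 2.
have df : is_derive x 1 f (- x).
  rewrite /f; apply: is_derive_eq.
  by rewrite /GRing.scale/=; field.
apply: is_derive_eq; rewrite /GRing.scale/=.
ring.
Qed.

#[global] Instance is_derive_normal_cdf x : is_derive x 1 normal_cdf (gauss x).
Proof.
have [dF <-] : derivable normal_cdf x 1 /\ derive1 normal_cdf x = gauss x.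
  apply: (@continuous_FTC1 _ gauss -oo%O x (x + 1)) => //.
  - by rewrite ltrDl.
  - apply: (integrableS _ _ (subsetT _)) => //.
    exact: integrable_normal_pdf.
  - exact: ltNyr.
  - exact: (@continuous_normal_pdf R 0 1 (oner_neq0 _) x).
by split; [exact: dF|rewrite derive1E].
Qed.

(** The constant comes from [exp (x^2 / 2) >= 1 + x^4 / 8] and
    [|x|^k <= 1 + x^4 <= 8 (1 + x^4 / 8)]. It serves for all the polynomials in [x] that multiply
    the density below. *)
Lemma gauss_moment_bound (k : nat) x : (k <= 4)%N ->
  `|x| ^+ k * gauss x <= 8 * normal_peak 1.
Proof.
move=> k4; rewrite gaussE mulrCA mulrC ler_wpM2r ?normal_peak_ge0//.
have xk : `|x| ^+ k <= 1 + x ^+ 4.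
  have x4 : 0 <= x ^+ 4 by rewrite exprn_even_ge0.
  have [x1|/ltW x1] := leP `|x| 1.
    by rewrite (le_trans (exprn_ile1 _ _ _))// lerDl.
  rewrite (@le_trans _ _ (`|x| ^+ 4))//; last by rewrite -normrX ger0_norm// lerDr.
  exact: ler_weXn2l.
have h0 : 0 <= x * x / 2 by rewrite mulr_ge0// -expr2 sqr_ge0.
have := expR_ge1Dxn 1%N h0; rewrite !factS fact0 mulNr expRN => eh.
rewrite ler_pdivrMr ?expR_gt0//; apply: le_trans xk _.
have x4E : x ^+ 4 = (x * x) ^+ 2 by ring.
have : 0 <= (x * x) ^+ 2 by rewrite sqr_ge0.
rewrite x4E; move: eh; rewrite exprMn expr2 expr2 => eh h2.
move: eh; rewrite [_%:R]/=.
by lra.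
Qed.


Definition gauss_const : R := 8 * normal_peak 1.

Local Notation B := gauss_const.

Lemma gauss_const_ge0 : 0 <= B.
Proof. by rewrite mulr_ge0// normal_peak_ge0. Qed.

Lemma gauss_bound x : `|gauss x| <= B.
Proof.
by rewrite ger0_norm ?gauss_ge0//; have := @gauss_moment_bound 0 x isT; rewrite mul1r.
Qed.

Lemma xgauss_bound x : `|x * gauss x| <= B.
Proof.
by rewrite normrM (ger0_norm (gauss_ge0 _)); exact: (@gauss_moment_bound 1).
Qed.

Lemma normal_cdf_lipschitz x y : `|normal_cdf y - normal_cdf x| <= B * `|y - x|.
Proof. by apply: (@mean_value_bound _ _ gauss) => // z _; exact: gauss_bound. Qed.

Lemma gauss_lipschitz x y : `|gauss y - gauss x| <= B * `|y - x|.
Proof.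
apply: (@mean_value_bound _ _ (fun x => - (x * gauss x))) => // z _.
by rewrite normrN; exact: xgauss_bound.
Qed.

Lemma is_derive_xgauss x :
  is_derive x 1 (fun x => x * gauss x) ((1 - x ^+ 2) * gauss x).
Proof.
by apply: is_derive_eq; rewrite /GRing.scale/=; ring.
Qed.

Lemma xgauss_lipschitz x y :
  `|y * gauss y - x * gauss x| <= 2 * B * `|y - x|.
Proof.
apply: (@mean_value_bound _ (fun x => x * gauss x)
  (fun x => (1 - x ^+ 2) * gauss x)) => z _.
  exact: is_derive_xgauss.
rewrite mulrBl mul1r (le_trans (ler_normB _ _))// mulrDl mul1r lerD ?gauss_bound//.
rewrite normrM normrX (ger0_norm (gauss_ge0 _)).
exact: (@gauss_moment_bound 2).
Qed.

Lemma normal_cdf_taylor x z :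
  `|normal_cdf (x + z) - normal_cdf x - gauss x * z
    + x * gauss x / 2 * z ^+ 2| <= 2 * B * `|z| ^+ 3.
Proof.
have := @taylor2_bound _ normal_cdf gauss (fun x => - (x * gauss x)) x (x + z)
  (2 * B).
rewrite (addrC x z) addrK !mulNr !opprK; apply => //.
  by rewrite mulr_ge0// gauss_const_ge0.
by move=> y _; rewrite addrC distrC; exact: xgauss_lipschitz.
Qed.

(* The heat equation for the normal distribution function, in the scale-free
   form obtained from [s + t = s (1 + x)]. *)
Lemma normal_cdf_heat x y : 0 <= x ->
  `|normal_cdf (y / Num.sqrt (1 + x)) - normal_cdf y + x / 2 * (y * gauss y)|
    <= B * x ^+ 2.
Proof.
move=> x0.
pose c (t : R) : R := (Num.sqrt (1 + t))^-1.
pose f t := normal_cdf (y * c t).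
pose df t := - (c t ^+ 2 / 2 * ((y * c t) * gauss (y * c t))).
have dc (t : R) : 0 <= t -> is_derive t 1 c (- (c t ^+ 3 / 2)).
  move=> t0; have t1 : 0 < 1 + t by rewrite ltr_pwDl.
  have sq : is_derive t 1 (fun t : R => Num.sqrt (1 + t)) (2^-1 * c t).
    have := is_derive1_sqrt t1 => ds.
    have d1 : is_derive t 1 (fun t : R => 1 + t) 1.
      by apply: is_derive_eq; rewrite add0r mulr1.
    have := @is_derive1_comp _ Num.sqrt (fun t : R => 1 + t) _ _ _ ds d1.
    by rewrite mulr1 invfM.
  have s0 : Num.sqrt (1 + t) != 0 by rewrite gt_eqF// sqrtr_gt0.
  have := @is_deriveV _ (fun t : R => Num.sqrt (1 + t)) _ _ _ s0 sq.
  rewrite /GRing.scale/= => /is_derive_eq; apply.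
  by rewrite /c; field.
have c0 (t : R) : 0 <= t -> 0 <= c t <= 1.
  move=> t0; rewrite /c invr_ge0 sqrtr_ge0/= invf_le1 ?sqrtr_gt0 ?ltr_pwDl//.
  by rewrite -[leLHS]sqrtr1 ler_wsqrtr// lerDl.
have dcf (t : R) : 0 <= t -> is_derive t 1 f (df t).
  move=> t0; have dct := dc _ t0; rewrite /f.
  have dyc : is_derive t 1 (fun t : R => y * c t) (y * - (c t ^+ 3 / 2)).
    by apply: is_derive_eq; rewrite /GRing.scale/=; ring.
  have := @is_derive1_comp _ normal_cdf (fun t : R => y * c t) _ _ _
    (is_derive_normal_cdf _) dyc.
  by move=> /is_derive_eq; apply; rewrite /df; field.
have d2cf (t : R) : 0 <= t -> is_derive t 1 df (c t ^+ 4 / 2 * (y * c t * gauss (y * c t)) +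
   c t ^+ 4 / 4 * (y * c t * ((1 - (y * c t) ^+ 2) * gauss (y * c t)))).
  move=> t0; have dct := dc _ t0.
  have dyc : is_derive t 1 (fun t : R => y * c t) (y * - (c t ^+ 3 / 2)).
    by apply: is_derive_eq; rewrite /GRing.scale/=; ring.
  have := is_derive_xgauss (y * c t) => dk.
  have := @is_derive1_comp _ (fun x => x * gauss x) (fun t => y * c t) _ _ _ dk dyc => dkc.
  rewrite /df; apply: is_derive_eq.
  by rewrite /GRing.scale/=; field.
have c1 : c 0 = 1 by rewrite /c addr0 sqrtr1 invr1.
have H (t : R) : Num.min 0 x <= t <= Num.max 0 x -> 0 <= t.
  by rewrite (min_idPl x0) => /andP[].
have := @taylor1_bound _ f df 0 x B gauss_const_ge0 (fun t h => dcf t (H _ h)).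
rewrite !subr0 (ger0_norm x0).
have -> : f x - f 0 - df 0 * x =
    normal_cdf (y / Num.sqrt (1 + x)) - normal_cdf y + x / 2 * (y * gauss y).
  by rewrite /f /df c1 !mulr1 /c; ring.
apply=> t tx; apply: (@mean_value_bound _ df (fun t =>
    c t ^+ 4 / 2 * (y * c t * gauss (y * c t)) + c t ^+ 4 / 4 *
    (y * c t * ((1 - (y * c t) ^+ 2) * gauss (y * c t))))).
  move=> u; have t0 := H _ tx; rewrite (min_idPl t0) => /andP[u0 _].
  exact: d2cf.
move=> u; have t0 := H _ tx; rewrite (min_idPl t0) => /andP[u0 _].
have /andP[cu0 cu1] := c0 _ u0.
have c4 : 0 <= c u ^+ 4 <= 1 by rewrite exprn_ge0//= exprn_ile1.
set v := y * c u.
have h1 := xgauss_bound v.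
have h3 : `|v ^+ 3 * gauss v| <= B.
  rewrite normrM normrX (ger0_norm (gauss_ge0 _)).
  exact: (@gauss_moment_bound 3).
(* The weights 3/4 and 1/4 add up to 1, so that the bound is [B] itself. *)
have -> : c u ^+ 4 / 2 * (v * gauss v) + c u ^+ 4 / 4 * (v * ((1 - v ^+ 2) * gauss v))
  = c u ^+ 4 * (3 / 4 * (v * gauss v) - 4^-1 * (v ^+ 3 * gauss v)) by field.
rewrite normrM -[leRHS]mul1r ler_pM// ?normr_ge0//.
  by rewrite ger0_norm//; case/andP: c4.
move: h1 h3; rewrite !ler_norml; lra.
Qed.

End normal_cdf.

(** * Test functions for the Lindeberg method *)

Section expansion_products.
Context {R : realDomainType}.
Implicit Types a b c f K delta : R.

(** [a], [b], [c] are the terms of order 0, 1, 2 in the size [delta] of the increment, and [f] is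
    the exact value. For [delta <= 1] the product of the remainders is telescoped; for [delta > 1]
    boundedness of [f] suffices, because each of the products is at most [K^2 delta^3]. Both cases
    produce seven terms. *)
Lemma expansion3_mul K delta a b c f a' b' c' f' : 0 <= delta ->
  `|a| <= K -> `|b| <= K * delta -> `|c| <= K * delta ^+ 2 -> `|f| <= K ->
  `|f - a - b - c| <= K * delta ^+ 3 ->
  `|a'| <= K -> `|b'| <= K * delta -> `|c'| <= K * delta ^+ 2 -> `|f'| <= K ->
  `|f' - a' - b' - c'| <= K * delta ^+ 3 ->
  `|f * f' - a * a' - (a * b' + b * a') - (a * c' + b * b' + c * a')|
    <= 7 * K ^+ 2 * delta ^+ 3.
Proof.
move=> d0 ha hb hc hf hr ha' hb' hc' hf' hr'.
have prod (x y X Y : R) : `|x| <= X -> `|y| <= Y -> `|x * y| <= X * Y.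
  by move=> *; rewrite normrM ler_pM.
have K0 : 0 <= K := le_trans (normr_ge0 _) ha.
have [d1|/ltW d1] := leP delta 1.
  have d21 : delta ^+ 2 <= 1 by rewrite exprn_ile1.
  have h1 : `|(f - a - b - c) * f'| <= K ^+ 2 * delta ^+ 3.
    by rewrite (le_trans (prod _ _ _ _ hr hf'))//; lra.
  have h2 : `|a * (f' - a' - b' - c')| <= K ^+ 2 * delta ^+ 3.
    by rewrite (le_trans (prod _ _ _ _ ha hr'))// expr2 mulrA.
  have h3 : `|b * (f' - a' - b' - c')| <= K ^+ 2 * delta ^+ 3.
    rewrite (le_trans (prod _ _ _ _ hb hr'))// mulrACA -expr2 ler_wpM2l ?sqr_ge0//.
    by rewrite ler_piMl// exprn_ge0.
  have h4 : `|c * (f' - a' - b' - c')| <= K ^+ 2 * delta ^+ 3.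
    rewrite (le_trans (prod _ _ _ _ hc hr'))// mulrACA -expr2 ler_wpM2l ?sqr_ge0//.
    by rewrite ler_piMl// exprn_ge0.
  have h5 : `|b * c'| <= K ^+ 2 * delta ^+ 3.
    by rewrite (le_trans (prod _ _ _ _ hb hc'))// mulrACA -expr2 -exprS.
  have h6 : `|c * b'| <= K ^+ 2 * delta ^+ 3.
    by rewrite (le_trans (prod _ _ _ _ hc hb'))// mulrACA -expr2 -exprSr.
  have h7 : `|c * c'| <= K ^+ 2 * delta ^+ 3.
    rewrite (le_trans (prod _ _ _ _ hc hc'))// mulrACA -expr2 ler_wpM2l ?sqr_ge0//.
    by rewrite -exprD; apply: ler_wiXn2l.
  have -> : f * f' - a * a' - (a * b' + b * a') - (a * c' + b * b' + c * a') =
    (f - a - b - c) * f' + a * (f' - a' - b' - c') + b * (f' - a' - b' - c')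
    + c * (f' - a' - b' - c') + b * c' + c * b' + c * c' by ring.
  move: h1 h2 h3 h4 h5 h6 h7; set X := K ^+ 2 * _.
  rewrite -[7 * _ * _]mulrA -/X.
  rewrite !ler_norml; lra.
have d3 : 1 <= delta ^+ 3 by rewrite exprn_ege1.
have d23 : delta ^+ 2 <= delta ^+ 3 by rewrite ler_weXn2l.
have d13 : delta <= delta ^+ 3 by rewrite -[leLHS]expr1 ler_weXn2l.
have KK0 : 0 <= K ^+ 2 by rewrite sqr_ge0.
have big x : x <= delta ^+ 3 -> K ^+ 2 * x <= K ^+ 2 * delta ^+ 3.
  by move=> ?; rewrite ler_wpM2l.
have h1 : `|f * f'| <= K ^+ 2 * delta ^+ 3.
  by rewrite (le_trans (prod _ _ _ _ hf hf'))// -expr2 -[leLHS]mulr1 big.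
have h2 : `|a * a'| <= K ^+ 2 * delta ^+ 3.
  by rewrite (le_trans (prod _ _ _ _ ha ha'))// -expr2 -[leLHS]mulr1 big.
have h3 : `|a * b'| <= K ^+ 2 * delta ^+ 3.
  by rewrite (le_trans (prod _ _ _ _ ha hb'))// mulrA -expr2 big.
have h4 : `|b * a'| <= K ^+ 2 * delta ^+ 3.
  by rewrite (le_trans (prod _ _ _ _ hb ha'))// mulrAC -expr2 big.
have h5 : `|a * c'| <= K ^+ 2 * delta ^+ 3.
  by rewrite (le_trans (prod _ _ _ _ ha hc'))// mulrA -expr2 big.
have h6 : `|c * a'| <= K ^+ 2 * delta ^+ 3.
  by rewrite (le_trans (prod _ _ _ _ hc ha'))// mulrAC -expr2 big.
have h7 : `|b * b'| <= K ^+ 2 * delta ^+ 3.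
  by rewrite (le_trans (prod _ _ _ _ hb hb'))// mulrACA -!expr2 big.
move: h1 h2 h3 h4 h5 h6 h7; set X := K ^+ 2 * _.
rewrite -[7 * _ * _]mulrA -/X.
rewrite !ler_norml; lra.
Qed.

(** The analogue of [expansion3_mul] for first order expansions, used in the time variable; here
    there are four terms. *)
Lemma expansion2_mul K delta a c f a' c' f' : 0 <= delta ->
  `|a| <= K -> `|c| <= K * delta -> `|f| <= K ->
  `|f - a - c| <= K * delta ^+ 2 ->
  `|a'| <= K -> `|c'| <= K * delta -> `|f'| <= K ->
  `|f' - a' - c'| <= K * delta ^+ 2 ->
  `|f * f' - a * a' - (a * c' + c * a')| <= 4 * K ^+ 2 * delta ^+ 2.
Proof.
move=> d0 ha hc hf hr ha' hc' hf' hr'.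
have prod (x y X Y : R) : `|x| <= X -> `|y| <= Y -> `|x * y| <= X * Y.
  by move=> *; rewrite normrM ler_pM.
have K0 : 0 <= K := le_trans (normr_ge0 _) ha.
have [d1|/ltW d1] := leP delta 1.
  have h1 : `|(f - a - c) * f'| <= K ^+ 2 * delta ^+ 2.
    by rewrite (le_trans (prod _ _ _ _ hr hf'))//; lra.
  have h2 : `|a * (f' - a' - c')| <= K ^+ 2 * delta ^+ 2.
    by rewrite (le_trans (prod _ _ _ _ ha hr'))// expr2 mulrA.
  have h3 : `|c * (f' - a' - c')| <= K ^+ 2 * delta ^+ 2.
    rewrite (le_trans (prod _ _ _ _ hc hr'))// mulrACA -expr2 ler_wpM2l ?sqr_ge0//.
    by rewrite ler_piMl// exprn_ge0.
  have h4 : `|c * c'| <= K ^+ 2 * delta ^+ 2.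
    by rewrite (le_trans (prod _ _ _ _ hc hc'))// mulrACA -!expr2.
  have -> : f * f' - a * a' - (a * c' + c * a') =
    (f - a - c) * f' + a * (f' - a' - c') + c * (f' - a' - c') + c * c' by ring.
  move: h1 h2 h3 h4; set X := K ^+ 2 * _.
  rewrite -[4 * _ * _]mulrA -/X.
  rewrite !ler_norml; lra.
have d2 : 1 <= delta ^+ 2 by rewrite exprn_ege1.
have d12 : delta <= delta ^+ 2 by rewrite -[leLHS]expr1 ler_weXn2l.
have KK0 : 0 <= K ^+ 2 by rewrite sqr_ge0.
have big x : x <= delta ^+ 2 -> K ^+ 2 * x <= K ^+ 2 * delta ^+ 2.
  by move=> ?; rewrite ler_wpM2l.
have h1 : `|f * f'| <= K ^+ 2 * delta ^+ 2.
  by rewrite (le_trans (prod _ _ _ _ hf hf'))// -expr2 -[leLHS]mulr1 big.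
have h2 : `|a * a'| <= K ^+ 2 * delta ^+ 2.
  by rewrite (le_trans (prod _ _ _ _ ha ha'))// -expr2 -[leLHS]mulr1 big.
have h3 : `|a * c'| <= K ^+ 2 * delta ^+ 2.
  by rewrite (le_trans (prod _ _ _ _ ha hc'))// mulrA -expr2 big.
have h4 : `|c * a'| <= K ^+ 2 * delta ^+ 2.
  by rewrite (le_trans (prod _ _ _ _ hc ha'))// mulrAC -expr2 big.
move: h1 h2 h3 h4; set X := K ^+ 2 * _.
rewrite -[4 * _ * _]mulrA -/X.
rewrite !ler_norml; lra.
Qed.

End expansion_products.

Section heat_solutions.
Context {R : realType} {m : nat} (s0 : R).
Hypothesis s0_gt0 : 0 < s0.

Notation V := ('I_m -> R).
Implicit Types (s y z tau : V) (u v f g : V -> V -> R) (K : R).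

(** The Lipschitz condition concerns space only. Measurability is required along arbitrary families
    of measurable coordinates, over an arbitrary measurable space, so that it yields measurability
    with respect to the past as well as on [T]. *)
Definition bdd_lip K f : Prop := [/\ 0 <= K,
  forall s y, (forall i, s0 <= s i) -> `|f s y| <= K,
  forall s y y', (forall i, s0 <= s i) ->
    `|f s y - f s y'| <= K * \sum_i `|y i - y' i| &
  forall d (T : measurableType d) (Y : T -> V) s,
    (forall i, measurable_fun setT (fun w => Y w i)) ->
    measurable_fun setT (fun w => f s (Y w))].

(* The expansions in space and, through the heat equation
   [du/ds_i = (1/2) d^2u/dy_i^2], in time that Lindeberg's argument consumes;
   [A] contains the coordinates on which [u] depends. *)
Definition heat_solution (A : {pred 'I_m}) K u (D1 : 'I_m -> V -> V -> R)
    (D2 : 'I_m -> 'I_m -> V -> V -> R) : Prop :=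
  [/\ bdd_lip K u, (forall i, bdd_lip K (D1 i)), (forall i j, bdd_lip K (D2 i j)),
   (forall i s y, i \notin A -> D1 i s y = 0) &
   (forall s y z, (forall i, s0 <= s i) ->
     `|u s (fun i => y i + z i) - u s y - \sum_i D1 i s y * z i
       - 2^-1 * \sum_i \sum_j D2 i j s y * (z i * z j)|
     <= K * (\sum_i `|z i|) ^+ 3) /\
   (forall s y tau, (forall i, s0 <= s i) -> (forall i, 0 <= tau i) ->
     `|u (fun i => s i + tau i) y - u s y - 2^-1 * \sum_i D2 i i s y * tau i|
     <= K * (\sum_i tau i) ^+ 2)].

Lemma bdd_lip_le K K' f : K <= K' -> bdd_lip K f -> bdd_lip K' f.
Proof.
move=> KK [K0 fb fl fm]; split => //; first exact: le_trans KK.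
- by move=> s y sy; exact: le_trans (fb _ _ sy) KK.
- move=> s y y' sy; rewrite (le_trans (fl _ _ _ sy))// ler_wpM2r//.
  exact: sumr_ge0.
Qed.

Lemma bdd_lip_cst0 K : 0 <= K -> bdd_lip K (fun _ _ => 0).
Proof.
move=> K0; split => //.
- by move=> s y _; rewrite normr0.
- by move=> s y y' _; rewrite subrr normr0 mulr_ge0// sumr_ge0.
Qed.

Lemma bdd_lipD K K' f g : bdd_lip K f -> bdd_lip K' g ->
  bdd_lip (K + K') (fun s y => f s y + g s y).
Proof.
move=> [K0 fb fl fm] [K0' gb gl gm]; split => //; first exact: addr_ge0.
- by move=> s y sy; rewrite (le_trans (ler_normD _ _))// lerD// ?fb ?gb.
- move=> s y y' sy; rewrite opprD addrACA (le_trans (ler_normD _ _))//.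
  by rewrite mulrDl lerD// ?fl ?gl.
- by move=> d T Y s mY; apply: measurable_funD; [exact: fm|exact: gm].
Qed.

Lemma bdd_lipM K f g : bdd_lip K f -> bdd_lip K g ->
  bdd_lip (2 * K ^+ 2) (fun s y => f s y * g s y).
Proof.
move=> [K0 fb fl fm] [K0' gb gl gm]; split => //.
- by rewrite mulr_ge0// sqr_ge0.
- move=> s y sy; rewrite normrM (@le_trans _ _ (K ^+ 2))//.
    by rewrite expr2 ler_pM// ?fb ?gb.
  by rewrite mulr_natl mulr2n lerDl sqr_ge0.
- move=> s y y' sy.
  have -> : f s y * g s y - f s y' * g s y' =
      f s y * (g s y - g s y') + (f s y - f s y') * g s y' by ring.
  rewrite (le_trans (ler_normD _ _))// -mulrA (mulr_natl _ 2) mulr2n lerD//.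
    by rewrite normrM expr2 -mulrA ler_pM// ?fb ?gl.
  by rewrite normrM expr2 mulrAC ler_pM// ?fl ?gb.
- by move=> d T Y s mY; apply: measurable_funM; [exact: fm|exact: gm].
Qed.

Lemma heat_solution_le A K K' u D1 D2 : K <= K' ->
  heat_solution A K u D1 D2 -> heat_solution A K' u D1 D2.
Proof.
move=> KK [ub b1 b2 sA [T H]]; split => //.
- exact: bdd_lip_le KK _.
- by move=> i; exact: bdd_lip_le KK _.
- by move=> i j; exact: bdd_lip_le KK _.
- split.
    move=> s y z sy; rewrite (le_trans (T _ _ _ sy))// ler_wpM2r//.
    by rewrite exprn_ge0// sumr_ge0.
  move=> s y tau sy ty; rewrite (le_trans (H _ _ _ sy ty))// ler_wpM2r//.
  exact: sqr_ge0.
Qed.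

Lemma heat_solution1 : heat_solution pred0 1 (fun _ _ => 1)
  (fun _ _ _ => 0) (fun _ _ _ _ => 0).
Proof.
split => //.
- split => //.
  + by move=> s y _; rewrite normr1.
  + by move=> s y y' _; rewrite subrr normr0 mul1r sumr_ge0.
- by move=> i; exact: bdd_lip_cst0.
- by move=> i j; exact: bdd_lip_cst0.
- split.
    move=> s y z sy.
    have -> : \sum_(i < m) (0 : R) * z i = 0.
      by rewrite big1// => i _; rewrite mul0r.
    have -> : \sum_(i < m) \sum_(j < m) (0 : R) * (z i * z j) = 0.
      by rewrite big1// => i _; rewrite big1// => j _; rewrite mul0r.
    by rewrite mulr0 subrr !subr0 normr0 mul1r exprn_ge0// sumr_ge0.
  move=> s y tau sy ty; rewrite big1 => [|i _]; last by rewrite mul0r.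
  by rewrite mulr0 subrr subr0 normr0 mul1r sqr_ge0.
Qed.

(** The Leibniz rule puts [2 D1 i E1 i] into the diagonal second derivative, a term that the
    expansion in time does not produce; it vanishes because [u] and [v] depend on disjoint sets of
    coordinates. The constant is the bound for a second derivative, a sum of four products, each
    costing [2 K^2]. *)
Lemma heat_solutionM A B K u v D1 D2 E1 E2 :
  heat_solution A K u D1 D2 -> heat_solution B K v E1 E2 ->
  (forall i, i \in A -> i \notin B) ->
  exists F1 F2, heat_solution [predU A & B] (8 * K ^+ 2)
    (fun s y => u s y * v s y) F1 F2.
Proof.
move=> [ub D1b D2b DA [uT uH]] [vb E1b E2b EB [vT vH]] AB.
exists (fun i s y => u s y * E1 i s y + D1 i s y * v s y).
exists (fun i j s y => (u s y * E2 i j s y + D1 i s y * E1 j s y)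
  + (D1 j s y * E1 i s y + D2 i j s y * v s y)).
have K0 : 0 <= K by case: ub.
have KK0 : 0 <= K ^+ 2 by rewrite sqr_ge0.
have lin (D : 'I_m -> V -> V -> R) s y z : (forall i, bdd_lip K (D i)) ->
    (forall i, s0 <= s i) -> `|\sum_i D i s y * z i| <= K * \sum_i `|z i|.
  move=> Db sy; rewrite (le_trans (ler_norm_sum _ _ _))// mulr_sumr.
  by apply: ler_sum => i _; rewrite normrM ler_wpM2r//; have [_ ->] := Db i.
have quad (D : 'I_m -> 'I_m -> V -> V -> R) s y z :
    (forall i j, bdd_lip K (D i j)) -> (forall i, s0 <= s i) ->
    `|2^-1 * \sum_i \sum_j D i j s y * (z i * z j)| <= K * (\sum_i `|z i|) ^+ 2.
  move=> Db sy; rewrite normrM ger0_norm ?invr_ge0//.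
  rewrite (@le_trans _ _ `|\sum_i \sum_j D i j s y * (z i * z j)|)//.
    by rewrite ler_piMl// invf_le1// ler1n.
  rewrite (le_trans (ler_norm_sum _ _ _))// expr2 mulr_suml mulr_sumr.
  apply: ler_sum => i _; rewrite mulr_sumr mulr_sumr.
  rewrite (le_trans (ler_norm_sum _ _ _))//; apply: ler_sum => j _.
  by rewrite normrM normrM ler_wpM2r//; have [_ ->] := Db i j.
split.
- apply: bdd_lip_le (bdd_lipM ub vb); lra.
- move=> i; apply: bdd_lip_le (bdd_lipD (bdd_lipM ub (E1b i)) (bdd_lipM (D1b i) vb)).
  lra.
- move=> i j; apply: bdd_lip_le (bdd_lipD
    (bdd_lipD (bdd_lipM ub (E2b i j)) (bdd_lipM (D1b i) (E1b j)))
    (bdd_lipD (bdd_lipM (D1b j) (E1b i)) (bdd_lipM (D2b i j) vb))).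
  lra.
- by move=> i s y; rewrite inE negb_or => /andP[iA iB]; rewrite DA// EB// mul0r mulr0 addr0.
split.
  move=> s y z sy.
  have z0 : 0 <= \sum_i `|z i| by exact: sumr_ge0.
  have [_ ubd _ _] := ub; have [_ vbd _ _] := vb.
  have := expansion3_mul z0 (ubd _ _ sy) (lin _ _ y z D1b sy)
    (quad _ _ y z D2b sy) (ubd s (fun i => y i + z i) sy) (uT _ _ _ sy)
    (vbd _ _ sy) (lin _ _ y z E1b sy)
    (quad _ _ y z E2b sy) (vbd s (fun i => y i + z i) sy) (vT _ _ _ sy).
  have -> : u s y * (\sum_i E1 i s y * z i) + (\sum_i D1 i s y * z i) * v s y =
     \sum_i (u s y * E1 i s y + D1 i s y * v s y) * z i.
    rewrite mulr_sumr mulr_suml -big_split/=; apply: eq_bigr => i _; ring.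
  have -> : u s y * (2^-1 * (\sum_i \sum_j E2 i j s y * (z i * z j))) +
      (\sum_i D1 i s y * z i) * (\sum_i E1 i s y * z i) +
      2^-1 * (\sum_i \sum_j D2 i j s y * (z i * z j)) * v s y =
    2^-1 * \sum_i \sum_j
        (u s y * E2 i j s y + D1 i s y * E1 j s y +
         (D1 j s y * E1 i s y + D2 i j s y * v s y)) * (z i * z j).
    (* The product of the linear terms is symmetrised in [i] and [j], which accounts for the factor
       1/2 and the two mixed terms of the Leibniz rule. *)
    have -> : (\sum_i D1 i s y * z i) * (\sum_i E1 i s y * z i) =
       2^-1 * (\sum_i \sum_j D1 i s y * E1 j s y * (z i * z j) +
               \sum_i \sum_j D1 j s y * E1 i s y * (z i * z j)).
      have e1 : \sum_i \sum_j D1 i s y * E1 j s y * (z i * z j) =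
         (\sum_i D1 i s y * z i) * (\sum_i E1 i s y * z i).
        rewrite mulr_suml; apply: eq_bigr => i _; rewrite mulr_sumr.
        by apply: eq_bigr => j _; ring.
      have -> : \sum_i \sum_j D1 j s y * E1 i s y * (z i * z j) =
         (\sum_i D1 i s y * z i) * (\sum_i E1 i s y * z i).
        rewrite exchange_big/= -e1; apply: eq_bigr => i _.
        by apply: eq_bigr => j _; ring.
      by rewrite e1; field.
    rewrite mulrCA mulr_sumr -mulrA mulr_suml -!mulrDr; congr (_ * _).
    rewrite -!big_split/=; apply: eq_bigr => i _.
    rewrite mulr_sumr mulr_suml -!big_split/=; apply: eq_bigr => j _; ring.
  move=> /le_trans; apply; rewrite ler_wpM2r ?exprn_ge0//; lra.
move=> s y tau sy ty.
have z0 : 0 <= \sum_i tau i by exact: sumr_ge0.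
have [_ ubd _ _] := ub; have [_ vbd _ _] := vb.
have st i : s0 <= s i + tau i by rewrite (le_trans (sy i))// lerDl.
have lin2 (D : 'I_m -> 'I_m -> V -> V -> R) : (forall i j, bdd_lip K (D i j)) ->
    `|2^-1 * \sum_i D i i s y * tau i| <= K * \sum_i tau i.
  move=> Db; rewrite normrM ger0_norm ?invr_ge0//.
  rewrite (@le_trans _ _ `|\sum_i D i i s y * tau i|)//.
    by rewrite ler_piMl// invf_le1// ler1n.
  rewrite (le_trans (lin (fun i => D i i) s y tau _ sy))// ler_wpM2l//.
  by apply: ler_sum => i _; rewrite ger0_norm.
have := expansion2_mul z0 (ubd _ _ sy) (lin2 _ D2b) (ubd (fun i => s i + tau i) y st)
  (uH _ _ _ sy ty) (vbd _ _ sy) (lin2 _ E2b) (vbd (fun i => s i + tau i) y st)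
  (vH _ _ _ sy ty).
have -> : u s y * (2^-1 * (\sum_i E2 i i s y * tau i)) +
   2^-1 * (\sum_i D2 i i s y * tau i) * v s y =
   2^-1 * \sum_i (u s y * E2 i i s y + D1 i s y * E1 i s y +
         (D1 i s y * E1 i s y + D2 i i s y * v s y)) * tau i.
  rewrite mulrCA -mulrA -mulrDr; congr (_ * _).
  rewrite mulr_sumr mulr_suml -!big_split/=; apply: eq_bigr => i _.
  have -> : D1 i s y * E1 i s y = 0.
    have [/AB/EB->|/DA->] := boolP (i \in A); by rewrite ?mulr0 ?mul0r.
  ring.
move=> /le_trans; apply; rewrite ler_wpM2r ?exprn_ge0//; lra.
Qed.

Lemma normal_factor_heat_solution (x : V) k : exists K D1 D2,
  heat_solution (pred1 k) K
    (fun s y => normal_cdf ((x k - y k) / Num.sqrt (s k))) D1 D2.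
Proof.
pose q := Num.sqrt s0; pose w s y := (x k - y k) / Num.sqrt (s k).
(* [p] bounds [(s k)^(-1/2)]; adding 1 makes it at least 1, so that [p^4] dominates all the powers
   that occur, just as [1 + 2 c] dominates all the bounds for the Gaussian factors. *)
pose c := @gauss_const R; pose p := 1 + q^-1.
have q0 : 0 < q by rewrite sqrtr_gt0.
have p1 : 1 <= p by rewrite lerDl invr_ge0 ltW.
have c0 : 0 <= c by exact: gauss_const_ge0.
have sqV s : (forall i, s0 <= s i) -> 0 <= (Num.sqrt (s k))^-1 <= p.
  move=> ss; rewrite invr_ge0 sqrtr_ge0/= (@le_trans _ _ q^-1)//.
    by rewrite lef_pV2 ?posrE ?sqrtr_gt0 ?(lt_le_trans s0_gt0)// ler_wsqrtr.
  by rewrite lerDr.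
pose K := (1 + 2 * c) * p ^+ 4.
exists K, (fun i s y => (i == k)%:R * (- (Num.sqrt (s k))^-1 * gauss (w s y))),
  (fun i j s y => ((i == k) && (j == k))%:R *
    (- (Num.sqrt (s k))^-1 ^+ 2 * (w s y * gauss (w s y)))).
have p0 : 0 <= p by lra.
have pn n : (n <= 4)%N -> p ^+ n <= p ^+ 4 by move=> ?; exact: ler_weXn2l.
have p41 : 1 <= p ^+ 4 by exact: exprn_ege1.
have K0 : 0 <= K by rewrite mulr_ge0// ?exprn_ge0//; lra.
have KE a n : (n <= 4)%N -> a <= 1 + 2 * c -> a * p ^+ n <= K.
  move=> n4 ac; rewrite (@le_trans _ _ ((1 + 2 * c) * p ^+ n))//.
    by rewrite ler_wpM2r// exprn_ge0.
  by rewrite ler_wpM2l ?pn//; lra.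
have dwE s y y' : (forall i, s0 <= s i) ->
    `|w s y - w s y'| <= p * \sum_i `|y i - y' i|.
  move=> ss; have /andP[h1 h2] := sqV _ ss.
  have -> : w s y - w s y' = (Num.sqrt (s k))^-1 * (y' k - y k) by rewrite /w; ring.
  rewrite normrM ger0_norm// ler_pM// distrC (bigD1 k)//= lerDl.
  exact: sumr_ge0.
have comp n a (f : R -> R) (r : V -> R) : 0 <= a <= 1 + 2 * c -> (n <= 3)%N ->
    (forall s, (forall i, s0 <= s i) -> `|r s| <= p ^+ n) ->
    (forall t : R, `|f t| <= a) ->
    (forall t t' : R, `|f t' - f t| <= a * `|t' - t|) ->
    measurable_fun setT f -> bdd_lip K (fun s y => r s * f (w s y)).
  move=> /andP[a0 ac] n3 rp fa fl mf; split => //.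
  - move=> s y ss; rewrite normrM (le_trans _ (@KE a n _ _))//; last exact: ltnW.
    by rewrite mulrC ler_pM// rp.
  - move=> s y y' ss; rewrite -mulrBr normrM.
    rewrite (@le_trans _ _ (a * p ^+ n.+1 * \sum_i `|y i - y' i|))//.
      rewrite exprS mulrA -(mulrA (a * p)) (mulrC (p ^+ n)) mulrA mulrC.
      rewrite ler_pM// ?rp//; apply: le_trans (fl _ _) _.
      by rewrite -mulrA ler_wpM2l// dwE.
    by rewrite ler_wpM2r ?sumr_ge0// KE.
  - move=> d T Y s mY; apply: measurable_funM => //.
    apply: measurableT_comp => //; rewrite /w; apply: measurable_funM => //.
    exact: measurable_funB.
have [cR1 cR2] : 0 <= c <= 1 + 2 * c /\ 0 <= 2 * c <= 1 + 2 * c by split; lra.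
have mg : measurable_fun setT (@gauss R) by exact: measurable_normal_pdf.
have bi (b : bool) (f : V -> V -> R) : bdd_lip K f -> bdd_lip K (fun s y => b%:R * f s y).
  case: b => bf; [have -> : (fun s y => true%:R * f s y) = f by
    apply/funext => s; apply/funext => y; rewrite mul1r|] => //.
  have -> : (fun s y => false%:R * f s y) = fun _ _ => 0 by
    apply/funext => s; apply/funext => y; rewrite mul0r.
  exact: bdd_lip_cst0.
split.
- have -> : (fun s y => normal_cdf ((x k - y k) / Num.sqrt (s k))) =
      (fun s y => 1 * normal_cdf (w s y)).
    by apply/funext => s; apply/funext => y; rewrite mul1r.
  apply: (@comp 0 (1 + 2 * c)) => //.
  + by rewrite lexx andbT; lra.
  + by move=> s _; rewrite normr1.
  + move=> z; rewrite ger0_norm ?normal_cdf_ge0// (le_trans (normal_cdf_le1 _))//; lra.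
  + move=> y z; apply: le_trans (normal_cdf_lipschitz _ _) _.
    by rewrite ler_wpM2r// -/c; lra.
  + apply: continuous_measurable_fun => z; apply: differentiable_continuous.
    by apply/derivable1_diffP; have [] := is_derive_normal_cdf z.
- move=> i; apply: bi => //; apply: (@comp 1 c) => //.
  + by move=> s ss; have /andP[h1 h2] := sqV _ ss; rewrite normrN ger0_norm.
  + exact: gauss_bound.
  + exact: gauss_lipschitz.
- move=> i j; apply: bi => //; apply: (@comp 2 (2 * c) (fun t : R => t * gauss t)) => //.
  + move=> s ss; have /andP[h1 h2] := sqV _ ss; rewrite normrN normrX ger0_norm//.
    by rewrite lerXn2r// nnegrE.
  + by move=> z; apply: le_trans (xgauss_bound _) _; rewrite -/c; lra.
  + exact: xgauss_lipschitz.
  + exact: measurable_funM.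
- by move=> i s y; rewrite inE => /negbTE->; rewrite mul0r.
split.
  move=> s y z ss; have /andP[h1 h2] := sqV _ ss.
  set t := (Num.sqrt (s k))^-1 in h1 h2 *.
  have zk : `|z k| <= \sum_i `|z i| by rewrite (bigD1 k)//= lerDl sumr_ge0.
  rewrite (bigD1 k)//= eqxx mul1r big1 ?addr0; last first.
    by move=> i /negbTE->; rewrite !mul0r.
  rewrite [X in 2^-1 * X](bigD1 k)//= [X in 2^-1 * (_ + X)]big1 ?addr0; last first.
    by move=> i /negbTE->; rewrite big1// => j _; rewrite !mul0r.
  rewrite (bigD1 k)//= eqxx mul1r [X in 2^-1 * (_ + X)]big1 ?addr0; last first.
    by move=> i /negbTE->; rewrite !mul0r.
  have -> : (x k - (y k + z k)) / Num.sqrt (s k) = w s y + - (t * z k).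
    by rewrite /w -/t; ring.
  rewrite -/t -[(x k - y k) * t]/(w s y).
  apply: le_trans (le_trans (normal_cdf_taylor (w s y) (- (t * z k))) _).
    by rewrite le_eqVlt; apply/orP; left; apply/eqP; congr (`|_|); field.
  rewrite normrN normrM exprMn mulrA ler_pM ?lerXn2r ?nnegrE ?sumr_ge0 ?exprn_ge0//.
    by rewrite mulr_ge0 ?exprn_ge0// mulr_ge0.
  rewrite (le_trans _ (KE (2 * c) 3%N isT _))//; last lra.
  apply: ler_wpM2l; first by rewrite mulr_ge0.
  by rewrite ger0_norm// lerXn2r// nnegrE.
move=> s y tau ss tt; have /andP[h1 h2] := sqV _ ss.
set t := (Num.sqrt (s k))^-1 in h1 h2 *.
have sk0 : 0 < s k by exact: lt_le_trans (ss k).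
rewrite (bigD1 k)//= eqxx mul1r big1 ?addr0; last first.
  by move=> i /negbTE->; rewrite !mul0r.
have t2 : t ^+ 2 = (s k)^-1 by rewrite /t exprVn sqr_sqrtr// ltW.
have := normal_cdf_heat (w s y) (mulr_ge0 (tt k) (ltW (_ : 0 < (s k)^-1))).
rewrite invr_gt0 => /(_ sk0).
have -> : w s y / Num.sqrt (1 + tau k / s k) = (x k - y k) / Num.sqrt (s k + tau k).
  rewrite /w -mulrA -invfM -sqrtrM ?(ltW sk0)// mulrDr mulr1 mulrCA divff ?mulr1//.
  by rewrite gt_eqF.
rewrite -/(w s y) => H; apply: le_trans (le_trans H _).
  by rewrite le_eqVlt; apply/orP; left; apply/eqP; congr (`|_|); rewrite t2; field; rewrite gt_eqF.
have tk : tau k <= \sum_i tau i by rewrite (bigD1 k)//= lerDl sumr_ge0.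
have -> : gauss_const * (tau k / s k) ^+ 2 = c * t ^+ 4 * tau k ^+ 2.
  rewrite -/c (_ : t ^+ 4 = (t ^+ 2) ^+ 2); last by ring.
  by rewrite t2; ring.
apply: ler_pM; rewrite ?sqr_ge0//.
- by rewrite mulr_ge0// exprn_ge0.
- rewrite (le_trans _ (KE c 4%N isT _))//; last lra.
  by rewrite ler_wpM2l// lerXn2r// nnegrE.
- by rewrite lerXn2r// nnegrE ?sumr_ge0.
Qed.

(** Induction on a duplicate-free list of coordinates. The predicate carried by [heat_solution]
    serves this induction: it records the coordinates already used, so that the next factor depends
    on a new one. *)
Lemma normal_product_heat_solution (x : V) : exists K D1 D2,
  heat_solution predT K
    (fun s y => \prod_i normal_cdf ((x i - y i) / Num.sqrt (s i))) D1 D2.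
Proof.
pose u r s y := \prod_(i <- r) normal_cdf ((x i - y i) / Num.sqrt (s i)).
suff H (r : seq 'I_m) : uniq r -> exists K D1 D2, heat_solution (mem r) K (u r) D1 D2.
  have [K [D1 [D2 [? ? ? ? ?]]]] := H _ (index_enum_uniq _).
  by exists K, D1, D2; split => // i s y.
elim: r => [_|k r IH /= /andP[kr /IH[K [D1 [D2 Hr]]]]].
  exists 1, (fun _ _ _ => 0), (fun _ _ _ _ => 0).
  have -> : u [::] = fun _ _ => 1.
    by apply/funext => s; apply/funext => y; rewrite /u big_nil.
  exact: heat_solution1.
have [K' [E1 [E2 Hk]]] := normal_factor_heat_solution x k.
have leK : K <= Num.max K K' by rewrite le_max lexx.
have leK' : K' <= Num.max K K' by rewrite le_max lexx orbT.
have [|F1 [F2 HF]] := heat_solutionM (heat_solution_le leK' Hk)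
  (heat_solution_le leK Hr).
  by move=> i; rewrite inE => /eqP->.
exists (8 * Num.max K K' ^+ 2), F1, F2.
have -> : u (k :: r) = fun s y =>
    normal_cdf ((x k - y k) / Num.sqrt (s k)) * u r s y.
  by apply/funext => s; apply/funext => y; rewrite /u big_cons.
by case: HF => ? ? ? D ?; split => // i s y ir; exact: D.
Qed.

End heat_solutions.

(** * Independence and expectations *)

Section independent_pair.
Local Open Scope ereal_scope.
Context d d1 d2 (T : measurableType d) (R : realType) (P : probability T R)
  (E1 : measurableType d1) (E2 : measurableType d2)
  (X : {mfun T >-> E1}) (V : {mfun T >-> E2}).
Hypothesis indepXV : forall A B, measurable A -> measurable B ->
  P (X @^-1` A `&` V @^-1` B) = P (X @^-1` A) * P (V @^-1` B).

Let XV w := (X w, V w).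

Let mXV : measurable_fun setT XV.
Proof. exact: measurable_fun_pair. Qed.

HB.instance Definition _ := isMeasurableFun.Build _ _ _ _ XV mXV.

Let joint_law A : measurable A ->
  (distribution P X \x distribution P V) A = distribution P XV A.
Proof.
apply: product_measure_unique => A' B mA mB.
exact: indepXV.
Qed.

(** Independence on rectangles identifies the law of the pair with the product of the laws, and
    Tonelli's theorem factors the integral. The target spaces are arbitrary because the second
    variable will be the identity map into a coarser sigma-algebra. *)
Lemma ge0_integral_independent (f : E1 -> \bar R) (g : E2 -> \bar R) :
  measurable_fun setT f -> measurable_fun setT g ->
  (forall x, 0 <= f x) -> (forall y, 0 <= g y) ->
  \int[P]_w (f (X w) * g (V w)) = \int[P]_w f (X w) * \int[P]_w g (V w).
Proof.
move=> mf mg f0 g0.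
pose h (z : E1 * E2) := f z.1 * g z.2.
have mh : measurable_fun setT h.
  by apply: emeasurable_funM; exact: measurableT_comp.
have h0 z : 0 <= h z by rewrite mule_ge0.
have -> : \int[P]_w (f (X w) * g (V w)) = \int[distribution P XV]_z h z.
  by rewrite ge0_integral_distribution.
rewrite (eq_measure_integral (distribution P X \x distribution P V)); last first.
  by move=> A mA _; exact/esym/joint_law.
rewrite fubini_tonelli1//= /fubini_F/=.
under eq_integral do rewrite /h/= ge0_integralZl//.
rewrite ge0_integralZr//; last exact: integral_ge0.
by rewrite !ge0_integral_distribution.
Qed.

Lemma integrable_independent (f : E1 -> R) (g : E2 -> R) :
  measurable_fun setT f -> measurable_fun setT g ->
  P.-integrable setT (EFin \o (f \o X)) -> P.-integrable setT (EFin \o (g \o V)) ->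
  P.-integrable setT (fun w => (f (X w) * g (V w))%:E).
Proof.
move=> mf mg fi gi; apply/integrableP; split.
  by apply/measurable_EFinP; apply: measurable_funM; exact: measurableT_comp.
under eq_integral do rewrite /= normrM EFinM.
rewrite (ge0_integral_independent (f := fun x => `|f x|%:E) (g := fun x => `|g x|%:E))//.
- apply: lte_mul_pinfty; [exact: integral_ge0| |].
    by have /integrableP[] := fi; rewrite ge0_fin_numE// integral_ge0.
  by have /integrableP[] := gi.
- by apply/measurable_EFinP; exact: measurableT_comp.
- by apply/measurable_EFinP; exact: measurableT_comp.
Qed.

Lemma Rintegral_independent (f : E1 -> R) (g : E2 -> R) :
  measurable_fun setT f -> measurable_fun setT g ->
  P.-integrable setT (EFin \o (f \o X)) -> P.-integrable setT (EFin \o (g \o V)) ->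
  (\int[P]_w (f (X w) * g (V w)) = \int[P]_w f (X w) * \int[P]_w g (V w))%R.
Proof.
move=> mf mg fi gi.
pose h (z : E1 * E2) := (f z.1 * g z.2)%:E.
have mh : measurable_fun setT h.
  apply/measurable_EFinP.
  by apply: measurable_funM; exact: measurableT_comp.
have hi : P.-integrable setT (h \o XV) by exact: integrable_independent.
have hi' : (distribution P X \x distribution P V).-integrable setT h.
  apply/integrableP; split=> //.
  rewrite (eq_measure_integral (distribution P XV)) => [|A mA _]; last exact: joint_law.
  rewrite ge0_integral_distribution//; first by have /integrableP[] := hi.
  exact: measurableT_comp.
have -> : (\int[P]_w (f (X w) * g (V w)))%R = fine (\int[distribution P XV]_z h z).
  by rewrite integral_distribution.
rewrite (eq_measure_integral (distribution P X \x distribution P V)); last first.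
  by move=> A mA _; exact/esym/joint_law.
have fi' : (distribution P X).-integrable setT (EFin \o f).
  by apply: integrable_pushforward => //; exact/measurable_EFinP.
have gi' : (distribution P V).-integrable setT (EFin \o g).
  by apply: integrable_pushforward => //; exact/measurable_EFinP.
rewrite -integral12_prod_meas1//= /fubini_F/=.
under eq_integral do rewrite /h/= (integralZl _ gi')//.
have gf : \int[distribution P V]_y (g y)%:E \is a fin_num by exact: integrable_fin_num gi'.
under eq_integral do rewrite muleC.
have <- := @fineK _ (\int[distribution P V]_y (g y)%:E) gf.
rewrite integralZl// fineM//; last exact: integrable_fin_num fi'.
rewrite mulrC; congr (_ * _)%R; rewrite /Rintegral/=; congr fine.
  by rewrite integral_distribution//; exact/measurable_EFinP.
by rewrite integral_distribution//; exact/measurable_EFinP.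
Qed.

End independent_pair.

(** * Independence from the past *)

Section filtration.
Context d (T : measurableType d) (R : realType) (P : probability T R)
  (Y : nat -> {mfun T >-> R}) (N : nat).

(** Constraints on fewer variables are obtained by taking [B t] equal to the whole line. *)
Definition independent_below : Prop := forall B : nat -> set R,
  (forall t, measurable (B t)) ->
  P (\bigcap_(t in `I_N) Y t @^-1` B t) = (\prod_(t < N) P (Y t @^-1` B t))%E.

Definition past_cylinders k : set (set T) :=
  [set A | exists2 B : nat -> set R, forall t, measurable (B t) &
    A = \bigcap_(t in `I_k) Y t @^-1` B t].

(* The type [T] equipped with the sigma-algebra generated by the [Y t], [t < k]. *)
Definition past k := g_sigma_algebraType (past_cylinders k).

Lemma past_cylinders_measurable k : past_cylinders k `<=` d.-measurable.
Proof.
move=> _ [B mB ->]; apply: fin_bigcap_measurable => // t _.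
by rewrite -[X in measurable X]setTI; exact: measurable_funP.
Qed.

Lemma past_cylindersI k : setI_closed (past_cylinders k).
Proof.
move=> _ _ [B mB ->] [C mC ->]; exists (fun t => B t `&` C t).
  by move=> t; exact: measurableI.
by rewrite -bigcapI; apply: eq_bigcapr => t _; rewrite preimage_setI.
Qed.

Lemma past_cylindersT k : past_cylinders k setT.
Proof.
exists (fun=> setT) => //.
by apply/seteqP; split => w //= _ t _.
Qed.

Lemma past_cylinders_sub k l : (k <= l)%N -> past_cylinders k `<=` past_cylinders l.
Proof.
move=> kl _ [B mB ->]; exists (fun t => if (t < k)%N then B t else setT).
  by move=> t; case: ifPn.
apply/seteqP; split => w /= Bw t /= tk; first by case: ifPn => //; exact: Bw.
by have := Bw t (leq_trans tk kl); rewrite tk.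
Qed.

Lemma past_measurable k : @measurable _ (past k) `<=` d.-measurable.
Proof.
apply: smallest_sub; first exact: sigma_algebra_measurable.
exact: past_cylinders_measurable.
Qed.

(** The identity seen as a random variable with values in [past k]: independence of [Y k] from the
    past becomes independence of two random variables. *)
Let to_past k (w : T) : past k := w.

Lemma measurable_to_past k : measurable_fun setT (@to_past k).
Proof. by move=> _ A mA; rewrite setTI; exact: past_measurable mA. Qed.

HB.instance Definition _ k :=
  isMeasurableFun.Build _ _ _ _ (@to_past k) (@measurable_to_past k).

Lemma measurable_past k (f : T -> R) :
  measurable_fun (setT : set (past k)) f -> measurable_fun setT f.
Proof.
by move=> mf; apply: (measurableT_comp (f := f : past k -> R) mf (@measurable_to_past k)).
Qed.

Lemma measurable_past_le k l (f : T -> R) : (k <= l)%N ->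
  measurable_fun (setT : set (past k)) f -> measurable_fun (setT : set (past l)) f.
Proof.
move=> kl mf _ A mA; have := mf measurableT A mA.
exact: (sub_sigma_algebra2 (past_cylinders_sub kl)).
Qed.

Lemma measurable_past_index k t : (t < k)%N ->
  measurable_fun (setT : set (past k)) (Y t : T -> R).
Proof.
move=> tk _ A mA; rewrite setTI; apply: sub_sigma_algebra.
exists (fun s => if s == t then A else setT).
  by move=> s; case: ifPn.
apply/seteqP; split => w /= h; last by have := h t tk; rewrite eqxx.
by move=> s /= _; case: ifPn => // /eqP->.
Qed.

Hypothesis indY : independent_below.

(** For fixed [A], both sides are finite measures in [B]. They agree on the cylinders, which are
    stable under intersection and generate the sigma-algebra. *)
Lemma independent_past k A B : (k < N)%N -> measurable A ->
  measurable (B : set (past k)) ->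
  P (Y k @^-1` A `&` B) = (P (Y k @^-1` A) * P B)%E.
Proof.
move=> kN mA mB.
have mYA : measurable (Y k @^-1` A).
  by rewrite -[X in measurable X]setTI; exact: measurable_funP.
pose m1 := mrestr P mYA; pose m2 := mscale (NngNum (fine_ge0 (measure_ge0 P (Y k @^-1` A)))) P.
have m2E D : m2 D = (P (Y k @^-1` A) * P D)%E.
  by rewrite /m2 /mscale; congr (_ * _)%E; rewrite /= fineK ?fin_num_measure.
have m1E D : m1 D = P (Y k @^-1` A `&` D) by rewrite setIC.
rewrite -m1E -m2E.
apply: (@g_sigma_algebra_measure_unique _ _ _ (past_cylinders k)
  (@past_cylinders_measurable k) (fun=> setT) (fun=> @past_cylindersT k) _ m1 m2
  (@past_cylindersI k) _ _ B mB).
- by rewrite bigcup_const.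
- move=> _ [C mC ->]; apply: etrans (m1E _) (etrans _ (esym (m2E _))).
  rewrite setIC.
  (* The cylinder is extended by [D] at index [k] and is unconstrained beyond it; [D = A] gives the
     intersection, and [D = setT] the probability of the cylinder alone. *)
  pose C' (D : set R) t := if (t < k)%N then C t else if t == k then D else setT.
  have prodE (D : set R) : measurable D ->
      P (\bigcap_(t in `I_k) Y t @^-1` C t `&` Y k @^-1` D) =
      ((\prod_(t < k) P (Y t @^-1` C t)) * P (Y k @^-1` D))%E.
    move=> mD; transitivity (P (\bigcap_(t in `I_N) Y t @^-1` C' D t)).
      congr (P _); apply/seteqP; split => w /=.
        move=> [wC wD] t tN; rewrite /C'; case: ltnP => tk; first exact: wC.
        by case: eqP => // ->.
      move=> H; split => [t /= tk|].
        by have := H t (ltn_trans tk kN); rewrite /C' tk.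
      by have := H k kN; rewrite /C' ltnn eqxx.
    rewrite indY; last by move=> t; rewrite /C'; do 2 case: ifPn => // _.
    rewrite -(big_mkord xpredT (fun t => P (Y t @^-1` C' D t))).
    rewrite (big_cat_nat (n := k.+1))//= big_nat_recr//= [X in (_ * X)%E]big1_seq.
      rewrite mule1 /C' ltnn eqxx; congr (_ * _)%E.
      by rewrite big_mkord; apply: eq_bigr => t _; rewrite ltn_ord.
    move=> t /andP[_]; rewrite mem_index_iota => /andP[kt _].
    by rewrite /C' ltnNge (ltnW kt)/= gtn_eqF// preimage_setT probability_setT.
  rewrite prodE// muleC; congr (_ * _)%E.
  by have := prodE setT measurableT; rewrite preimage_setT setIT probability_setT mule1.
- by move=> _; rewrite [ltLHS]m1E setIT ltey_eq fin_num_measure.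
Qed.

Lemma integrable_past k (f : R -> R) (G : T -> R) : (k < N)%N ->
  measurable_fun setT f -> measurable_fun (setT : set (past k)) G ->
  P.-integrable setT (EFin \o (f \o Y k)) -> P.-integrable setT (EFin \o G) ->
  P.-integrable setT (fun w => (f (Y k w) * G w)%:E).
Proof.
move=> kN mf mG fi Gi.
apply: (@integrable_independent _ _ _ _ _ P _ _ (Y k) (@to_past k) _ f G) => // A B mA mB.
exact: independent_past.
Qed.

Lemma Rintegral_past k (f : R -> R) (G : T -> R) : (k < N)%N ->
  measurable_fun setT f -> measurable_fun (setT : set (past k)) G ->
  P.-integrable setT (EFin \o (f \o Y k)) -> P.-integrable setT (EFin \o G) ->
  \int[P]_w (f (Y k w) * G w) = \int[P]_w f (Y k w) * \int[P]_w G w.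
Proof.
move=> kN mf mG fi Gi.
apply: (@Rintegral_independent _ _ _ _ _ P _ _ (Y k) (@to_past k) _ f G) => // A B mA mB.
exact: independent_past.
Qed.

End filtration.

(** * Integrability and expectation of real random variables *)

Section real_expectation.
Context d (T : measurableType d) (R : realType) (P : probability T R).
Implicit Types (f g h : T -> R) (K : R).

Definition intg f : Prop := P.-integrable setT (EFin \o f).

Lemma intg_measurable f : intg f -> measurable_fun setT f.
Proof. by move=> /integrableP[/measurable_EFinP]. Qed.

Lemma intg_le f h : measurable_fun setT f -> intg h ->
  (forall w, `|f w| <= h w) -> intg f.
Proof.
move=> mf ih fh; apply: le_integrable ih => //.
  exact/measurable_EFinP.
by move=> w _ /=; rewrite lee_fin (le_trans (fh w))// ler_norm.
Qed.

Lemma intg_cst K : intg (fun=> K).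
Proof. exact: finite_measure_integrable_cst. Qed.

Lemma intg_bounded f K : measurable_fun setT f -> (forall w, `|f w| <= K) -> intg f.
Proof. by move=> mf fK; exact: intg_le (intg_cst K) fK. Qed.

Lemma intgD f g : intg f -> intg g -> intg (fun w => f w + g w).
Proof. by move=> fi gi; have := integrableD measurableT fi gi. Qed.

Lemma intgZ f K : intg f -> intg (fun w => K * f w).
Proof. by move=> fi; have := integrableZl measurableT K fi. Qed.

Lemma intgB f g : intg f -> intg g -> intg (fun w => f w - g w).
Proof. by move=> fi gi; have := integrableB measurableT fi gi. Qed.

Lemma intg_sum (I : eqType) (r : seq I) (F : I -> T -> R) :
  (forall i, i \in r -> intg (F i)) -> intg (fun w => \sum_(i <- r) F i w).
Proof.
elim: r => [_|i r IH iF].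
  by under [X in intg X]eq_fun do rewrite big_nil; exact: intg_cst.
under [X in intg X]eq_fun do rewrite big_cons.
apply: intgD; first by apply: iF; rewrite inE eqxx.
by apply: IH => j jr; apply: iF; rewrite inE jr orbT.
Qed.

Lemma intg_norm f : intg f -> intg (fun w => `|f w|).
Proof. by move=> fi; have := integrable_norm fi. Qed.

Lemma intgM_bounded f g K : intg f -> measurable_fun setT g ->
  (forall w, `|g w| <= K) -> intg (fun w => g w * f w).
Proof.
move=> fi mg gK; apply: (@intg_le _ (fun w => K * `|f w|)).
- by apply: measurable_funM => //; exact: intg_measurable.
- exact/intgZ/intg_norm.
- by move=> w; rewrite normrM ler_wpM2r.
Qed.

Lemma Rintegral_add f g : intg f -> intg g ->
  \int[P]_w (f w + g w) = \int[P]_w f w + \int[P]_w g w.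
Proof. by move=> fi gi; exact: RintegralD. Qed.

Lemma Rintegral_sub f g : intg f -> intg g ->
  \int[P]_w (f w - g w) = \int[P]_w f w - \int[P]_w g w.
Proof. by move=> fi gi; exact: RintegralB. Qed.

Lemma Rintegral_scale f K : intg f -> \int[P]_w (K * f w) = K * \int[P]_w f w.
Proof. by move=> fi; exact: RintegralZl. Qed.

Lemma Rintegral_const K : \int[P]_w K = K.
Proof.
by rewrite Rintegral_cst//= probability_setT/= mulr1.
Qed.

Lemma Rintegral_sumr (I : eqType) (r : seq I) (F : I -> T -> R) :
  (forall i, i \in r -> intg (F i)) ->
  \int[P]_w (\sum_(i <- r) F i w) = \sum_(i <- r) \int[P]_w F i w.
Proof.
elim: r => [_|i r IH iF].
  by under eq_Rintegral do rewrite big_nil; rewrite Rintegral_const big_nil.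
have ir : intg (F i) by apply: iF; rewrite inE eqxx.
have rF j : j \in r -> intg (F j) by move=> jr; apply: iF; rewrite inE jr orbT.
under eq_Rintegral do rewrite big_cons.
by rewrite Rintegral_add ?IH ?big_cons//; exact: intg_sum.
Qed.

Lemma Rintegral_le f g : intg f -> intg g -> (forall w, f w <= g w) ->
  \int[P]_w f w <= \int[P]_w g w.
Proof. by move=> fi gi fg; exact: le_Rintegral. Qed.

Lemma Rintegral_norm_le f h : intg f -> intg h -> (forall w, `|f w| <= h w) ->
  `|\int[P]_w f w| <= \int[P]_w h w.
Proof.
move=> fi hi fh; apply: le_trans (le_normr_Rintegral _ fi) _ => //.
by apply: Rintegral_le => //; exact: intg_norm.
Qed.

Lemma Rintegral_norm_le_cst f h K K' : intg f -> intg h ->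
  (forall w, `|f w| <= K * h w) -> 0 <= K -> \int[P]_w h w <= K' ->
  `|\int[P]_w f w| <= K * K'.
Proof.
move=> fi hi fh K0 hK; apply: le_trans (Rintegral_norm_le fi (intgZ K hi) fh) _.
by rewrite Rintegral_scale// ler_wpM2l.
Qed.

Lemma probability_markov f (eps : R) : 0 < eps -> intg f ->
  fine (P [set w | eps <= `|f w|]) <= eps^-1 * \int[P]_w `|f w|.
Proof.
move=> e0 fi.
have mf := intg_measurable fi.
have mA : measurable [set w | eps <= `|f w|].
  rewrite (_ : [set _ | _] = (fun w => `|f w|) @^-1` `[eps, +oo[).
    by rewrite -[X in measurable X]setTI; apply: measurableT_comp.
  by apply/seteqP; split => w /=; rewrite in_itv/= andbT.
rewrite -(Rintegral_scale _ (intg_norm fi)).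
have -> : fine (P [set w | eps <= `|f w|]) = \int[P]_w \1_[set w | eps <= `|f w|] w.
  by rewrite /Rintegral integral_indic// setIT.
apply: Rintegral_le => [||w].
- apply: (@intg_bounded _ 1); first exact: measurable_indic.
  by move=> w; rewrite indicE; case: (_ \in _); rewrite ?normr1 ?normr0.
- exact/intgZ/intg_norm.
- rewrite indicE; have [/set_mem/= ew|_] := boolP (_ \in _).
    by rewrite mulrC ler_pdivlMr// mul1r.
  by rewrite mulr_ge0// invr_ge0 ltW.
Qed.

End real_expectation.

(** * The Lindeberg method for lagged products *)

Section elementary_bounds.
Context {R : realType}.
Implicit Types x y z u : R.

Lemma norm_expr_le p x : (p <= 4)%N -> `|x| ^+ p <= 1 + x ^+ 4.
Proof.
move=> p4; have x4 : 0 <= x ^+ 4 by rewrite exprn_even_ge0.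
have [x1|/ltW x1] := leP `|x| 1.
  by rewrite (le_trans (exprn_ile1 _ _ _))// lerDl.
rewrite (@le_trans _ _ (`|x| ^+ 4))//; first exact: ler_weXn2l.
by rewrite -normrX ger0_norm// lerDr.
Qed.

Lemma norm_mul2_le x y : `|x * y| <= 2^-1 * (1 + x ^+ 4) + 2^-1 * (1 + y ^+ 4).
Proof.
have := norm_expr_le x (isT : (2 <= 4)%N); have := norm_expr_le y (isT : (2 <= 4)%N).
rewrite normrM; set a := `|x|; set b := `|y|.
have : 0 <= (a - b) ^+ 2 by rewrite sqr_ge0.
nra.
Qed.

(** The inequality [2 a b <= a^2 + b^2], used twice. It controls any product of four values of [Y],
    repeated indices included and without independence, by the moment bound [kappa]. *)
Lemma norm_mul4_le x y z u : `|x * y * (z * u)| <=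
  4^-1 * (1 + x ^+ 4) + 4^-1 * (1 + y ^+ 4) + (4^-1 * (1 + z ^+ 4) + 4^-1 * (1 + u ^+ 4)).
Proof.
have e (t : R) : t ^+ 4 = `|t| ^+ 4 by rewrite -normrX ger0_norm// exprn_even_ge0.
rewrite !normrM (e x) (e y) (e z) (e u).
move: `|x| `|y| `|z| `|u| => {x y z u e} a b c r.
have h1 : 2 * (a * b * (c * r)) <= (a * b) ^+ 2 + (c * r) ^+ 2.
  by have := sqr_ge0 (a * b - c * r); nra.
have h2 (s t : R) : 2 * (s * t) ^+ 2 <= s ^+ 4 + t ^+ 4.
  by have := sqr_ge0 (s ^+ 2 - t ^+ 2); rewrite exprMn; nra.
have := h2 a b; have := h2 c r; lra.
Qed.

(** Iterate [(a + b)^3 <= 4 (a^3 + b^3)]. The exponential constant is harmless, since the list will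
    have the fixed length [m]. *)
Lemma sum_expr3_le (I : Type) (r : seq I) (x : I -> R) : (forall i, 0 <= x i) ->
  (\sum_(i <- r) x i) ^+ 3 <= 4 ^+ size r * \sum_(i <- r) x i ^+ 3.
Proof.
move=> x0; elim: r => [|i r IH].
  by rewrite !big_nil expr0n mulr0.
rewrite !big_cons/= [4 ^+ _.+1]exprS.
set s := \sum_(i <- r) x i in IH *; set c := \sum_(i <- r) _ in IH *.
have s0 : 0 <= s by exact: sumr_ge0.
have c0 : 0 <= c by apply: sumr_ge0 => j _; exact: exprn_ge0.
have x30 : 0 <= x i ^+ 3 by exact: exprn_ge0.
have p1 : 1 <= 4 ^+ size r :> R by rewrite exprn_ege1// ler1n.
have h : (x i + s) ^+ 3 <= 4 * (x i ^+ 3 + s ^+ 3).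
  rewrite -subr_ge0 (_ : _ - _ = 3 * ((x i + s) * (x i - s) ^+ 2)); last by ring.
  by rewrite mulr_ge0// mulr_ge0 ?sqr_ge0 ?addr_ge0.
apply: le_trans h _; rewrite -mulrA ler_wpM2l// mulrDr lerD//.
exact: ler_peMl.
Qed.

End elementary_bounds.

Section lindeberg.
Context d (T : measurableType d) (R : realType) (P : probability T R)
  (Y : nat -> {mfun T >-> R}) (n m : nat) (kappa : R).
Hypothesis Y0 : forall w, Y 0%N w = 0.
Hypothesis indY : independent_below P Y n.+1.
Hypothesis intY4 : forall t, (t <= n)%N -> intg P (fun w => 1 + Y t w ^+ 4).
Hypothesis kappaY : forall t, (t <= n)%N -> \int[P]_w (1 + Y t w ^+ 4) <= kappa.
Hypothesis meanY : forall t, (t <= n)%N -> \int[P]_w Y t w = 0.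

Let mY t : measurable_fun setT (Y t : T -> R).
Proof. exact: measurable_funP. Qed.

Let kappa1 : 1 <= kappa.
Proof.
apply: le_trans (kappaY (leq0n n)); rewrite -[leLHS](Rintegral_const P).
apply: Rintegral_le; [exact: intg_cst|exact: intY4|move=> w].
by rewrite lerDl exprn_even_ge0.
Qed.

Let kappa0 : 0 <= kappa. Proof. exact: le_trans kappa1. Qed.

Let norm_expr_moment p t : (p <= 4)%N -> (t <= n)%N ->
  intg P (fun w => `|Y t w| ^+ p) /\ \int[P]_w `|Y t w| ^+ p <= kappa.
Proof.
move=> p4 tn.
have i : intg P (fun w => `|Y t w| ^+ p).
  apply: intg_le (intY4 tn) _.
    by apply: measurable_funX; exact: measurableT_comp.
  by move=> w; rewrite ger0_norm ?exprn_ge0// norm_expr_le.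
split => //; apply: le_trans (kappaY tn).
by apply: Rintegral_le => // [|w]; [exact: intY4|exact: norm_expr_le].
Qed.

Let mul4_moment a b c e : (a <= n)%N -> (b <= n)%N -> (c <= n)%N -> (e <= n)%N ->
  intg P (fun w => Y a w * Y b w * (Y c w * Y e w)) /\
  \int[P]_w `|Y a w * Y b w * (Y c w * Y e w)| <= kappa.
Proof.
move=> an bn cn en.
have ih : intg P (fun w => 4^-1 * (1 + Y a w ^+ 4) + 4^-1 * (1 + Y b w ^+ 4) +
    (4^-1 * (1 + Y c w ^+ 4) + 4^-1 * (1 + Y e w ^+ 4))).
  by repeat (apply: intgD); apply: intgZ; exact: intY4.
have i : intg P (fun w => Y a w * Y b w * (Y c w * Y e w)).
  apply: intg_le ih _ => [|w]; last exact: norm_mul4_le.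
  by apply: measurable_funM; exact: measurable_funM.
split => //; apply: le_trans (Rintegral_le (intg_norm i) ih _) _ => [w|].
  exact: norm_mul4_le.
rewrite !Rintegral_add; try by [exact: intgZ (intY4 _)|
  apply: intgD; apply: intgZ; exact: intY4].
rewrite !Rintegral_scale; try exact: intY4.
have := kappaY an; have := kappaY bn; have := kappaY cn; have := kappaY en.
lra.
Qed.

Let mul2_moment a b : (a <= n)%N -> (b <= n)%N ->
  intg P (fun w => Y a w * Y b w) /\ \int[P]_w `|Y a w * Y b w| <= kappa.
Proof.
move=> an bn.
have ih : intg P (fun w => 2^-1 * (1 + Y a w ^+ 4) + 2^-1 * (1 + Y b w ^+ 4)).
  by apply: intgD; apply: intgZ; exact: intY4.
have i : intg P (fun w => Y a w * Y b w).
  apply: intg_le ih _ => [|w]; last exact: norm_mul2_le.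
  exact: measurable_funM.
split => //; apply: le_trans (Rintegral_le (intg_norm i) ih _) _ => [w|].
  exact: norm_mul2_le.
rewrite !Rintegral_add; try by [exact: intgZ (intY4 _)].
rewrite !Rintegral_scale; try exact: intY4.
have := kappaY an; have := kappaY bn.
lra.
Qed.

Definition second_moment t : R := \int[P]_w Y t w ^+ 2.

Local Notation v := second_moment.

Let v_ge0 t : 0 <= v t.
Proof. by apply: Rintegral_ge0 => w _; exact: sqr_ge0. Qed.

Let v_le t : (t <= n)%N -> v t <= kappa.
Proof.
move=> tn; have [_] := norm_expr_moment (isT : (2 <= 4)%N) tn.
by under eq_Rintegral do rewrite -normrX ger0_norm ?sqr_ge0//.
Qed.

Let v0 : v 0 = 0.
Proof.
rewrite /v; under eq_Rintegral do rewrite Y0 expr0n/=.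
exact: Rintegral_const.
Qed.

(** Coordinate [i] carries the lag [i + 1]. For [s <= i] the truncated index [s - i.+1] is 0, and
    the term vanishes because [Y 0 = 0]; thus all the coordinates share one range of summation. *)
Definition lag_sum t (w : T) (i : 'I_m) : R :=
  (Num.sqrt n%:R)^-1 * \sum_(s < t.+1) Y s w * Y (s - i.+1)%N w.

Local Notation c := ((Num.sqrt n%:R)^-1 : R).
Local Notation S := lag_sum.

Let c0 : 0 <= c. Proof. by rewrite invr_ge0 sqrtr_ge0. Qed.

Lemma lag_sum0 w i : S 0 w i = 0.
Proof. by rewrite /S big_ord_recr big_ord0/= Y0 mul0r addr0 mulr0. Qed.

Lemma lag_sumS t w i : S t.+1 w i = S t w i + c * (Y t.+1 w * Y (t - i)%N w).
Proof. by rewrite /S big_ord_recr/= subSS mulrDr. Qed.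

Lemma measurable_lag_sum_past t i :
  measurable_fun (setT : set (past Y t.+1)) (fun w => S t w i).
Proof.
apply: measurable_funM => //; apply: measurable_sum => s.
apply: measurable_funM; apply: measurable_past_index => //.
by rewrite (leq_ltn_trans _ (ltn_ord s))// leq_subr.
Qed.

Lemma measurable_lag_sum t i : measurable_fun setT (fun w => S t w i).
Proof. exact: measurable_past (@measurable_lag_sum_past t i). Qed.

Context (s0 : R) (s0_gt0 : 0 < s0) (K : R) (u : ('I_m -> R) -> ('I_m -> R) -> R)
  (D1 : 'I_m -> ('I_m -> R) -> ('I_m -> R) -> R)
  (D2 : 'I_m -> 'I_m -> ('I_m -> R) -> ('I_m -> R) -> R).
Hypothesis u_heat : heat_solution s0 predT K u D1 D2.

Let K0 : 0 <= K. Proof. by have [[]] := u_heat. Qed.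

Let bdd_lip_intg f t s : bdd_lip s0 K f -> (forall i, s0 <= s i) ->
  intg P (fun w => f s (S t w)).
Proof.
move=> [_ fb _ fm] ss; apply: (@intg_bounded _ _ _ _ _ K).
  by apply: fm => i; exact: measurable_lag_sum.
by move=> w; exact: fb.
Qed.

Let bdd_lip_past f t s : bdd_lip s0 K f ->
  measurable_fun (setT : set (past Y t.+1)) (fun w => f s (S t w)).
Proof.
move=> [_ _ _ fm].
exact: (fm _ (past Y t.+1) (S t) s (fun i => @measurable_lag_sum_past t i)).
Qed.

Let moment1 t : (t <= n)%N -> intg P (Y t).
Proof.
move=> tn; apply: intg_le (norm_expr_moment (isT : (1 <= 4)%N) tn).1 _ => //.
Qed.

Let moment2 t : (t <= n)%N -> intg P (fun w => Y t w ^+ 2).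
Proof.
move=> tn; apply: intg_le (norm_expr_moment (isT : (2 <= 4)%N) tn).1 _ => [|w].
  exact: measurable_funX.
by rewrite normrX.
Qed.

Let mean_past t (G : T -> R) : (t <= n)%N ->
  measurable_fun (setT : set (past Y t)) G -> intg P G ->
  intg P (fun w => Y t w * G w) /\ \int[P]_w (Y t w * G w) = 0.
Proof.
move=> tn mG Gi; have mid : measurable_fun [set: R] (@id R) by exact: measurable_id.
split; first exact: (integrable_past indY tn mid mG (moment1 tn) Gi).
by rewrite (Rintegral_past indY tn mid mG (moment1 tn) Gi) meanY// mul0r.
Qed.

Let square_past t (G : T -> R) : (t <= n)%N ->
  measurable_fun (setT : set (past Y t)) G -> intg P G ->
  intg P (fun w => Y t w ^+ 2 * G w) /\
  \int[P]_w (Y t w ^+ 2 * G w) = v t * \int[P]_w G w.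
Proof.
move=> tn mG Gi.
have m2 : measurable_fun [set: R] (fun x : R => x ^+ 2) by exact: measurable_funX.
split; first exact: (integrable_past indY tn m2 mG (moment2 tn) Gi).
exact: (Rintegral_past indY tn m2 mG (moment2 tn) Gi).
Qed.

(** The Taylor remainder involves a product of degree six. Independence splits it into two third
    moments, so fourth moments of [Y] are enough. *)
Let cube_past t a : (t <= n)%N -> (a < t)%N ->
  intg P (fun w => `|Y t w| ^+ 3 * `|Y a w| ^+ 3) /\
  \int[P]_w (`|Y t w| ^+ 3 * `|Y a w| ^+ 3) <= kappa ^+ 2.
Proof.
move=> tn a_t; have an : (a <= n)%N by rewrite (leq_trans (ltnW a_t)).
have m3 : measurable_fun [set: R] (fun x : R => `|x| ^+ 3).
  exact: measurable_funX.
have [i1 h1] := norm_expr_moment (isT : (3 <= 4)%N) tn.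
have [i2 h2] := norm_expr_moment (isT : (3 <= 4)%N) an.
have mG : measurable_fun (setT : set (past Y t)) (fun w => `|Y a w| ^+ 3).
  apply: (measurableT_comp m3); exact: measurable_past_index.
split; first exact: (integrable_past indY tn m3 mG i1 i2).
rewrite (Rintegral_past indY tn m3 mG i1 i2) expr2 ler_pM//.
- by apply: Rintegral_ge0 => w _; exact: exprn_ge0.
- by apply: Rintegral_ge0 => w _; exact: exprn_ge0.
Qed.

(** * One step of the Lindeberg replacement *)

Section one_step.
Variables (k : nat) (s : 'I_m -> R).
Hypotheses (kn : (k < n)%N) (ss : forall i, s0 <= s i).

Let ki i : (k - i <= n)%N.
Proof. by rewrite (leq_trans (leq_subr _ _))// ltnW. Qed.

Let past_ki i : measurable_fun (setT : set (past Y k.+1)) (Y (k - i)%N).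
Proof. by apply: measurable_past_index; rewrite ltnS leq_subr. Qed.

Let linear_term i :
  intg P (fun w => D1 i s (S k w) * (c * (Y k.+1 w * Y (k - i)%N w))) /\
  \int[P]_w (D1 i s (S k w) * (c * (Y k.+1 w * Y (k - i)%N w))) = 0.
Proof.
have [_ D1b _ _ _] := u_heat; have [_ D1bd _ _] := D1b i.
have [||h1 h2] := @mean_past k.+1 (fun w => D1 i s (S k w) * Y (k - i)%N w) kn.
- by apply: measurable_funM => //; exact: bdd_lip_past.
- apply: (@intgM_bounded _ _ _ _ _ _ K); first exact: moment1.
    exact: measurable_past (@bdd_lip_past (D1 i) k s (D1b i)).
  by move=> w; exact: D1bd.
have -> : (fun w => D1 i s (S k w) * (c * (Y k.+1 w * Y (k - i)%N w))) =
    fun w => c * (Y k.+1 w * (D1 i s (S k w) * Y (k - i)%N w)).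
  by apply/funext => w; ring.
by split; [exact: intgZ|rewrite Rintegral_scale// h2 mulr0].
Qed.

Let D2_past_term i j :
  intg P (fun w => D2 i j s (S k w) * (Y (k - i)%N w * Y (k - j)%N w)).
Proof.
have [_ _ D2b _ _] := u_heat; have [_ D2bd _ _] := D2b i j.
apply: (@intgM_bounded _ _ _ _ _ _ K); first exact: (mul2_moment (ki i) (ki j)).1.
  exact: measurable_past (@bdd_lip_past (D2 i j) k s (D2b i j)).
by move=> w; exact: D2bd.
Qed.

(** Only [Y k.+1 ^ 2] is averaged out; the product of lagged values stays under the integral, where
    it is correlated with [S k]. *)
Let quadratic_term i j :
  intg P (fun w => D2 i j s (S k w) * ((c * (Y k.+1 w * Y (k - i)%N w)) *
     (c * (Y k.+1 w * Y (k - j)%N w)))) /\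
  \int[P]_w (D2 i j s (S k w) * ((c * (Y k.+1 w * Y (k - i)%N w)) *
     (c * (Y k.+1 w * Y (k - j)%N w)))) =
  c ^+ 2 * (v k.+1 * \int[P]_w (D2 i j s (S k w) * (Y (k - i)%N w * Y (k - j)%N w))).
Proof.
have [_ _ D2b _ _] := u_heat.
have [||h1 h2] := @square_past k.+1
   (fun w => D2 i j s (S k w) * (Y (k - i)%N w * Y (k - j)%N w)) kn.
- by apply: measurable_funM; [exact: bdd_lip_past|exact: measurable_funM].
- exact: D2_past_term.
have -> : (fun w => D2 i j s (S k w) * ((c * (Y k.+1 w * Y (k - i)%N w)) *
     (c * (Y k.+1 w * Y (k - j)%N w)))) =
    fun w => c ^+ 2 * (Y k.+1 w ^+ 2 * (D2 i j s (S k w) * (Y (k - i)%N w * Y (k - j)%N w))).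
  by apply/funext => w; ring.
by split; [exact: intgZ|rewrite Rintegral_scale// h2].
Qed.

(* [S (k - m)] only involves [Y t] with [t < k - i], so that it is independent
   of the pair [(Y (k - i), Y (k - j))]. *)
Let frozen_term i j :
  intg P (fun w => D2 i j s (S (k - m) w) * (Y (k - i)%N w * Y (k - j)%N w)) /\
  \int[P]_w (D2 i j s (S (k - m) w) * (Y (k - i)%N w * Y (k - j)%N w)) =
  (i == j)%:R * (v (k - i) * \int[P]_w D2 i j s (S (k - m) w)).
Proof.
have [_ _ D2b _ _] := u_heat; have [_ D2bd _ _] := D2b i j.
have i0 : intg P (fun w => D2 i j s (S (k - m) w) * (Y (k - i)%N w * Y (k - j)%N w)).
  apply: (@intgM_bounded _ _ _ _ _ _ K); first exact: (mul2_moment (ki i) (ki j)).1.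
    exact: measurable_past (@bdd_lip_past (D2 i j) _ s (D2b i j)).
  by move=> w; exact: D2bd.
split => //.
(* A lagged index truncated to 0 makes both sides vanish, as [Y 0 = 0]; the positive indices
   remain. *)
have [a0|a0] := posnP (k - i)%N.
  rewrite a0 v0 mul0r mulr0; under eq_Rintegral do rewrite Y0 mul0r mulr0.
  exact: Rintegral_const.
have [b0|b0] := posnP (k - j)%N.
  have -> : (i == j) = false.
    by apply/negbTE/eqP => ij; move: a0; rewrite ij b0.
  rewrite mul0r b0; under eq_Rintegral do rewrite Y0 !mulr0.
  exact: Rintegral_const.
have pastD l : (l < m)%N -> (0 < k - l)%N -> measurable_fun (setT : set (past Y (k - l)))
    (fun w => D2 i j s (S (k - m) w)).
  move=> lm l0; apply: (@measurable_past_le _ _ _ _ (k - m).+1).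
    have [km|km] := leqP m k; first by rewrite ltn_sub2l// (leq_trans lm).
    by move: (ltnW km); rewrite -subn_eq0 => /eqP->.
  exact: bdd_lip_past.
have intD : intg P (fun w => D2 i j s (S (k - m) w)) by exact: bdd_lip_intg.
(* Off the diagonal, the lagged value with the larger index is centred and independent of the
   remaining factors. *)
have key l l' : (l < m)%N -> (l' < m)%N -> (0 < k - l')%N -> (k - l < k - l')%N ->
    \int[P]_w (Y (k - l')%N w * (D2 i j s (S (k - m) w) * Y (k - l)%N w)) = 0.
  move=> lm lm' l0 ll.
  apply: (@mean_past _ (fun w => D2 i j s (S (k - m) w) * Y (k - l)%N w) (ki l') _ _).2.
    apply: measurable_funM; first exact: pastD.
    exact: measurable_past_index.
  apply: (@intgM_bounded _ _ _ _ _ _ K); first exact: moment1.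
    exact: measurable_past (@bdd_lip_past (D2 i j) _ s (D2b i j)).
  by move=> w; exact: D2bd.
have [ij|ij] := eqVneq i j.
  have -> : (k - j)%N = (k - i)%N by rewrite ij.
  rewrite mul1r.
  have [_ <-] := @square_past _ (fun w => D2 i j s (S (k - m) w)) (ki i)
    (pastD _ (ltn_ord i) a0) intD.
  by apply: eq_Rintegral => w _; ring.
have ijn : (i != j :> nat)%N by [].
rewrite mul0r; have [ltab|ltba|eqab] := ltngtP (k - i) (k - j).
- rewrite -(key i j (ltn_ord i) (ltn_ord j) b0 ltab).
  by apply: eq_Rintegral => w _; ring.
- rewrite -(key j i (ltn_ord j) (ltn_ord i) a0 ltba).
  by apply: eq_Rintegral => w _; ring.
- exfalso; move: ijn a0 b0 eqab => /eqP; rewrite !subn_gt0; lia.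
Qed.

(** Up to the factor [c], this dominates the [l^1] distance between [S k] and [S (k - m)]: in each
    of the [m] coordinates at most [m] terms have been added. *)
Let recent_sum w := \sum_(l < m) \sum_((k - m).+1 <= r < k.+1)
  `|Y r w * Y (r - l.+1)%N w|.

Let lag_sum_recent w :
  \sum_i `|S k w i - S (k - m) w i| <= c * recent_sum w.
Proof.
rewrite mulr_sumr; apply: ler_sum => i _.
have -> : S k w i - S (k - m) w i =
    c * \sum_((k - m).+1 <= r < k.+1) Y r w * Y (r - i.+1)%N w.
  rewrite /S -mulrBr; congr (_ * _).
  rewrite -2!(big_mkord xpredT (fun r => Y r w * Y (r - i.+1)%N w)).
  rewrite (big_cat_nat (n := (k - m).+1))//= ?ltnS ?leq_subr//.
  by rewrite addrAC subrr add0r.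
rewrite normrM (ger0_norm c0) ler_wpM2l//; exact: ler_norm_sum.
Qed.

Let sum_recent_le (x : nat -> nat -> R) M : 0 <= M ->
  (forall l r, (r <= n)%N -> x l r <= M) ->
  \sum_(l < m) \sum_((k - m).+1 <= r < k.+1) x l r <= m%:R ^+ 2 * M.
Proof.
move=> M0 xM; have H l : \sum_((k - m).+1 <= r < k.+1) x l r <= m%:R * M.
  apply: (@le_trans _ _ (\sum_((k - m).+1 <= r < k.+1) M)).
    rewrite [leLHS]big_nat_cond [leRHS]big_nat_cond.
    apply: ler_sum => r /andP[/andP[_ rk] _]; apply: xM.
    by rewrite (leq_trans _ kn)// ltnW.
  rewrite sumr_const_nat -[leLHS]mulr_natl ler_wpM2r// ler_nat subSS.
  lia.
apply: (@le_trans _ _ (\sum_(l < m) (m%:R * M))); first exact: ler_sum.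
by rewrite sumr_const card_ord -[leLHS]mulr_natl mulrA expr2.
Qed.

(** [D2] is Lipschitz, so freezing costs [K c] times [recent_sum], possibly multiplied by two more
    lagged values. Each of the at most [m^2] resulting products has absolute moment at most
    [kappa]. *)
Let freezing_error i j :
  `|\int[P]_w (D2 i j s (S k w) * (Y (k - i)%N w * Y (k - j)%N w)) -
    \int[P]_w (D2 i j s (S (k - m) w) * (Y (k - i)%N w * Y (k - j)%N w))|
    <= K * c * (m%:R ^+ 2 * kappa) /\
  `|\int[P]_w D2 i j s (S k w) - \int[P]_w D2 i j s (S (k - m) w)|
    <= K * c * (m%:R ^+ 2 * kappa).
Proof.
have [_ _ D2b _ _] := u_heat; have [_ D2bd D2l _] := D2b i j.
have Kc0 : 0 <= K * c by rewrite mulr_ge0.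
have dD w : `|D2 i j s (S k w) - D2 i j s (S (k - m) w)| <= K * c * recent_sum w.
  rewrite (le_trans (D2l _ _ _ ss))// -mulrA ler_wpM2l//.
have rk r : (r < k.+1)%N -> (r <= n)%N by move=> ?; rewrite (leq_trans _ kn)// ltnW.
have rl r l : (r <= n)%N -> (r - l <= n)%N.
  by move=> ?; rewrite (leq_trans (leq_subr _ _)).
split.
  rewrite -Rintegral_sub; [|exact: D2_past_term|exact: (frozen_term i j).1].
  pose h w := \sum_(l < m) \sum_((k - m).+1 <= r < k.+1)
    `|Y r w * Y (r - l.+1)%N w * (Y (k - i)%N w * Y (k - j)%N w)|.
  have hE w : h w = recent_sum w * `|Y (k - i)%N w * Y (k - j)%N w|.
    rewrite /h mulr_suml; apply: eq_bigr => l _; rewrite mulr_suml.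
    by apply: eq_bigr => r _; rewrite normrM.
  have hi' l r : r \in index_iota (k - m).+1 k.+1 ->
      intg P (fun w => `|Y r w * Y (r - l.+1)%N w * (Y (k - i)%N w * Y (k - j)%N w)|).
    rewrite mem_index_iota => /andP[_ /rk rn].
    by apply: intg_norm; apply: (mul4_moment _ _ _ _).1 => //; exact: rl.
  have hi : intg P h by apply: intg_sum => l _; apply: intg_sum; exact: hi'.
  apply: (@Rintegral_norm_le_cst _ _ _ _ _ h) => //.
  - by apply: intgB; [exact: D2_past_term|exact: (frozen_term i j).1].
  - by move=> w; rewrite hE -mulrBl normrM mulrA ler_wpM2r.
  - rewrite Rintegral_sumr => [|l _]; last by apply: intg_sum; exact: hi'.
    under eq_bigr do rewrite (Rintegral_sumr (hi' _)).
    apply: (sum_recent_le (x := fun l r => \int[P]_w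
      `|Y r w * Y (r - l.+1)%N w * (Y (k - i)%N w * Y (k - j)%N w)|)) => // l r rn.
    by apply: (mul4_moment _ _ _ _).2 => //; exact: rl.
have intD t : intg P (fun w => D2 i j s (S t w)) by exact: bdd_lip_intg.
rewrite -Rintegral_sub//.
have hi' l r : r \in index_iota (k - m).+1 k.+1 ->
    intg P (fun w => `|Y r w * Y (r - l.+1)%N w|).
  rewrite mem_index_iota => /andP[_ /rk rn].
  by apply: intg_norm; apply: (mul2_moment _ _).1 => //; exact: rl.
apply: (@Rintegral_norm_le_cst _ _ _ _ _ recent_sum) => //.
- exact: intgB.
- by apply: intg_sum => l _; apply: intg_sum; exact: hi'.
rewrite Rintegral_sumr => [|l _]; last by apply: intg_sum; exact: hi'.
under eq_bigr do rewrite (Rintegral_sumr (hi' _)).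
apply: (sum_recent_le (x := fun l r => \int[P]_w
  `|Y r w * Y (r - l.+1)%N w|)) => // l r rn.
by apply: (mul2_moment _ _).2 => //; exact: rl.
Qed.

(** The variance of coordinate [i] of the step, by independence of [Y k.+1] and [Y (k - i)]; it is 0
    when the lagged index is truncated to 0, in agreement with the step itself. *)
Let tau (i : 'I_m) : R := c ^+ 2 * (v k.+1 * v (k - i)).

Let tau_ge0 i : 0 <= tau i.
Proof. by rewrite /tau mulr_ge0 ?sqr_ge0// mulr_ge0. Qed.

Let tau_le i : tau i <= c ^+ 2 * kappa ^+ 2.
Proof. by rewrite /tau ler_wpM2l ?sqr_ge0// [kappa ^+ 2]expr2 ler_pM// v_le. Qed.

Let step w (i : 'I_m) : R := c * (Y k.+1 w * Y (k - i)%N w).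

Let taylor_error : `|\int[P]_w u s (S k.+1 w) -
    (\int[P]_w u s (S k w) + 2^-1 * \sum_i \sum_j
      \int[P]_w (D2 i j s (S k w) * (step w i * step w j)))|
  <= K * (4 ^+ m * (m%:R * kappa ^+ 2)) * c ^+ 3.
Proof.
have [ub D1b D2b _ [tay _]] := u_heat.
pose L w := \sum_i D1 i s (S k w) * step w i.
pose Q w := 2^-1 * \sum_i \sum_j D2 i j s (S k w) * (step w i * step w j).
have iS t : intg P (fun w => u s (S t w)) by exact: bdd_lip_intg.
have iL : intg P L by apply: intg_sum => i _; exact: (linear_term i).1.
have iQ : intg P Q.
  apply: intgZ; apply: intg_sum => i _; apply: intg_sum => j _.
  exact: (quadratic_term i j).1.
have L0 : \int[P]_w L w = 0.
  rewrite Rintegral_sumr => [|i _]; last exact: (linear_term i).1.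
  by apply: big1 => i _; exact: (linear_term i).2.
have QE : \int[P]_w Q w = 2^-1 * \sum_i \sum_j
    \int[P]_w (D2 i j s (S k w) * (step w i * step w j)).
  rewrite Rintegral_scale; last first.
    apply: intg_sum => i _; apply: intg_sum => j _; exact: (quadratic_term i j).1.
  rewrite Rintegral_sumr => [|i _]; last first.
    apply: intg_sum => j _; exact: (quadratic_term i j).1.
  congr (_ * _); apply: eq_bigr => i _; rewrite Rintegral_sumr// => j _.
  exact: (quadratic_term i j).1.
rewrite -QE -[X in X + \int[P]_w Q w]addr0 -L0 opprD opprD !addrA.
have iR1 := intgB (iS k.+1) (iS k).
have iR2 := intgB iR1 iL; have iR3 := intgB iR2 iQ.
rewrite -Rintegral_sub// -Rintegral_sub// -Rintegral_sub//.
pose h w := \sum_(i < m) `|Y k.+1 w| ^+ 3 * `|Y (k - i)%N w| ^+ 3.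
have ci (i : 'I_m) : intg P (fun w => `|Y k.+1 w| ^+ 3 * `|Y (k - i)%N w| ^+ 3) /\
    \int[P]_w (`|Y k.+1 w| ^+ 3 * `|Y (k - i)%N w| ^+ 3) <= kappa ^+ 2.
  by apply: cube_past => //; rewrite ltnS leq_subr.
have ih : intg P h by apply: intg_sum => i _; exact: (ci i).1.
rewrite mulrA mulrAC; apply: (@Rintegral_norm_le_cst _ _ _ _ _ h) => //; last 2 first.
- by rewrite mulr_ge0 ?exprn_ge0// mulr_ge0// exprn_ge0.
- rewrite Rintegral_sumr => [|i _]; last exact: (ci i).1.
  apply: (@le_trans _ _ (\sum_(i < m) kappa ^+ 2)).
    by apply: ler_sum => i _; exact: (ci i).2.
  by rewrite sumr_const card_ord mulr_natl.
move=> w.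
have -> : u s (S k.+1 w) = u s (fun i => S k w i + step w i).
  by congr (u s _); apply/funext => i; rewrite lag_sumS.
apply: le_trans (tay _ _ _ ss) _.
have -> : K * 4 ^+ m * c ^+ 3 * h w = K * (4 ^+ m * (c ^+ 3 * h w)) by ring.
rewrite ler_wpM2l//.
apply: le_trans (sum_expr3_le _ _) _ => //.
rewrite [X in 4 ^+ X](_ : _ = m); last first.
  by rewrite -[RHS]card_ord cardE enumT -(size_map val) /index_enum; rewrite size_map.
rewrite ler_wpM2l ?exprn_ge0// /h mulr_sumr; apply: ler_sum => i _.
by rewrite /step !normrM !exprMn (ger0_norm c0).
Qed.

Let heat_error : `|\int[P]_w u (fun i : 'I_m => s i + tau i) (S k w) -
    (\int[P]_w u s (S k w) + 2^-1 * \sum_i tau i * \int[P]_w D2 i i s (S k w))|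
  <= K * (m%:R * (c ^+ 2 * kappa ^+ 2)) ^+ 2.
Proof.
have [ub _ D2b _ [_ heat]] := u_heat.
have st i : s0 <= s i + tau i by rewrite (le_trans (ss i))// lerDl.
have iD i : intg P (fun w => D2 i i s (S k w)) by exact: bdd_lip_intg.
have iH : intg P (fun w => 2^-1 * \sum_i tau i * D2 i i s (S k w)).
  by apply: intgZ; apply: intg_sum => i _; exact: intgZ.
have -> : 2^-1 * \sum_i tau i * \int[P]_w D2 i i s (S k w) =
    \int[P]_w (2^-1 * \sum_i tau i * D2 i i s (S k w)).
  rewrite Rintegral_scale; last by apply: intg_sum => i _; exact: intgZ.
  rewrite Rintegral_sumr => [|i _]; last exact: intgZ.
  by congr (_ * _); apply: eq_bigr => i _; rewrite Rintegral_scale.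
have iS s' : (forall i, s0 <= s' i) -> intg P (fun w => u s' (S k w)).
  by move=> ?; exact: bdd_lip_intg.
have i1 := iS _ st; have i2 := iS _ ss; have i3 := intgB i1 i2.
rewrite opprD addrA -Rintegral_sub// -Rintegral_sub//.
rewrite -[leRHS](Rintegral_const P); apply: Rintegral_norm_le => [||w].
- exact: intgB.
- exact: intg_cst.
under eq_bigr do rewrite mulrC.
apply: le_trans (heat _ _ _ ss tau_ge0) _.
rewrite ler_wpM2l// lerXn2r// ?nnegrE ?sumr_ge0//.
  by rewrite mulr_ge0// mulr_ge0 ?exprn_ge0.
apply: (@le_trans _ _ (\sum_(i < m) c ^+ 2 * kappa ^+ 2)).
  by apply: ler_sum => i _; exact: tau_le.
by rewrite sumr_const card_ord mulr_natl.
Qed.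

(** Both sums are compared with their frozen versions [q0] and [e0], which cancel exactly by [q0E].
    Each row then leaves [m] freezing errors from the covariances and one, multiplied by a variance
    at most [kappa], from the time decrement. *)
Let covariance_error : `|\sum_i \sum_j
      \int[P]_w (D2 i j s (S k w) * (step w i * step w j)) -
    \sum_i tau i * \int[P]_w D2 i i s (S k w)|
  <= (c ^+ 2 * kappa) * (m%:R * ((m%:R + kappa) * (K * c * (m%:R ^+ 2 * kappa)))).
Proof.
set E := K * c * _.
pose q i j := \int[P]_w (D2 i j s (S k w) * (Y (k - i)%N w * Y (k - j)%N w)).
pose q0 i j := \int[P]_w (D2 i j s (S (k - m) w) * (Y (k - i)%N w * Y (k - j)%N w)).
pose e i := \int[P]_w D2 i i s (S k w).
pose e0 i := \int[P]_w D2 i i s (S (k - m) w).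
have q0E i : \sum_j q0 i j = v (k - i) * e0 i.
  rewrite (bigD1 i)//= big1 => [|j ji].
    by rewrite addr0 /q0 (frozen_term i i).2 eqxx mul1r.
  by rewrite /q0 (frozen_term i j).2 eq_sym (negbTE ji) mul0r.
have -> : \sum_i \sum_j \int[P]_w (D2 i j s (S k w) * (step w i * step w j)) -
    \sum_i tau i * \int[P]_w D2 i i s (S k w) =
    c ^+ 2 * v k.+1 * \sum_i (\sum_j (q i j - q0 i j) - v (k - i) * (e i - e0 i)).
  rewrite -sumrB mulr_sumr; apply: eq_bigr => i _.
  rewrite sumrB q0E; under eq_bigr do rewrite (quadratic_term i _).2 -/(q _ _).
  by rewrite -!mulr_sumr /tau -/(e i); ring.
rewrite normrM ler_pM// ?normr_ge0//.
  rewrite ger0_norm ?mulr_ge0 ?sqr_ge0// ler_wpM2l ?sqr_ge0//; exact: v_le.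
apply: le_trans (ler_norm_sum _ _ _) _.
apply: (@le_trans _ _ (\sum_(i < m) ((m%:R + kappa) * E))); last first.
  by rewrite sumr_const card_ord mulr_natl.
apply: ler_sum => i _; apply: le_trans (ler_normB _ _) _; rewrite mulrDl lerD//.
  apply: le_trans (ler_norm_sum _ _ _) _.
  apply: (@le_trans _ _ (\sum_(j < m) E)); last by rewrite sumr_const card_ord mulr_natl.
  by apply: ler_sum => j _; exact: (freezing_error i j).1.
rewrite normrM (ger0_norm (v_ge0 _)) ler_pM ?normr_ge0// ?v_le//.
exact: (freezing_error i i).2.
Qed.

(** The summands come from the Taylor expansion in space, the expansion in time and the covariances,
    in this order. None depends on [n] or on the step. *)
Definition lindeberg_const : R := K * (4 ^+ m * (m%:R * kappa ^+ 2)) +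
  K * (m%:R * kappa ^+ 2) ^+ 2 + K * m%:R ^+ 3 * kappa ^+ 2 * (m%:R + kappa).

Lemma lindeberg_step :
  `|\int[P]_w u s (S k.+1 w) - \int[P]_w u (fun i : 'I_m => s i + tau i) (S k w)|
  <= lindeberg_const * c ^+ 3.
Proof.
have c1 : c <= 1.
  rewrite invf_le1 ?sqrtr_gt0 ?ltr0n ?(leq_ltn_trans _ kn)//.
  by rewrite -[leLHS]sqrtr1 ler_wsqrtr// ler1n (leq_ltn_trans _ kn).
have c43 : c ^+ 4 <= c ^+ 3 by apply: ler_wiXn2l.
have h1 := taylor_error; have h2 := heat_error; have h3 := covariance_error.
have h2' : K * (m%:R * (c ^+ 2 * kappa ^+ 2)) ^+ 2 <=
    K * (m%:R * kappa ^+ 2) ^+ 2 * c ^+ 3.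
  rewrite (_ : K * _ = K * (m%:R * kappa ^+ 2) ^+ 2 * c ^+ 4); last by ring.
  by rewrite ler_wpM2l// mulr_ge0// sqr_ge0.
have h3' : (c ^+ 2 * kappa) * (m%:R * ((m%:R + kappa) * (K * c * (m%:R ^+ 2 * kappa)))) =
  K * m%:R ^+ 3 * kappa ^+ 2 * (m%:R + kappa) * c ^+ 3 by ring.
rewrite h3' in h3; rewrite /lindeberg_const.
move: h1 {h2}(le_trans h2 h2') h3.
set A := \int[P]_w u s (S k.+1 w); set B := \int[P]_w u s (S k w).
set A' := \int[P]_w u (fun i : 'I_m => s i + tau i) (S k w).
set Q := \sum_i \sum_j _; set H := \sum_i tau i * _.
rewrite (mulrDl _ _ (c ^+ 3)) (mulrDl _ _ (c ^+ 3)).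
set X1 := _ * c ^+ 3; set X2 := _ * c ^+ 3; set X3 := _ * c ^+ 3.
rewrite !ler_norml => /andP[a1 a2] /andP[b1 b2] /andP[d1 d2].
by apply/andP; split; lra.
Qed.

End one_step.
Definition lag_variance (i : 'I_m) : R :=
  n%:R^-1 * \sum_(t < n) v t.+1 * v (t - i)%N.

(** Telescoping along the times [sg t], which are [s0] plus the variances still to be consumed: at
    [t = 0] the sum is 0 and the time is maximal, at [t = n] only [s0] is left. The [n] errors of
    size [c^3] add up to a multiple of [c]. *)
Theorem lindeberg :
  `|\int[P]_w u (fun=> s0) (S n w) - u (fun i => s0 + lag_variance i) (fun=> 0)|
  <= lindeberg_const / Num.sqrt n%:R.
Proof.
have c2 : c ^+ 2 = n%:R^-1 by rewrite exprVn sqr_sqrtr.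
pose tau t (i : 'I_m) : R := c ^+ 2 * (v t.+1 * v (t - i)).
pose sg t i := s0 + \sum_(t <= r < n) tau r i.
have tau0 t i : 0 <= tau t i by rewrite /tau mulr_ge0 ?sqr_ge0// mulr_ge0.
have sgn : sg n = fun=> s0.
  by apply/funext => i; rewrite /sg big_geq// addr0.
have sg0 : sg 0 = fun i => s0 + lag_variance i.
  apply/funext => i; rewrite /sg /lag_variance big_mkord mulr_sumr -c2.
  by congr (_ + _); apply: eq_bigr.
have sgS t : (t < n)%N -> sg t = fun i => sg t.+1 i + tau t i.
  by move=> tn; apply/funext => i; rewrite /sg big_ltn// addrA addrAC.
have sgge t i : s0 <= sg t i by rewrite /sg lerDl sumr_ge0.
pose F t := \int[P]_w u (sg t) (S t w).
have F0 : F 0 = u (fun i => s0 + lag_variance i) (fun=> 0).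
  rewrite /F sg0 (_ : (fun w => _) = fun=> u (fun i => s0 + lag_variance i) (fun=> 0)).
    exact: Rintegral_const.
  by apply/funext => w; congr (u _ _); apply/funext => i; exact: lag_sum0.
have FS t : (t < n)%N -> `|F t.+1 - F t| <= lindeberg_const * c ^+ 3.
  by move=> tn; rewrite [F t]/F (sgS _ tn); exact: lindeberg_step.
have H t : (t <= n)%N -> `|F t - F 0| <= lindeberg_const * c ^+ 3 * t%:R.
  elim: t => [_|t IH tn]; first by rewrite subrr normr0 mulr0.
  rewrite (_ : F t.+1 - F 0 = (F t.+1 - F t) + (F t - F 0)); last by ring.
  rewrite (le_trans (ler_normD _ _))// -natr1 mulrDr mulr1 addrC lerD ?IH ?FS//.
  exact: ltnW.
rewrite -F0 -sgn -/(F n); apply: le_trans (H n (leqnn n)) _.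
have [->|n0] := posnP n; first by rewrite !mulr0 sqrtr0 invr0 mulr0.
rewrite exprSr c2 mulrA -!mulrA ler_wpM2l//.
  rewrite /lindeberg_const !addr_ge0// ?mulr_ge0// ?exprn_ge0// ?mulr_ge0// ?exprn_ge0//.
  exact: addr_ge0.
by rewrite mulrCA mulVf ?mulr1// pnatr_eq0 -lt0n.
Qed.

End lindeberg.

(** * Riemann sums *)

Section riemann_sums.
Context {R : realType}.
Implicit Types (f g : R -> R) (c : nat -> nat -> R).

Let mu := @lebesgue_measure R.

Let step c n (x : R) : R :=
  \sum_(t < n) c n t.+1 * \1_(`[t%:R / n%:R, t.+1%:R / n%:R[%classic : set R) x.

Let stepE c n x : (0 < n)%N -> 0 <= x < 1 ->
  step c n x = c n (Num.truncn (n%:R * x)).+1 /\ (Num.truncn (n%:R * x) < n)%N.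
Proof.
move=> n0 /andP[x0 x1]; set k := Num.truncn _.
have nR : 0 < n%:R :> R by rewrite ltr0n.
have /andP[k1 k2] := truncn_itv (mulr_ge0 (ltW nR) x0).
have kn : (k < n)%N.
  by rewrite -(ltr_nat R) (le_lt_trans k1)// -[ltRHS]mulr1 ltr_pM2l.
split => //; rewrite /step (bigD1 (Ordinal kn))//= big1 => [|t tk].
  rewrite addr0 indicE mem_set ?mulr1//= in_itv/=.
  by rewrite ler_pdivrMr// ltr_pdivlMr// mulrC k1 k2.
rewrite indicE memNset ?mulr0//= in_itv/= ler_pdivrMr// ltr_pdivlMr// => /andP[t1 t2].
move/eqP : tk; apply; apply: val_inj => /=; rewrite -/k.
by apply/esym/truncn_def; rewrite mulrC t1 t2.
Qed.

Let measurable_step c n (A : set R) : measurable_fun A (step c n).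
Proof.
apply: measurable_sum => t; apply: measurable_funM => //.
Qed.

Let integral_step c n : (0 < n)%N ->
  (\int[mu]_(x in `[0%R, 1%R[) (step c n x)%:E)%E =
  (n%:R^-1 * \sum_(t < n) c n t.+1)%:E.
Proof.
move=> n0; have nR : 0 < n%:R :> R by rewrite ltr0n.
have i1 (t : 'I_n) : mu.-integrable `[0%R, 1%R[
    (EFin \o (fun x => c n t.+1 * \1_(`[t%:R / n%:R, t.+1%:R / n%:R[%classic : set R) x)).
  have -> : (EFin \o (fun x => c n t.+1 * \1_(`[t%:R / n%:R, t.+1%:R / n%:R[%classic : set R) x))
    = (fun x => (c n t.+1)%:E * (\1_(`[t%:R / n%:R, t.+1%:R / n%:R[%classic : set R) x)%:E)%E.
    by apply/funext => x /=; rewrite EFinM.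
  apply: integrableZl => //; apply: (integrableS measurableT) => //.
  exact: integrable_indic_itv.
under eq_integral do rewrite /step -sumEFin.
rewrite integral_sum// mulr_sumr -sumEFin; apply: eq_bigr => t _.
under eq_integral do rewrite EFinM.
have tn0 : t%:R / n%:R < t.+1%:R / n%:R :> R by rewrite ltr_pM2r ?invr_gt0// ltr_nat.
rewrite integralZl//; last first.
  by apply: (integrableS measurableT) => //; exact: integrable_indic_itv.
rewrite integral_indic//= setIidl; last first.
  apply: subset_itv; rewrite bnd_simp ?divr_ge0//.
  by rewrite ler_pdivrMr// mul1r ler_nat.
rewrite lebesgue_measure_itv/= lte_fin tn0 -EFinB -EFinM mulrC; congr (_ * _)%:E.
by rewrite -mulrBl -natr1 addrAC subrr add0r mul1r.
Qed.

(** The average is the integral over [[0, 1[] of the step function equal to [c n t.+1] on [[t / n,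
    t.+1 / n[], and dominated convergence applies. A general array [c] is allowed, rather than the
    values of [f] at [t / n], in order to cover products of lagged values. *)
Lemma riemann_sum_cvg c f (M : R) (E : set R) :
  measurable_fun (`]0, 1]%classic : set R) f -> finite_set E ->
  (forall n t, (0 < t <= n)%N -> `|c n t| <= M) ->
  (forall s, 0 < s < 1 -> ~ E s ->
    c n (Num.truncn (n%:R * s)).+1 @[n --> \oo] --> f s) ->
  n%:R^-1 * \sum_(t < n) c n t.+1 @[n --> \oo] --> \int[mu]_(s in `[0%R, 1%R]) f s.
Proof.
move=> mf cE cM cf.
(* The convergence is assumed for [0 < s] only, so the left endpoint joins the exceptional set. *)
pose N := E `|` [set 0%R].
have cN : countable N by apply: finite_set_countable; rewrite finite_setU.
have N0 : mu.-negligible N.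
  exists N; split => //; first exact: countable_measurable.
  exact: countable_lebesgue_measure0.
have mf1 : measurable_fun (`[0, 1[%classic : set R) f.
  apply: (@measurable_funS _ _ _ _ (`[0, 1]%classic : set R)) => //.
    by apply: subset_itvl; rewrite bnd_simp.
  exact/measurable_fun_itv_obnd_cbndP.
have M0 : 0 <= M by apply: le_trans (normr_ge0 _) (cM 1%N 1%N isT).
have iM : mu.-integrable (`[0, 1[%classic : set R) (fun=> M%:E).
  apply/integrableP; split => //.
  rewrite integral_cst//= lebesgue_measure_itv/= lte_fin ltr01 -EFinB -EFinM.
  exact: ltry.
have ptw : {ae mu, forall x, (`[0, 1[%classic : set R) x ->
    (step c n x)%:E @[n --> \oo] --> (f x)%:E}.
  apply: negligibleS N0 => x /= /not_implyP[]; rewrite in_itv/= => /andP[x0 x1].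
  apply: contra_notP => /not_orP[nE n0].
  have x0' : 0 < x by rewrite lt_neqAle x0 andbT eq_sym; apply/eqP.
  apply/fine_cvgP; split; first exact: nearW.
  apply: cvg_trans (cf x _ nE); last by rewrite x0' x1.
  apply: near_eq_cvg; near=> n; rewrite /= (stepE _ _ _).1// ?x0 ?x1//.
  by near: n; exact: nbhs_infty_gt.
have dom : {ae mu, forall x n, (`[0, 1[%classic : set R) x ->
    (`|(step c n x)%:E| <= M%:E)%E}.
  apply: aeW => x n /=; rewrite in_itv/= => x01; rewrite lee_fin.
  have [->|n0] := posnP n; first by rewrite /step big_ord0 normr0.
  by have [-> h] := @stepE c n x n0 x01; exact: cM.
have [fi _ H] := @dominated_convergence _ _ _ mu (`[0, 1[%classic : set R) (measurable_itv _)
  (fun n x => (step c n x)%:E) (EFin \o f) (fun=> M%:E)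
  (fun n => (measurable_EFinP _ _).2 (@measurable_step c n _))
  ((measurable_EFinP _ _).2 mf1) ptw iM dom.
rewrite -Rintegral_itv_bndo_bndc//.
suff : (n%:R^-1 * \sum_(t < n) c n t.+1)%:E @[n --> \oo] -->
    (\int[mu]_(s in `[0%R, 1%R[) f s)%:E.
  by move=> h; apply: (fine_cvg h).
rewrite /Rintegral fineK; last exact: integrable_fin_num fi.
apply: cvg_trans H; apply: near_eq_cvg; near=> n.
rewrite /= integral_step//; near: n; exact: nbhs_infty_gt.
Unshelve. all: by end_near. Qed.

End riemann_sums.

(** * Continuity points of a piecewise Lipschitz function *)

Section piecewise_continuity.
Context {R : realType}.

(** The index differs from [n s] by at most [i + 1], once [n >= i / s] ensures that the subtraction
    is not truncated. *)
Lemma truncn_lag_cvg (s : R) (i : nat) : 0 < s ->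
  ((Num.truncn (n%:R * s)).+1 - i)%N%:R / n%:R @[n --> \oo] --> s.
Proof.
move=> s0; apply/cvgrPdist_le => e e0.
near=> n.
have n0 : 0 < n%:R :> R by rewrite ltr0n; near: n; exact: nbhs_infty_gt.
have ine : (i%:R + 1) / e <= n%:R :> R by near: n; exact: nbhs_infty_ger.
have ins : i%:R / s <= n%:R :> R by near: n; exact: nbhs_infty_ger.
have /andP[k1 k2] := truncn_itv (mulr_ge0 (ltW n0) (ltW s0)).
move: k1 k2; set k := Num.truncn _ => k1 k2.
have ik : (i <= k)%N.
  rewrite -ltnS -(ltr_nat R) (le_lt_trans _ k2)//.
  by move: ins; rewrite ler_pdivrMr.
rewrite natrB ?(leq_trans ik)//.
have -> : s - (k.+1%:R - i%:R) / n%:R = (n%:R * s - k.+1%:R + i%:R) / n%:R.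
  by field; rewrite gt_eqF.
rewrite normrM [X in _ * X]ger0_norm ?invr_ge0 ?(ltW n0)// ler_pdivrMr//.
move: ine; rewrite ler_pdivrMr// (mulrC _ e) => ine; apply: le_trans ine.
have i0 : 0 <= i%:R :> R by [].
by move: k2 k1; rewrite -natr1 ler_norml => k2 k1; apply/andP; split; lra.
Unshelve. all: by end_near. Qed.

(** The exceptional set consists of the infima and suprema of the pieces. Any other point of []0,
    1[] lies strictly between two points [a] and [b] of its piece, so that [g] coincides with one
    Lipschitz function near it; pieces reduced to a point are thereby excluded too. *)
Lemma piecewise_lipschitz_continuous (g : R -> R) : piecewise_lipschitz g ->
  exists2 E : set R, finite_set E &
    forall s, 0 < s < 1 -> ~ E s -> {for s, continuous g}.
Proof.
move=> [p [J [gl [_ [itvJ trivJ] bigJ lipgl gE]]]].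
pose E := [set inf (J l) | l in [set: 'I_p]] `|` [set sup (J l) | l in [set: 'I_p]].
exists E; first by rewrite finite_setU; split; apply: finite_image; exact: finite_finset.
move=> s /andP[s0 s1] nE.
have : (\bigcup_l J l) s by rewrite bigJ /= in_itv/= s0 ltW.
move=> [l _ Jls].
have J01 x : J l x -> 0 < x <= 1.
  by move=> Jx; have : (\bigcup_l J l) x by [exists l]; rewrite bigJ /= in_itv.
have glE x : J l x -> g x = gl l x.
  move=> Jx; rewrite gE ?in_itv/= ?J01// (bigD1 l)//= big1 => [|k kl].
    by rewrite addr0 indicE mem_set// mulr1.
  rewrite indicE memNset ?mulr0// => Jkx; move/eqP : kl; apply.
  by apply: (trivJ k l I I); exists x.
have [b Jb sb] : exists2 b, J l b & s < b.
  apply: sup_gt; first by exists s.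
  rewrite lt_neqAle; apply/andP; split.
    by apply/eqP => sE; apply: nE; right; exists l.
  by apply: ub_le_sup => //; exists 1 => x /J01/andP[].
have [a Ja sa] : exists2 a, J l a & a < s.
  apply: inf_lt; first by exists s.
  rewrite lt_neqAle; apply/andP; split.
    by apply/eqP => sE; apply: nE; left; exists l.
  by apply: ge_inf => //; exists 0 => x /J01/andP[/ltW].
(* The Lipschitz property holds for all constants larger than [M]; [|M| + 1] is one that is also
   positive. *)
have [M [_ HM]] := lipgl l.
have {}HM : forall x, J l x -> `|gl l s - gl l x| <= (`|M| + 1) * `|s - x|.
  by move=> x Jx; apply: (HM (`|M| + 1) _ (s, x)) => //; rewrite ltr_pwDr// ler_norm.
apply/cvgrPdist_le => e e0.
have M0 : 0 < `|M| + 1 by rewrite ltr_wpDl.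
near=> x.
have /andP[ax xb] : a < x < b.
  rewrite -[a < x < b]/(x \in `]a, b[); near: x; apply: near_in_itvoo.
  by rewrite in_itv/= sa sb.
have Jx : J l x by apply: (itvJ l a b) => //; rewrite !ltW.
rewrite glE// glE//; apply: le_trans (HM _ Jx) _.
rewrite mulrC -ler_pdivlMr//; near: x.
have eM : 0 < e / (`|M| + 1) by rewrite divr_gt0.
by have /cvgrPdist_le/(_ _ eM) := @cvg_id _ (nbhs s).
Unshelve. all: by end_near. Qed.

End piecewise_continuity.

(** * From smooth test functions to distribution functions *)

Section normal_cdf_limits.
Context {R : realType}.
Implicit Types x y : R.

Lemma normal_cdf_le x y : x <= y -> normal_cdf x <= normal_cdf y.
Proof.
move=> xy; rewrite fine_le ?fin_num_measure//.
by apply: le_measure; rewrite ?inE//; exact: subitvPr.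
Qed.

Let idTR : measurableTypeR R -> R := idfun.

#[local] HB.instance Definition _ :=
  @isMeasurableFun.Build _ _ _ _ idTR (@measurable_id _ _ setT).

Lemma normal_cdf_tails (e : R) : 0 < e ->
  exists k, [/\ 0 <= k, 1 - e <= normal_cdf k & normal_cdf (- k) <= e].
Proof.
move=> e0.
have cX x : fine (cdf (idTR : {RV (normal_prob (0 : R) 1) >-> R}) x) = normal_cdf x by [].
have h1 : (fine \o cdf (idTR : {RV (normal_prob (0 : R) 1) >-> R})) x @[x --> +oo] --> (1 : R).
  by apply: fine_cvg; exact: cvg_cdfy1.
have h0 : (fine \o cdf (idTR : {RV (normal_prob (0 : R) 1) >-> R})) x @[x --> -oo] --> (0 : R).
  by apply: fine_cvg; exact: cvg_cdfNy0.
move/cvgrPdist_le : h1 => /(_ e e0) [k1 [_ k1P]].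
move/cvgrPdist_le : h0 => /(_ e e0) [k0 [_ k0P]].
pose k := Num.max 0 (Num.max (k1 + 1) (1 - k0)).
exists k; split.
- by rewrite le_max lexx.
- have /k1P : k1 < k by rewrite !lt_max ltrDl ltr01 !orbT.
  by rewrite /= cX ler_norml => /andP[_]; lra.
- have /k0P : - k < k0 by rewrite ltrNl !lt_max ltrDr ltr01 !orbT.
  by rewrite /= cX ler_norml => /andP[]; lra.
Qed.

Lemma normal_prod_itv (I : Type) (r : seq I) (Q : pred I) (a : I -> R) :
  0 <= \prod_(i <- r | Q i) normal_cdf (a i) <= 1.
Proof.
elim/big_rec : _ => [|i x _ /andP[x0 x1]]; first by rewrite ler01 lexx.
by rewrite mulr_ge0 ?normal_cdf_ge0//= mulr_ile1 ?normal_cdf_ge0 ?normal_cdf_le1.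
Qed.

(** The factors lie in [[0, 1]], so replacing them one at a time adds up the individual errors,
    without any loss from the other factors. *)
Lemma normal_prod_lipschitz (I : Type) (r : seq I) (a b : I -> R) :
  `|\prod_(i <- r) normal_cdf (a i) - \prod_(i <- r) normal_cdf (b i)|
  <= gauss_const * \sum_(i <- r) `|a i - b i|.
Proof.
elim: r => [|i r IH]; first by rewrite !big_nil subrr normr0 mulr0.
rewrite !big_cons.
have p1 : 0 <= \prod_(i <- r) normal_cdf (a i) <= 1.
  exact: normal_prod_itv.
set A := \prod_(i <- r) _ in IH p1 *; set B := \prod_(i <- r) _ in IH *.
rewrite (_ : _ - _ = (normal_cdf (a i) - normal_cdf (b i)) * A +
    normal_cdf (b i) * (A - B)); last by ring.
rewrite (le_trans (ler_normD _ _))// [leRHS]mulrDr !normrM lerD//.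
  rewrite -[leRHS]mulr1 ler_pM// ?normal_cdf_lipschitz// ger0_norm; by case/andP: p1.
rewrite -[leRHS]mul1r ler_pM// ger0_norm ?normal_cdf_ge0//; exact: normal_cdf_le1.
Qed.

End normal_cdf_limits.

Section cdf_smoothing.
Context d (T : measurableType d) (R : realType) (P : probability T R) (m : nat)
  (S : T -> 'I_m -> R).
Hypothesis mS : forall i, measurable_fun setT (fun w => S w i).
Implicit Types (y : 'I_m -> R) (h k : R).

Lemma measurable_joint_ray y : measurable [set w | forall i, S w i <= y i].
Proof.
rewrite (_ : [set w | _] = \bigcap_(i in [set: 'I_m]) ((fun w => S w i) @^-1` `]-oo, y i])).
  apply: fin_bigcap_measurable => // i _.
  by rewrite -[X in measurable X]setTI; exact: mS.
apply/seteqP; split => w /= H i; first by move=> _ /=; rewrite in_itv/=; exact: H.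
by have := H i I; rewrite /= in_itv.
Qed.

Let mSy := measurable_joint_ray.

Let mPhi y h : measurable_fun setT
  (fun w => \prod_i normal_cdf ((y i - S w i) / h)).
Proof.
apply: measurable_prod => i _.
apply: measurableT_comp.
  apply: nondecreasing_measurable => //; exact: normal_cdf_le.
by apply: measurable_funM => //; exact: measurable_funB.
Qed.

Let iPhi y h : intg P (fun w => \prod_i normal_cdf ((y i - S w i) / h)).
Proof.
apply: (@intg_bounded _ _ _ _ _ 1) => // w.
by have /andP[h0 h1] := normal_prod_itv (index_enum 'I_m) xpredT
  (fun i => (y i - S w i) / h); rewrite ger0_norm.
Qed.

Let indicE_le y : fine (P [set w | forall i, S w i <= y i]) =
  \int[P]_w \1_[set w | forall i, S w i <= y i] w.
Proof. by rewrite /Rintegral integral_indic// setIT. Qed.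

Let i1 y : intg P (\1_[set w | forall i, S w i <= y i]).
Proof.
apply: (@intg_bounded _ _ _ _ _ 1); first exact: measurable_indic.
by move=> w; rewrite indicE; case: (_ \in _); rewrite ?normr1 ?normr0.
Qed.

(** After the shift by [k h], every argument is at least [k] on the event, and each of the [m]
    factors is at least [normal_cdf k]. *)
Lemma joint_cdf_smoothing_le y h k : 0 < h -> 0 <= k ->
  normal_cdf k ^+ m * fine (P [set w | forall i, S w i <= y i]) <=
  \int[P]_w \prod_i normal_cdf ((y i + k * h - S w i) / h).
Proof.
move=> h0 k0; rewrite indicE_le -Rintegral_scale//.
apply: Rintegral_le; [exact: intgZ|exact: iPhi|move=> w].
have /andP[p0 _] := normal_prod_itv (index_enum 'I_m) xpredT
  (fun i => (y i + k * h - S w i) / h).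
rewrite indicE; have [/set_mem/= Sw|_] := boolP (_ \in _); last by rewrite mulr0.
rewrite mulr1 -[in leLHS](card_ord m) -prodr_const; apply: ler_prod => i _.
rewrite normal_cdf_ge0/= normal_cdf_le// ler_pdivlMr//.
by have := Sw i; lra.
Qed.

(** Off the event some coordinate exceeds [y i], and its factor alone is at most
    [normal_cdf (- k)]. *)
Lemma joint_cdf_smoothing_ge y h k : 0 < h -> 0 <= k ->
  \int[P]_w \prod_i normal_cdf ((y i - k * h - S w i) / h) <=
  fine (P [set w | forall i, S w i <= y i]) + normal_cdf (- k).
Proof.
move=> h0 k0; rewrite indicE_le -[X in _ + X](Rintegral_const P) -Rintegral_add//.
  apply: Rintegral_le; [exact: iPhi|by apply: intgD => //; exact: intg_cst|move=> w].
  have /andP[_ p1] := normal_prod_itv (index_enum 'I_m) xpredT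
    (fun i => (y i - k * h - S w i) / h).
  rewrite indicE; have [/set_mem/= Sw|/negP nSw] := boolP (_ \in _).
    by rewrite (le_trans p1)// lerDl normal_cdf_ge0.
  have [i Si] : exists i, y i < S w i.
    apply: contrapT => nS; apply: nSw; rewrite inE/= => i.
    by rewrite leNgt; apply/negP => ?; apply: nS; exists i.
  rewrite add0r (bigD1 i)//= -[leRHS]mulr1 ler_pM ?normal_cdf_ge0//.
  - by case/andP: (normal_prod_itv (index_enum 'I_m) (fun j => j != i)
      (fun i => (y i - k * h - S w i) / h)).
  - by rewrite normal_cdf_le// ler_pdivrMr//; lra.
  - by case/andP: (normal_prod_itv (index_enum 'I_m) (fun j => j != i)
      (fun i => (y i - k * h - S w i) / h)).
exact: intg_cst.
Qed.

End cdf_smoothing.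

Section joint_cdf_cvg.
Context (R : realType) (m : nat) (d : nat -> measure_display)
  (T : forall n, measurableType (d n)) (P : forall n, probability (T n) R)
  (S : forall n, T n -> 'I_m -> R) (V : R).
Hypothesis V0 : 0 < V.
Hypothesis mS : forall n i, measurable_fun setT (fun w => @S n w i).

Let perturb_cvg (x k : R) :
  (x + k * h) / Num.sqrt (h ^+ 2 + V) @[h --> (0 : R)] --> x / Num.sqrt V.
Proof.
have -> : x / Num.sqrt V = (x + k * 0) / Num.sqrt (0 ^+ 2 + V).
  by rewrite mulr0 addr0 expr0n/= add0r.
apply: cvgM.
  by apply: cvgD; [exact: cvg_cst|apply: cvgM; [exact: cvg_cst|exact: cvg_id]].
apply: cvgV; first by rewrite expr0n/= add0r gt_eqF// sqrtr_gt0.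
apply: continuous_cvg; first exact: sqrt_continuous.
by apply: cvgD; [exact: exprn_continuous|exact: cvg_cst].
Qed.

Let expr_defect (x : R) : 0 <= x <= 1 -> 1 - x ^+ m <= m%:R * (1 - x).
Proof.
move=> /andP[x0 x1]; elim: m => [|k IH]; first by rewrite expr0 subrr mul0r.
have xk : 0 <= x ^+ k <= 1 by rewrite exprn_ge0//= exprn_ile1.
rewrite exprS -natr1; nra.
Qed.

(** The order of the choices matters: [k] is fixed by the Gaussian tails, then [h] is taken so small
    that the shifts by [k h] and the extra variance [h^2] barely move the limit, and only then does
    [n] grow. *)
Lemma joint_cdf_cvg :
  (forall h (y : 'I_m -> R), 0 < h ->
    \int[P n]_w (\prod_i normal_cdf ((y i - @S n w i) / h)) @[n --> \oo] -->
      \prod_i normal_cdf (y i / Num.sqrt (h ^+ 2 + V))) ->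
  forall y : 'I_m -> R, fine (P n [set w | forall i, @S n w i <= y i]) @[n --> \oo] -->
    \prod_i normal_cdf (y i / Num.sqrt V).
Proof.
move=> H y; apply/cvgrPdist_le => e e0.
(* The [m]-th power of [normal_cdf k] multiplies the tail error by [m]; adding 1 avoids a division
   by 0. *)
pose e1 := e / (4 * (m%:R + 1)).
have m1 : 0 < m%:R + 1 :> R by rewrite ltr_wpDl.
have e10 : 0 < e1 by rewrite divr_gt0// mulr_gt0.
have me1 : m%:R * e1 <= e / 4.
  have -> : e / 4 = (m%:R + 1) * e1 by rewrite /e1; field; rewrite gt_eqF.
  by rewrite mulrDl mul1r lerDl ltW.
have e1e : e1 <= e / 4.
  by rewrite /e1 ler_pM2l// lef_pV2 ?posrE ?mulr_gt0// ler_peMr// lerDr.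
have [k [k0 k1 k2]] := normal_cdf_tails e10.
pose c := @gauss_const R.
have c0 : 0 <= c by exact: gauss_const_ge0.
have cm0 : 0 < (c + 1) * (m%:R + 1) by rewrite mulr_gt0// ltr_wpDl.
pose e2 := e / 4 / ((c + 1) * (m%:R + 1)).
have e20 : 0 < e2 by rewrite !divr_gt0.
have [h [h0 hk hk']] : exists h, [/\ 0 < h,
    forall i, `|(y i + k * h) / Num.sqrt (h ^+ 2 + V) - y i / Num.sqrt V| <= e2 &
    forall i, `|(y i + - k * h) / Num.sqrt (h ^+ 2 + V) - y i / Num.sqrt V| <= e2].
  have nk k' : \forall h \near (0 : R)^'+, forall i : 'I_m,
      `|(y i + k' * h) / Num.sqrt (h ^+ 2 + V) - y i / Num.sqrt V| <= e2.
    apply: filter_forall => i.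
    have /cvgrPdist_le/(_ _ e20) := cvg_at_right_filter (@perturb_cvg (y i) k').
    by apply: filterS => h; rewrite distrC.
  have [h [[h1 h2] h3]] : exists h : R, ((forall i : 'I_m,
      `|(y i + k * h) / Num.sqrt (h ^+ 2 + V) - y i / Num.sqrt V| <= e2) /\
      (forall i : 'I_m,
      `|(y i + - k * h) / Num.sqrt (h ^+ 2 + V) - y i / Num.sqrt V| <= e2)) /\ 0 < h.
    near (0 : R)^'+ => h; exists h; split; first split.
    - by near: h; exact: nk.
    - by near: h; exact: nk.
    - by near: h; exact: nbhs_right_gt.
  by exists h.
set L := \prod_i normal_cdf (y i / Num.sqrt V).
have Ldist k' : (forall i, `|(y i + k' * h) / Num.sqrt (h ^+ 2 + V) - y i / Num.sqrt V| <= e2) ->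
    `|\prod_i normal_cdf ((y i + k' * h) / Num.sqrt (h ^+ 2 + V)) - L| <= e / 4.
  move=> hi; apply: le_trans (normal_prod_lipschitz _ _ _) _.
  apply: (@le_trans _ _ (c * (m%:R * e2))).
    rewrite ler_wpM2l//; apply: (@le_trans _ _ (\sum_(i < m) e2)).
      exact: ler_sum.
    by rewrite sumr_const card_ord mulr_natl.
  have -> : e / 4 = (c + 1) * ((m%:R + 1) * e2) by rewrite /e2; field; rewrite !gt_eqF//; lra.
  apply: ler_pM => //; [by rewrite mulr_ge0// ltW|by rewrite lerDl|].
  by rewrite ler_wpM2r ?ltW// ltrDl.
have k'P : 1 - normal_cdf k ^+ m <= e / 4.
  apply: le_trans (expr_defect _) (le_trans _ me1).
    by rewrite normal_cdf_ge0 normal_cdf_le1.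
  by rewrite ler_wpM2l//; lra.
have up := H h (fun i => y i + k * h) h0; have dn := H h (fun i => y i + - k * h) h0.
have e40 : 0 < e / 4 by rewrite divr_gt0.
move/cvgrPdist_le : up => /(_ _ e40); move/cvgrPdist_le : dn => /(_ _ e40).
apply: filterS2 => n; have := Ldist _ hk; have := Ldist _ hk'.
set Lm := \prod_i _; set Lp := \prod_i normal_cdf ((y i + k * h) / _).
have := @joint_cdf_smoothing_le _ _ _ (P n) _ (@S n) (@mS n) y _ _ h0 k0.
have := @joint_cdf_smoothing_ge _ _ _ (P n) _ (@S n) (@mS n) y _ _ h0 k0.
under eq_Rintegral do under eq_bigr do rewrite -mulNr.
set p := fine _; set Im := \int[P n]_w _; set Ip := \int[P n]_w _.
have p1 : p <= 1.
  rewrite /p -lee_fin fineK ?fin_num_measure//; last exact: measurable_joint_ray.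
  by apply: probability_le1; exact: measurable_joint_ray.
have p0 : 0 <= p by rewrite fine_ge0.
move: k'P; set q := normal_cdf k ^+ m => k'P.
have q1 : q <= 1 by rewrite exprn_ile1 ?normal_cdf_ge0 ?normal_cdf_le1.
move=> h1 h2.
move: p p1 p0 q k'P q1 Im Ip Lm Lp h1 h2 => p p1 p0 q k'P q1 Im Ip Lm Lp h1 h2.
rewrite ler_norml => /andP[a1 a2]; rewrite ler_norml => /andP[b1 b2].
rewrite ler_norml => /andP[c1 c2]; rewrite ler_norml => /andP[d1 d2]; rewrite ler_norml.
have : p - e / 4 <= q * p by nra.
by move=> h3; apply/andP; split; lra.
Unshelve. all: by end_near. Qed.

End joint_cdf_cvg.

Lemma fine_probability_leD d (T : measurableType d) (R : realType)
  (P : probability T R) (A B C : set T) :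
  measurable A -> measurable B -> measurable C -> A `<=` B `|` C ->
  fine (P A) <= fine (P B) + fine (P C).
Proof.
move=> mA mB mC ABC; rewrite -fineD ?fin_num_measure// fine_le//.
- exact: fin_num_measure.
- by rewrite fin_numD !fin_num_measure.
apply: (@le_trans _ _ (P (B `|` C))); last exact: measureU2.
by apply: le_measure; rewrite ?inE//; exact: measurableU.
Qed.

(** * A Slutsky argument for the ratio *)

Section slutsky_ratio.
Context (R : realType) (m : nat) (d : nat -> measure_display)
  (T : forall n, measurableType (d n)) (P : forall n, probability (T n) R)
  (S A rho : forall n, T n -> 'I_m -> R) (G : forall n, T n -> R) (D V : R).
Hypothesis D0 : 0 < D.
Hypothesis mS : forall n i, measurable_fun setT (fun w => @S n w i).
Hypothesis mrho : forall n i, measurable_fun setT (fun w => @rho n w i).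
Hypothesis rhoE : forall n w i, @rho n w i = A w i / G w.

Let Z n w : R := `|@G n w - D| + \sum_i `|@A n w i - S w i|.

Hypothesis iZ : forall n, intg (P n) (@Z n).
Hypothesis Z_cvg0 : \int[P n]_w Z w @[n --> \oo] --> 0.
Hypothesis S_cvg : forall y : 'I_m -> R,
  fine (P n [set w | forall i, S w i <= y i]) @[n --> \oo] -->
    \prod_i normal_cdf (y i / Num.sqrt V).

(** Outside the event [Z >= eta], whose probability Markov's inequality controls, [G] is positive.
    Then [A / G <= x] means [A <= x G], and replacing [G] by [D] and [A] by [S] moves the threshold
    by at most [(|x| + 1) eta]. *)
Lemma slutsky_ratio (x : 'I_m -> R) :
  fine (P n [set w | forall i, rho w i <= x i]) @[n --> \oo] -->
    \prod_i normal_cdf (x i * D / Num.sqrt V).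
Proof.
apply/cvgrPdist_le => e e0.
pose c := @gauss_const R.
have c0 : 0 <= c by exact: gauss_const_ge0.
pose a := \sum_i ((`|x i| + 1) / Num.sqrt V).
have a0 : 0 <= a by apply: sumr_ge0 => i _; rewrite divr_ge0// addr_ge0.
have ca : 0 < (c + 1) * (a + 1) by rewrite mulr_gt0// ltr_wpDl.
(* The first bound keeps [G] positive; by the second, shifting the thresholds changes the limit by
   at most [e / 4]. *)
pose eta := Num.min (D / 2) (e / 4 / ((c + 1) * (a + 1))).
have eta0 : 0 < eta by rewrite lt_min !divr_gt0.
have etaD : eta < D by rewrite gt_min ltr_pdivrMr// ltr_pMr// ltr1n.
have etae : c * (a * eta) <= e / 4.
  apply: (@le_trans _ _ ((c + 1) * (a + 1) * eta)).
    rewrite -mulrA ler_pM// ?lerDl//; first by rewrite mulr_ge0// ltW.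
    by rewrite ler_wpM2r ?lerDl// ltW.
  by rewrite mulrC -ler_pdivlMr// ge_min lexx orbT.
set L := \prod_i _.
pose y b i := x i * D + b * ((`|x i| + 1) * eta).
have Ly b : `|b| = 1 -> `|\prod_i normal_cdf (y b i / Num.sqrt V) - L| <= e / 4.
  move=> b1; apply: le_trans (normal_prod_lipschitz _ _ _) (le_trans _ etae).
  rewrite ler_wpM2l// mulr_suml; apply: ler_sum => i _.
  rewrite (_ : _ - _ = b * ((`|x i| + 1) * eta / Num.sqrt V)); last by rewrite /y; ring.
  rewrite normrM b1 mul1r ger0_norm; first by rewrite mulrAC.
  by rewrite divr_ge0// mulr_ge0// ?addr_ge0// ltW.
have e40 : 0 < e / 4 by rewrite divr_gt0.
have /cvgrPdist_le/(_ _ e40) up := @S_cvg (y 1).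
have /cvgrPdist_le/(_ _ e40) dn := @S_cvg (y (- 1)).
have ee0 : 0 < e / 4 * eta by rewrite mulr_gt0.
have /cvgrPdist_le/(_ _ ee0) Zn := Z_cvg0.
apply: filterS3 up dn Zn => n.
rewrite sub0r normrN => h1 h2 h3.
have L1 := Ly 1 (normr1 _); have L2 := Ly (- 1) (ltac:(by rewrite normrN normr1)).
pose B := [set w | eta <= `|@Z n w|].
have mB : measurable B.
  rewrite (_ : B = (fun w => `|@Z n w|) @^-1` `[eta, +oo[).
    rewrite -[X in measurable X]setTI.
    by apply: measurableT_comp => //; exact: intg_measurable (iZ n).
  by apply/seteqP; split => w /=; rewrite in_itv/= andbT.
have Z0 w : 0 <= @Z n w by rewrite addr_ge0// sumr_ge0.
have PB : fine (P n B) <= e / 4.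
  apply: le_trans (probability_markov eta0 (iZ n)) _.
  rewrite mulrC ler_pdivrMr//; apply: le_trans h3.
  by under eq_Rintegral do rewrite ger0_norm//; rewrite ler_norm.
have nB w : ~ B w -> `|G w - D| < eta /\ forall i, `|A w i - S w i| < eta.
  rewrite /B/= => /negP; rewrite -ltNge ger0_norm// => Zw; split.
    by apply: le_lt_trans Zw; rewrite lerDl sumr_ge0.
  move=> i; apply: le_lt_trans Zw; rewrite /Z (bigD1 i)//= addrCA lerDl.
  by rewrite addr_ge0// sumr_ge0.
have mrx : measurable [set w | forall i, @rho n w i <= x i].
  exact: measurable_joint_ray.
have mSb b : measurable [set w | forall i, @S n w i <= y b i].
  exact: measurable_joint_ray.
have hup : fine (P n [set w | forall i, rho w i <= x i]) <=
    fine (P n [set w | forall i, S w i <= y 1 i]) + fine (P n B).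
  apply: fine_probability_leD => // w /= rx.
  have [Bw|/nB[Gw Aw]] := pselect (B w); [by right|left => i].
  have G0 : 0 < G w by move: Gw; rewrite ltr_norml => /andP[]; lra.
  have := rx i; rewrite rhoE ler_pdivrMr// /y mul1r => Ax.
  have := Aw i; rewrite ltr_norml => /andP[Aw1 Aw2].
  have : x i * (G w - D) <= `|x i| * eta.
    by rewrite (le_trans (ler_norm _))// normrM ler_wpM2l// ltW.
  by rewrite mulrDl mul1r mulrBr; lra.
have hdn : fine (P n [set w | forall i, S w i <= y (- 1) i]) <=
    fine (P n [set w | forall i, rho w i <= x i]) + fine (P n B).
  apply: fine_probability_leD => // w /= rx.
  have [Bw|/nB[Gw Aw]] := pselect (B w); [by right|left => i].
  have G0 : 0 < G w by move: Gw; rewrite ltr_norml => /andP[]; lra.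
  have := rx i; rewrite rhoE ler_pdivrMr// /y mulN1r => Ax.
  have := Aw i; rewrite ltr_norml => /andP[Aw1 Aw2].
  have : - (x i * (G w - D)) <= `|x i| * eta.
    by rewrite (le_trans (ler_norm _))// normrN normrM ler_wpM2l// ltW.
  by rewrite mulrDl mul1r mulrBr in Ax *; lra.
move: h1 h2 L1 L2; rewrite !ler_norml => /andP[a1 a2] /andP[b1 b2] /andP[c1 c2] /andP[d1 d2].
by apply/andP; split; lra.
Qed.

End slutsky_ratio.

(** * Replacing the empirical mean *)

Section weak_law.
Context d (T : measurableType d) (R : realType) (P : probability T R)
  (Y : nat -> {mfun T >-> R}) (n : nat) (kappa : R).
Hypothesis Y0 : forall w, Y 0%N w = 0.
Hypothesis indY : independent_below P Y n.+1.
Hypothesis intY4 : forall t, (t <= n)%N -> intg P (fun w => 1 + Y t w ^+ 4).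
Hypothesis kappaY : forall t, (t <= n)%N -> \int[P]_w (1 + Y t w ^+ 4) <= kappa.
Hypothesis meanY : forall t, (t <= n)%N -> \int[P]_w Y t w = 0.

Let mY t : measurable_fun setT (Y t : T -> R).
Proof. exact: measurable_funP. Qed.

Lemma intg_square_norm (f : T -> R) : measurable_fun setT f -> intg P (fun w => f w ^+ 2) -> intg P f.
Proof.
move=> mf if2; apply: intg_le (intgD (intg_cst P 1) if2) _ => // w.
have [f1|/ltW f1] := leP `|f w| 1; first by rewrite (le_trans f1)// lerDl sqr_ge0.
rewrite -(ger0_norm (sqr_ge0 (f w))) normrX expr2.
by rewrite (le_trans (ler_peMr _ f1))// lerDr.
Qed.

(** Each term is centred and independent of the preceding partial sum, so the cross terms vanish.
    The functions [f t] allow both weighted sums of [Y] and centred squares. *)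
Lemma sum_square_moment (f : nat -> R -> R) (b : R) :
  (forall t, measurable_fun setT (f t)) ->
  (forall t, (t <= n)%N -> intg P (fun w => f t (Y t w) ^+ 2)) ->
  (forall t, (t <= n)%N -> \int[P]_w f t (Y t w) = 0) ->
  (forall t, (t <= n)%N -> \int[P]_w (f t (Y t w) ^+ 2) <= b) ->
  intg P (fun w => (\sum_(t < n.+1) f t (Y t w)) ^+ 2) /\
  \int[P]_w ((\sum_(t < n.+1) f t (Y t w)) ^+ 2) <= n.+1%:R * b.
Proof.
move=> mf if2 f0 fb.
suff H k : (k <= n.+1)%N -> intg P (fun w => (\sum_(t < k) f t (Y t w)) ^+ 2) /\
  \int[P]_w ((\sum_(t < k) f t (Y t w)) ^+ 2) <= k%:R * b by exact: H.
elim: k => [_|k IH kn].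
  under [X in intg P X]eq_fun do rewrite big_ord0 expr0n.
  under eq_Rintegral do rewrite big_ord0 expr0n.
  by split; [exact: intg_cst|rewrite Rintegral_const mul0r].
have [i2 h2] := IH (ltnW kn).
have mS : measurable_fun (setT : set (past Y k)) (fun w => \sum_(t < k) f t (Y t w)).
  apply: measurable_sum => t; apply: measurableT_comp => //.
  exact: measurable_past_index.
have iS : intg P (fun w => \sum_(t < k) f t (Y t w)).
  by apply: intg_square_norm => //; exact: measurable_past mS.
have mfk : measurable_fun setT (fun w => f k (Y k w)) by exact: measurableT_comp.
have ifk : intg P (fun w => f k (Y k w)) by apply: intg_square_norm => //; exact: if2.
have ic := integrable_past indY kn (mf k) mS ifk iS.
have hc := Rintegral_past indY kn (mf k) mS ifk iS.
have e : (fun w => (\sum_(t < k.+1) f t (Y t w)) ^+ 2) =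
    fun w => (\sum_(t < k) f t (Y t w)) ^+ 2 + 2 * (f k (Y k w) * \sum_(t < k) f t (Y t w))
      + f k (Y k w) ^+ 2.
  by apply/funext => w; rewrite big_ord_recr/=; ring.
have i3 := intgD i2 (intgZ 2 ic).
rewrite e; split; first by apply: intgD => //; exact: if2.
rewrite Rintegral_add//; last exact: if2.
rewrite Rintegral_add//; last exact: intgZ.
rewrite Rintegral_scale// hc f0// mul0r mulr0 addr0 -natr1 mulrDl mul1r lerD//.
exact: fb.
Qed.

Let moment4 t : (t <= n)%N ->
  intg P (fun w => Y t w ^+ 4) /\ \int[P]_w (Y t w ^+ 4) <= kappa.
Proof.
move=> tn; have i4 : intg P (fun w => Y t w ^+ 4).
  rewrite (_ : (fun w => _) = fun w => (1 + Y t w ^+ 4) - 1).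
    by apply: intgB; [exact: intY4|exact: intg_cst].
  by apply/funext => w; ring.
split => //; apply: le_trans (kappaY tn); apply: Rintegral_le => //; first exact: intY4.
by move=> w; rewrite lerDr.
Qed.

Let moment2 t : (t <= n)%N ->
  intg P (fun w => Y t w ^+ 2) /\ \int[P]_w (Y t w ^+ 2) <= kappa.
Proof.
move=> tn.
have le2 w : Y t w ^+ 2 <= 1 + Y t w ^+ 4.
  by rewrite -(ger0_norm (sqr_ge0 _)) normrX norm_expr_le.
have i2 : intg P (fun w => Y t w ^+ 2).
  apply: intg_le (intY4 tn) _; first exact: measurable_funX.
  by move=> w; rewrite ger0_norm ?sqr_ge0.
split => //; apply: le_trans (kappaY tn); apply: Rintegral_le => //; exact: intY4.
Qed.

Let weighted_sum (x : nat -> R) (C : R) : (forall t, (t <= n)%N -> `|x t| <= C) ->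
  intg P (fun w => (\sum_(t < n.+1) x t * Y t w) ^+ 2) /\
  \int[P]_w ((\sum_(t < n.+1) x t * Y t w) ^+ 2) <= n.+1%:R * (C ^+ 2 * kappa).
Proof.
move=> xC.
have C0 : 0 <= C by apply: le_trans (xC 0%N isT).
apply: (@sum_square_moment (fun t y => x t * y)).
- by move=> t; exact: measurable_funM.
- move=> t tn; rewrite (_ : (fun w => _) = fun w => x t ^+ 2 * Y t w ^+ 2).
    by apply: intgZ; exact: (moment2 tn).1.
  by apply/funext => w; rewrite exprMn.
- move=> t tn; rewrite Rintegral_scale ?meanY ?mulr0//.
  by apply: intg_square_norm => //; exact: (moment2 tn).1.
- move=> t tn; under eq_Rintegral do rewrite exprMn.
  rewrite Rintegral_scale; last exact: (moment2 tn).1.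
  apply: ler_pM (moment2 tn).2; rewrite ?sqr_ge0//.
    by apply: Rintegral_ge0 => w _; rewrite sqr_ge0.
  by rewrite -(ger0_norm (sqr_ge0 (x t))) normrX lerXn2r ?nnegrE ?xC.
Qed.

Let n1_le : (0 < n)%N -> n.+1%:R / n%:R <= 2 :> R.
Proof.
move=> n0; rewrite ler_pdivrMr ?ltr0n// -natr1 mulr_natl mulr2n lerD2l.
by rewrite ler1n.
Qed.

(** The variance of [Y t ^ 2] is at most its fourth moment [E Y t ^ 4 <= kappa], so the sum has a
    second moment of order [n], which is then turned into an [L^1] bound. *)
Lemma second_moment_lln : (0 < n)%N ->
  intg P (fun w => n%:R^-1 * \sum_(t < n.+1) (Y t w ^+ 2 - second_moment P Y t)) /\
  \int[P]_w `|n%:R^-1 * \sum_(t < n.+1) (Y t w ^+ 2 - second_moment P Y t)|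
    <= (kappa + 1) / Num.sqrt n%:R.
Proof.
move=> n0.
have nR : 0 < n%:R :> R by rewrite ltr0n.
have [i2 h2] : intg P (fun w => (\sum_(t < n.+1) (Y t w ^+ 2 - second_moment P Y t)) ^+ 2) /\
   \int[P]_w ((\sum_(t < n.+1) (Y t w ^+ 2 - second_moment P Y t)) ^+ 2) <= n.+1%:R * kappa.
  have e t : (fun w => (Y t w ^+ 2 - second_moment P Y t) ^+ 2) =
      fun w => Y t w ^+ 4 - 2 * second_moment P Y t * Y t w ^+ 2 + second_moment P Y t ^+ 2.
    by apply/funext => w; ring.
  apply: (@sum_square_moment (fun t y => y ^+ 2 - second_moment P Y t)).
  - by move=> t; apply: measurable_funB => //; exact: measurable_funX.
  - move=> t tn; rewrite e; apply: intgD; last exact: intg_cst.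
    by apply: intgB; [exact: (moment4 tn).1|apply: intgZ; exact: (moment2 tn).1].
  - move=> t tn; rewrite Rintegral_sub; [|exact: (moment2 tn).1|exact: intg_cst].
    by rewrite Rintegral_const subrr.
  - move=> t tn; rewrite e.
    have [i4 h4] := moment4 tn; have [i2 h2] := moment2 tn.
    rewrite Rintegral_add; [|by apply: intgB => //; exact: intgZ|exact: intg_cst].
    rewrite Rintegral_sub//; last exact: intgZ.
    rewrite Rintegral_scale// Rintegral_const -/(second_moment P Y t).
    apply: le_trans h4; set v := second_moment P Y t.
    rewrite (_ : _ + _ = \int[P]_w Y t w ^+ 4 - v ^+ 2); last by ring.
    by rewrite gerBl sqr_ge0.
have iS : intg P (fun w => \sum_(t < n.+1) (Y t w ^+ 2 - second_moment P Y t)).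
  apply: intg_square_norm => //; apply: measurable_sum => t.
  by apply: measurable_funB => //; exact: measurable_funX.
split; first exact: intgZ.
pose q := Num.sqrt n%:R : R.
have q0 : 0 < q by rewrite sqrtr_gt0.
have qq : q ^+ 2 = n%:R by rewrite sqr_sqrtr// ltW.
pose h w := (2 * q)^-1 + (2 * q * n%:R)^-1 *
  (\sum_(t < n.+1) (Y t w ^+ 2 - second_moment P Y t)) ^+ 2.
have ih : intg P h by apply: intgD; [exact: intg_cst|exact: intgZ].
apply: (@le_trans _ _ (\int[P]_w h w)).
  apply: Rintegral_le => //; first by apply: intg_norm; exact: intgZ.
  (* AM-GM: [|W| <= (1 / sqrt n + sqrt n W^2) / 2]. *)
  move=> w; rewrite /h; set W := \sum_(t < n.+1) _.
  have : 0 <= (2 * q)^-1 * (1 - q^-1 * `|W|) ^+ 2.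
    by rewrite mulr_ge0 ?sqr_ge0// invr_ge0 mulr_ge0// ltW.
  rewrite normrM ger0_norm ?invr_ge0 ?(ltW nR)//.
  have -> : (2 * q)^-1 * (1 - q^-1 * `|W|) ^+ 2 =
     (2 * q)^-1 + (2 * q * q ^+ 2)^-1 * `|W| ^+ 2 - (q ^+ 2)^-1 * `|W|.
    by field; rewrite gt_eqF.
  by rewrite qq -normrX (ger0_norm (sqr_ge0 W)) subr_ge0.
rewrite Rintegral_add; [|exact: intg_cst|exact: intgZ].
rewrite Rintegral_const Rintegral_scale//.
have k0 : 0 <= kappa by apply: le_trans (moment2 (leq0n n)).2; exact: Rintegral_ge0 (fun w _ => sqr_ge0 _).
have : (2 * q * n%:R)^-1 * \int[P]_w ((\sum_(t < n.+1) (Y t w ^+ 2 - second_moment P Y t)) ^+ 2)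
   <= (2 * q * n%:R)^-1 * (n.+1%:R * kappa).
  by rewrite ler_wpM2l// invr_ge0 !mulr_ge0// ltW.
have -> : (2 * q * n%:R)^-1 * (n.+1%:R * kappa) = kappa / q * (n.+1%:R / n%:R / 2).
  by field; rewrite !gt_eqF.
have := n1_le n0.
have kq : 0 <= kappa / q by rewrite divr_ge0// ltW.
move=> r2 h2'; rewrite -/q [leRHS]mulrDl [leLHS]addrC lerD//.
  apply: le_trans h2' _; rewrite ler_piMr//; lra.
by rewrite mul1r lef_pV2 ?posrE ?mulr_gt0// ler_peMl ?ler1n// ltW.
Qed.

Lemma big_nat_ord_if (a b k : nat) (F : nat -> R) : (b <= k)%N ->
  \sum_(a <= t < b) F t = \sum_(t < k) (if (a <= t < b)%N then F t else 0).
Proof.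
move=> bk; rewrite -(big_mkord xpredT (fun t => if (a <= t < b)%N then F t else 0)).
rewrite -big_mkcond/= (big_nat_widenl _ 0%N)// (big_nat_widen _ _ k)//.
Qed.

Section covariance_approx.
Variables (c : nat -> R) (C : R) (h : nat).
Hypotheses (n0 : (0 < n)%N) (cC : forall t, (0 < t <= n)%N -> `|c t| <= C).

Let Ybar w : R := n%:R^-1 * \sum_(1 <= t < n.+1) Y t w.

Let defect w : R :=
  n%:R^-1 * \sum_(h.+1 <= t < n.+1)
    (Y t w - Ybar w * c t) * (Y (t - h)%N w - Ybar w * c (t - h)%N) -
  n%:R^-1 * \sum_(h.+1 <= t < n.+1) Y t w * Y (t - h)%N w.

Let C0 : 0 <= C.
Proof. by apply: le_trans (cC (t := 1%N) _); rewrite ?normr_ge0. Qed.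

Let N w : R := \sum_(t < n.+1) 1 * Y t w.
(** [U1] and [U2] are the two cross sums, of [c (t - h) Y t] and, after reindexing, of
    [c t Y (t - h)]. Zero weights extend them to the full range, where orthogonality applies. *)
Let U1 w : R := \sum_(t < n.+1) (if (h < t < n.+1)%N then c (t - h) else 0) * Y t w.
Let U2 w : R := \sum_(t < n.+1) (if (0 < t < n.+1 - h)%N then c (t + h) else 0) * Y t w.

Let YbarE w : Ybar w = n%:R^-1 * N w.
Proof.
rewrite /Ybar /N; congr (_ * _); rewrite big_ord_recl/= Y0 mulr0 add0r.
rewrite big_add1/= big_mkord; apply: eq_bigr => t _; by rewrite mul1r.
Qed.

Let defectE w : defect w = n%:R^-1 *
  (Ybar w ^+ 2 * (\sum_(h.+1 <= t < n.+1) c t * c (t - h)%N)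
   - Ybar w * (U1 w + U2 w)).
Proof.
have -> : U1 w = \sum_(h.+1 <= t < n.+1) c (t - h)%N * Y t w.
  rewrite (@big_nat_ord_if _ _ n.+1)//; apply: eq_bigr => t _.
  by case: ifPn => // _; rewrite mul0r.
have -> : U2 w = \sum_(h.+1 <= t < n.+1) c t * Y (t - h)%N w.
  rewrite -[h.+1]add1n big_addn (@big_nat_ord_if _ _ n.+1) ?leq_subr//.
  by apply: eq_bigr => t _; case: ifPn => _; rewrite ?mul0r// addnK.
rewrite /defect -mulrBr; congr (_ * _).
rewrite -sumrB -big_split/= !mulr_sumr -sumrB; apply: eq_bigr => t _; ring.
Qed.

(** Every term of the defect contains two factors among [N], [U1] and [U2], whose second moments are
    of order [n]; the prefactor [n^(-2)] leaves [1 / n]. The leading 2 bounds [(n + 1) / n]. *)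
Lemma covariance_approx : intg P defect /\
  \int[P]_w `|defect w| <= 2 * kappa * (1 + 2 * C ^+ 2) / n%:R.
Proof.
have nR : 0 < n%:R :> R by rewrite ltr0n.
have [iN hN] : intg P (fun w => N w ^+ 2) /\ \int[P]_w (N w ^+ 2) <= n.+1%:R * (1 ^+ 2 * kappa).
  by apply: (@weighted_sum (fun=> 1)) => t _; rewrite normr1.
have [iU1 hU1] : intg P (fun w => U1 w ^+ 2) /\ \int[P]_w (U1 w ^+ 2) <= n.+1%:R * (C ^+ 2 * kappa).
  apply: (@weighted_sum (fun t => if (h < t < n.+1)%N then c (t - h) else 0)) => t tn.
  case: ifPn => [/andP[ht _]|_]; last by rewrite normr0.
  by apply: cC; rewrite subn_gt0 ht (leq_trans (leq_subr _ _)).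
have [iU2 hU2] : intg P (fun w => U2 w ^+ 2) /\ \int[P]_w (U2 w ^+ 2) <= n.+1%:R * (C ^+ 2 * kappa).
  apply: (@weighted_sum (fun t => if (0 < t < n.+1 - h)%N then c (t + h) else 0)) => t tn.
  case: ifPn => [/andP[t0 th]|_]; last by rewrite normr0.
  by apply: cC; rewrite addn_gt0 t0/=; move: th; rewrite ltn_subRL addnC.
pose H w := (n%:R ^+ 2)^-1 * ((1 + C ^+ 2) * N w ^+ 2 + (2^-1 * U1 w ^+ 2 + 2^-1 * U2 w ^+ 2)).
have iH : intg P H.
  by apply: intgZ; apply: intgD; [exact: intgZ|apply: intgD; exact: intgZ].
have cc : `|\sum_(h.+1 <= t < n.+1) c t * c (t - h)%N| <= n%:R * C ^+ 2.
  apply: le_trans (ler_norm_sum _ _ _) _.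
  apply: (@le_trans _ _ (\sum_(h.+1 <= t < n.+1) C ^+ 2)).
    rewrite [leLHS]big_nat_cond [leRHS]big_nat_cond.
    apply: ler_sum => t /andP[/andP[ht tn] _].
    rewrite normrM expr2 ler_pM//; apply: cC; first by rewrite (leq_ltn_trans _ ht).
    by rewrite subn_gt0 ht (leq_trans (leq_subr _ _)).
  rewrite sumr_const_nat -[leLHS]mulr_natl ler_wpM2r ?sqr_ge0// ler_nat subSS.
  exact: leq_subr.
have le_H w : `|defect w| <= H w.
  rewrite defectE YbarE; set s := \sum_(_ <= t < _) _ in cc *.
  have -> : n%:R^-1 * ((n%:R^-1 * N w) ^+ 2 * s - n%:R^-1 * N w * (U1 w + U2 w)) =
    (n%:R ^+ 2)^-1 * (N w ^+ 2 * (s / n%:R) - N w * (U1 w + U2 w)).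
    by field; rewrite gt_eqF.
  rewrite normrM ger0_norm ?invr_ge0 ?exprn_ge0// /H ler_wpM2l ?invr_ge0 ?exprn_ge0//.
  have sn : `|s / n%:R| <= C ^+ 2.
    by rewrite normrM [X in _ * X]ger0_norm ?invr_ge0// ler_pdivrMr// mulrC.
  have h1 : `|N w ^+ 2 * (s / n%:R)| <= C ^+ 2 * N w ^+ 2.
    by rewrite normrM (ger0_norm (sqr_ge0 _)) mulrC ler_wpM2r ?sqr_ge0.
  have h2 : `|N w * (U1 w + U2 w)| <= N w ^+ 2 + (2^-1 * U1 w ^+ 2 + 2^-1 * U2 w ^+ 2).
    have := sqr_ge0 (N w - U1 w); have := sqr_ge0 (N w - U2 w).
    have := sqr_ge0 (N w + U1 w); have := sqr_ge0 (N w + U2 w).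
    rewrite ler_norml; nra.
  by rewrite (le_trans (ler_normB _ _))// mulrDl mul1r; lra.
have mN : measurable_fun setT N by apply: measurable_sum => t; exact: measurable_funM.
have mU1 : measurable_fun setT U1 by apply: measurable_sum => t; exact: measurable_funM.
have mU2 : measurable_fun setT U2 by apply: measurable_sum => t; exact: measurable_funM.
have id : intg P defect.
  apply: intg_le iH le_H.
  rewrite (_ : defect = fun w => n%:R^-1 * ((n%:R^-1 * N w) ^+ 2 *
     (\sum_(h.+1 <= t < n.+1) c t * c (t - h)%N) - (n%:R^-1 * N w) * (U1 w + U2 w))).
    apply: measurable_funM => //; apply: measurable_funB.
      by apply: measurable_funM => //; apply: measurable_funX; exact: measurable_funM.
    by apply: measurable_funM; [exact: measurable_funM|exact: measurable_funD].
  by apply/funext => w; rewrite defectE YbarE.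
split => //; apply: le_trans (Rintegral_le (intg_norm id) iH le_H) _.
rewrite Rintegral_scale; last by apply: intgD; [exact: intgZ|apply: intgD; exact: intgZ].
rewrite Rintegral_add; [|exact: intgZ|by apply: intgD; exact: intgZ].
rewrite Rintegral_add; try exact: intgZ.
rewrite !Rintegral_scale//.
have k0 : 0 <= kappa by apply: le_trans (moment2 (leq0n n)).2; exact: Rintegral_ge0 (fun w _ => sqr_ge0 _).
have C20 : 0 <= C ^+ 2 by rewrite sqr_ge0.
have hN' : (1 + C ^+ 2) * \int[P]_w N w ^+ 2 <= (1 + C ^+ 2) * (n.+1%:R * (1 ^+ 2 * kappa)).
  by rewrite ler_wpM2l// addr_ge0.
apply: (@le_trans _ _ ((n%:R ^+ 2)^-1 * (n.+1%:R * kappa * (1 + 2 * C ^+ 2)))).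
  by rewrite ler_wpM2l ?invr_ge0 ?exprn_ge0//; lra.
have -> : (n%:R ^+ 2)^-1 * (n.+1%:R * kappa * (1 + 2 * C ^+ 2)) =
  (n.+1%:R / n%:R) * (kappa * (1 + 2 * C ^+ 2) / n%:R) by field; rewrite gt_eqF.
have -> : 2 * kappa * (1 + 2 * C ^+ 2) / n%:R = 2 * (kappa * (1 + 2 * C ^+ 2) / n%:R) by ring.
rewrite ler_wpM2r ?n1_le// divr_ge0 ?mulr_ge0//.
by rewrite addr_ge0// mulr_ge0.
Qed.

End covariance_approx.
End weak_law.

(** * Moments of the observed returns *)

Section conditional_law.
Context d1 (T1 : measurableType d1) d2 (T2 : measurableType d2) (R : realType)
  (P1 : probability T1 R) (P2 : probability T2 R)
  (X1 : {mfun T1 >-> R}) (a1 : {mfun T1 >-> bool})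
  (X2 : {mfun T2 >-> R}) (a2 : {mfun T2 >-> bool}).
Local Notation one a := (a @^-1` [set true]).
Hypothesis eq_law : forall B : set R, measurable B ->
  cond_prob P1 (X1 @^-1` B) (one a1) = cond_prob P2 (X2 @^-1` B) (one a2).

Let joint d (T : measurableType d) (X : {mfun T >-> R}) (a : {mfun T >-> bool}) w :=
  (X w, a w).

Let measurable_joint d (T : measurableType d) X a : measurable_fun setT (@joint d T X a).
Proof. exact: measurable_fun_pair. Qed.

HB.instance Definition _ d T X a :=
  isMeasurableFun.Build _ _ _ _ (@joint d T X a) (@measurable_joint d T X a).

Let slab : set (R * bool) := [set z | z.2 = true].

Let measurable_slab : measurable slab.
Proof.
rewrite (_ : slab = setT `*` [set true]); first exact: measurableX.
by apply/seteqP; split => -[x b]; rewrite /slab /=; [move=> ->|case].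
Qed.

Let inv_prob_ge0 d (T : measurableType d) (P : probability T R) (A : set T) :
  0 <= (fine (P A))^-1.
Proof. by rewrite invr_ge0 fine_ge0. Qed.

Let cond_measure d (T : measurableType d) (P : probability T R)
  (X : {mfun T >-> R}) (a : {mfun T >-> bool}) :=
  mscale (NngNum (inv_prob_ge0 P (one a))) (distribution P (@joint d T X a)).

Let cond_expectationE d (T : measurableType d) (P : probability T R)
  (X : {mfun T >-> R}) (a : {mfun T >-> bool}) (f : R -> R) :
  measurable_fun setT f -> (forall x, 0 <= f x) ->
  cond_expectation P (f \o X) (one a) =
  (\int[@cond_measure d T P X a]_(z in slab) (f z.1)%:E)%E.
Proof.
move=> mf f0.
have mf1 : measurable_fun slab (fun z : R * bool => (f z.1)%:E).
  apply: measurable_funS (measurableT) (@subsetT _ _) _.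
  by apply/measurable_EFinP; exact: measurableT_comp.
rewrite /cond_measure ge0_integral_mscale//; last by move=> z _; rewrite lee_fin.
rewrite /cond_expectation; congr (_ * _)%E.
by rewrite /distribution ge0_integral_pushforward// => z _; rewrite lee_fin.
Qed.

(** The conditional expectation is an integral over the slab where the second coordinate is [true],
    against the rescaled law of [(X, a)]. On subsets of the slab this measure is the conditional law
    of [X], so the two underlying spaces may differ. *)
Lemma cond_expectation_eq_law (f : R -> R) :
  measurable_fun setT f -> (forall x, 0 <= f x) ->
  cond_expectation P1 (f \o X1) (one a1) = cond_expectation P2 (f \o X2) (one a2).
Proof.
move=> mf f0; rewrite !cond_expectationE//.
apply: eq_measure_integral => A mA Aslab.
pose B := ysection A true.
have mB : measurable B by exact: measurable_ysection.
have cm d (T : measurableType d) (P : probability T R)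
      (X : {mfun T >-> R}) (a : {mfun T >-> bool}) :
    @cond_measure d T P X a A = (cond_prob P (X @^-1` B) (one a))%:E.
  rewrite /cond_measure /mscale /cond_prob/= mulrC EFinM; congr (_ * _)%E.
  rewrite fineK; last first.
    rewrite fin_num_measure//; apply: measurableI.
      by rewrite -[X in measurable X]setTI; exact: measurable_funP.
    by rewrite -[X in measurable X]setTI; exact: measurable_funP.
  rewrite /distribution /pushforward; congr (P _); apply/seteqP; split => w /=.
    rewrite /joint => Aw; have awt : a w = true by exact: (Aslab _ Aw).
    by split => //; rewrite /B /ysection/= inE -awt.
  by rewrite /B /ysection/= inE /joint => -[+ ->].
by apply: etrans (cm _ _ P1 X1 a1) (etrans _ (esym (cm _ _ P2 X2 a2))); rewrite eq_law.
Qed.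

End conditional_law.

Section centered_powers.
Context d (T : measurableType d) (R : realType).
Variables (delta : R) (r : nat -> {mfun T >-> R}) (b : nat -> R).

(* The value [0] at [t = 0] makes the products with truncated index [t - h]
   vanish when [t <= h]. *)
Definition centered_power (t : nat) (w : T) : R :=
  if t is 0 then 0 else `|r t w| `^ delta - b t.

Lemma measurable_centered_power t : measurable_fun setT (centered_power t).
Proof.
case: t => [|t]; first exact: measurable_cst.
apply: measurable_funB => //; apply: (measurableT_comp (measurable_powR delta)).
exact: measurableT_comp.
Qed.

HB.instance Definition _ t :=
  isMeasurableFun.Build _ _ _ _ (centered_power t) (@measurable_centered_power t).

End centered_powers.

Section returns_moments.
Context d (T : measurableType d) (R : realType) (P : probability T R)
  (eta : nat -> {mfun T >-> R}) (a : nat -> {mfun T >-> bool})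
  (delta sigma : R) (n : nat) (M1 M2 M4 : R).
Let one t : set T := a t @^-1` [set true].
Let r t : {mfun T >-> R} := observed_return (fun=> sigma) eta a t.
Let q t : R := fine (P (one t)).
Let Y t : {mfun T >-> R} := centered_power delta r (fun t => M1 * q t) t.
Hypothesis delta_gt0 : 0 < delta.
Hypothesis q_itv : forall t, (0 < t <= n)%N -> 0 < q t <= 1.

(** For [t >= 1], [Y t] is a measurable function [phi t] of the pair [(eta t, a t)]; index 0 is
    added as a constant. *)
Lemma independent_centered_power :
  mutually_independent P [set t | (1 <= t <= n)%N] (fun t w => (eta t w, a t w)) ->
  independent_below P Y n.+1.
Proof.
move=> ind B mB.
pose phi t (z : R * bool) : R := `|z.2%:R * (sigma * z.1)| `^ delta - M1 * q t.
have mphi t : measurable_fun setT (phi t).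
  apply: measurable_funB => //; apply: (measurableT_comp (measurable_powR delta)).
  apply: measurableT_comp => //; apply: measurable_funM; last exact: measurable_funM.
  exact: (measurableT_comp (f := fun b : bool => b%:R : R)).
pose C t := phi t @^-1` B t.
have mC t : measurable (C t) by rewrite -[X in measurable X]setTI; exact: mphi.
have YC t : Y t.+1 @^-1` B t.+1 = (fun w => (eta t.+1 w, a t.+1 w)) @^-1` C t.+1 by [].
have J1 t : t \in iota 1 n -> (1 <= t <= n)%N.
  by rewrite mem_iota add1n ltnS.
have := ind (iota 1 n) C (iota_uniq _ _) J1 mC.
have -> : (\prod_(t <- iota 1 n) P ((fun w => (eta t w, a t w)) @^-1` C t) =
    \prod_(t < n) P (Y t.+1 @^-1` B t.+1))%E.
  have -> : iota 1 n = index_iota 1 n.+1 by rewrite /index_iota subSS subn0.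
  by rewrite big_add1/= big_mkord.
move=> indC; rewrite big_ord_recl/=.
have -> : \bigcap_(t in `I_n.+1) Y t @^-1` B t = Y 0%N @^-1` B 0%N `&`
   \bigcap_(t in [set` iota 1 n]) (fun w => (eta t w, a t w)) @^-1` C t.
  apply/seteqP; split => w /=.
    move=> H; split; first exact: (H 0%N).
    by move=> [|t]; rewrite /= mem_iota add1n//= ltnS => tn; exact: (H t.+1).
  by move=> [H0 H] [|t] //= tn; apply: (H t.+1); rewrite /= mem_iota add1n ltnS.
(* [Y 0] is the constant 0, so its preimage is either the whole space or empty. *)
have [B0|B0] := pselect (B 0%N 0).
  have -> : Y 0%N @^-1` B 0%N = setT by apply/seteqP; split.
  by rewrite setTI probability_setT mul1e indC.
have -> : Y 0%N @^-1` B 0%N = set0 by apply/seteqP; split.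
by rewrite set0I measure0 mul0e.
Qed.

Hypothesis condM : forall t, (0 < t <= n)%N ->
  [/\ cond_expectation P (fun w => `|r t w| `^ delta) (one t) = M1%:E,
      cond_expectation P (fun w => `|r t w| `^ (2 * delta)) (one t) = M2%:E &
      cond_expectation P (fun w => `|r t w| `^ (4 * delta)) (one t) = M4%:E].

Let X t w := `|r t w| `^ delta.

Let XE (k : nat) t w : `|r t w| `^ (k%:R * delta) = X t w ^+ k.
Proof. by rewrite mulrC powRrM powR_mulrn ?powR_ge0. Qed.

Let mone t : measurable (one t).
Proof. by rewrite -[X in measurable X]setTI; exact: measurable_funP. Qed.

Let mX t : measurable_fun setT (X t).
Proof.
by apply: (measurableT_comp (measurable_powR delta)); exact: measurableT_comp.
Qed.

(** As [s > 0], the power of the observed return is 0 where [a t] is [false], so the conditional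
    moment only has to be multiplied by [q t]. *)
Let power_moment s M t : (0 < t <= n)%N -> 0 < s ->
  cond_expectation P (fun w => `|r t w| `^ s) (one t) = M%:E ->
  intg P (fun w => `|r t w| `^ s) /\ \int[P]_w (`|r t w| `^ s) = q t * M.
Proof.
move=> tn s0 cM; have /andP[q0 _] := q_itv tn.
have e : (\int[P]_w (`|r t w| `^ s)%:E = (q t * M)%:E)%E.
  rewrite EFinM -cM /cond_expectation muleA -EFinM divff ?gt_eqF// mul1e.
  rewrite [RHS]integral_mkcond; apply: eq_integral => w _.
  rewrite /patch; case: ifPn => //; rewrite notin_setE /one/= => /negP aw.
  rewrite /r/= /observed_return (negbTE aw) mul0r normr0 powR0// gt_eqF//.
split; last by rewrite /Rintegral e.
apply/integrableP; split.
  apply/measurable_EFinP; apply: (measurableT_comp (measurable_powR s)).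
  exact: measurableT_comp.
under eq_integral do rewrite /= ger0_norm ?powR_ge0//.
by rewrite e ltry.
Qed.

Let moments t : (0 < t <= n)%N ->
  [/\ intg P (X t), intg P (fun w => X t w ^+ 2) & intg P (fun w => X t w ^+ 4)] /\
  [/\ \int[P]_w X t w = q t * M1, \int[P]_w (X t w ^+ 2) = q t * M2 &
      \int[P]_w (X t w ^+ 4) = q t * M4].
Proof.
move=> tn; have [c1 c2 c4] := condM tn.
have [i1 h1] := power_moment tn delta_gt0 c1.
have [|i2 h2] := power_moment tn _ c2; first exact: mulr_gt0.
have [|i4 h4] := power_moment tn _ c4; first exact: mulr_gt0.
have e k : (fun w => `|r t w| `^ (k%:R * delta)) = fun w => X t w ^+ k.
  by apply/funext => w; exact: XE.
by rewrite -(e 2%N) -(e 4%N).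
Qed.

(** The factor 8 comes from [(x - y)^4 <= 8 (x^4 + y^4)]; together with [q t <= 1] it makes the
    bound independent of [t] and [n]. *)
Lemma centered_power_moments :
  [/\ forall t, (t <= n)%N -> intg P (fun w => 1 + Y t w ^+ 4),
      forall t, (t <= n)%N -> \int[P]_w (1 + Y t w ^+ 4) <= 1 + 8 * (`|M4| + M1 ^+ 4),
      forall t, (t <= n)%N -> \int[P]_w Y t w = 0 &
      forall t, (0 < t <= n)%N -> \int[P]_w Y t w ^+ 2 = q t * M2 - q t ^+ 2 * M1 ^+ 2].
Proof.
have le4 (x y : R) : (x - y) ^+ 4 <= 8 * (x ^+ 4 + y ^+ 4).
  have h (u v : R) : (u - v) ^+ 2 <= 2 * (u ^+ 2 + v ^+ 2).
    by have := sqr_ge0 (u + v); nra.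
  have h' (u v : R) : (u + v) ^+ 2 <= 2 * (u ^+ 2 + v ^+ 2).
    by have := sqr_ge0 (u - v); nra.
  have e4 (u : R) : u ^+ 4 = (u ^+ 2) ^+ 2 by rewrite -exprM.
  rewrite !e4 (@le_trans _ _ ((2 * (x ^+ 2 + y ^+ 2)) ^+ 2))//.
    by rewrite lerXn2r ?nnegrE ?sqr_ge0// ?mulr_ge0// ?addr_ge0// sqr_ge0.
  have := h' (x ^+ 2) (y ^+ 2); rewrite exprMn; lra.
have Y4 t : (0 < t <= n)%N -> intg P (fun w => 1 + Y t w ^+ 4) /\
    \int[P]_w (1 + Y t w ^+ 4) <= 1 + 8 * (`|M4| + M1 ^+ 4).
  move=> tn; have [[_ _ i4] [_ _ h4]] := moments tn.
  have /andP[q0 q1] := q_itv tn.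
  have M140 : 0 <= M1 ^+ 4 by rewrite exprn_even_ge0.
  have ih : intg P (fun w => 1 + 8 * (X t w ^+ 4 + M1 ^+ 4)).
    apply: intgD; first exact: intg_cst.
    by apply: intgZ; apply: intgD => //; exact: intg_cst.
  have leY w : 1 + Y t w ^+ 4 <= 1 + 8 * (X t w ^+ 4 + M1 ^+ 4).
    rewrite lerD2l; have -> : Y t w = X t w - M1 * q t by case: t tn {i4 h4 q0 q1 ih}.
    apply: le_trans (le4 _ _) _; rewrite ler_wpM2l// lerD2l exprMn.
    by rewrite ler_piMr// exprn_ile1// ltW.
  have i : intg P (fun w => 1 + Y t w ^+ 4).
    apply: intg_le ih _ => [|w].
      by apply: measurable_funD => //; apply: measurable_funX; exact: measurable_funP.
    by rewrite ger0_norm// addr_ge0// exprn_even_ge0.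
  split=> //; apply: le_trans (Rintegral_le i ih leY) _.
  rewrite Rintegral_add; [|exact: intg_cst|apply: intgZ; apply: intgD => //; exact: intg_cst].
  rewrite Rintegral_scale; last by apply: intgD => //; exact: intg_cst.
  rewrite Rintegral_add//; last exact: intg_cst.
  rewrite !Rintegral_const h4 lerD2l ler_wpM2l// lerD2r.
  apply: le_trans (ler_norm _) _; rewrite normrM ger0_norm ?(ltW q0)//.
  by rewrite ler_piMl.
have Y00 : (fun w => 1 + Y 0%N w ^+ 4) = fun=> 1.
  by apply/funext => w; rewrite [Y 0%N w]/(0 : R) expr0n addr0.
split.
- move=> [_|t tn]; last exact: (Y4 t.+1 tn).1.
  by rewrite Y00; exact: intg_cst.
- move=> [_|t tn]; last exact: (Y4 t.+1 tn).2.
  rewrite Y00 Rintegral_const lerDl mulr_ge0// addr_ge0// exprn_even_ge0//.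
- move=> [_|t tn]; first exact: Rintegral_const.
  have [[i1 _ _] [h1 _ _]] := moments (tn : (0 < t.+1 <= n)%N).
  rewrite (_ : \int[P]_w Y t.+1 w = \int[P]_w (X t.+1 w - M1 * q t.+1))//.
  by rewrite Rintegral_sub//; [rewrite Rintegral_const h1; ring|exact: intg_cst].
- move=> [//|t] tn.
  have [[i1 i2 _] [h1 h2 _]] := moments tn.
  have -> : \int[P]_w Y t.+1 w ^+ 2 =
     \int[P]_w (X t.+1 w ^+ 2 - 2 * M1 * q t.+1 * X t.+1 w + (M1 * q t.+1) ^+ 2).
    apply: eq_Rintegral => w _.
    have -> : Y t.+1 w = X t.+1 w - M1 * q t.+1 by [].
    by move: (X _ _) (q _) => x y; ring.
  rewrite Rintegral_add; [|by apply: intgB => //; exact: intgZ|exact: intg_cst].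
  rewrite Rintegral_sub//; last exact: intgZ.
  by rewrite Rintegral_scale// Rintegral_const h1 h2; ring.
Qed.

(** The conditional Jensen inequality: the second moment of [X - M1] on the event [a = 1], with [X]
    the power of the return, equals [q (M2 - M1^2)]. *)
Lemma square_cond_moment_le : (0 < n)%N -> M1 ^+ 2 <= M2.
Proof.
move=> n0; have n1 : (0 < 1 <= n)%N by [].
have [[i1 i2 _] [h1 h2 _]] := moments n1.
have /andP[q0 q1] := q_itv n1.
have ione : intg P (\1_(one 1) : T -> R).
  apply: (@intg_bounded _ _ _ _ _ 1); first exact: measurable_indic.
  by move=> w; rewrite indicE; case: (_ \in _); rewrite ?normr1 ?normr0.
have hone : \int[P]_w \1_(one 1) w = q 1.
  by rewrite /Rintegral integral_indic// setIT.
have : 0 <= \int[P]_w (X 1 w - M1 * \1_(one 1) w) ^+ 2.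
  by apply: Rintegral_ge0 => w _; exact: sqr_ge0.
have -> : \int[P]_w (X 1 w - M1 * \1_(one 1) w) ^+ 2 =
    \int[P]_w (X 1 w ^+ 2 - 2 * M1 * X 1 w + M1 ^+ 2 * \1_(one 1) w).
  apply: eq_Rintegral => w _; rewrite indicE.
  have [_|] := boolP (w \in one 1); first by rewrite /=; ring.
  rewrite notin_setE /one/= => /negP aw.
  have -> : X 1 w = 0.
    by rewrite /X /r/= /observed_return (negbTE aw) mul0r normr0 powR0// gt_eqF.
  by rewrite /=; ring.
rewrite Rintegral_add; [|by apply: intgB => //; exact: intgZ|exact: intgZ].
rewrite Rintegral_sub//; last exact: intgZ.
rewrite !Rintegral_scale// h1 h2 hone.
have -> : q 1 * M2 - 2 * M1 * (q 1 * M1) + M1 ^+ 2 * q 1 = q 1 * (M2 - M1 ^+ 2) by ring.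
by rewrite pmulr_rge0// subr_ge0.
Qed.

(** Were [M2] zero, [eta] would vanish almost everywhere on the event [a = 1], against its
    conditional second moment being 1. *)
Lemma second_cond_moment_gt0 : (0 < n)%N -> sigma != 0 ->
  cond_expectation P (fun w => eta 1 w ^+ 2) (one 1) = 1%E -> 0 < M2.
Proof.
move=> n0 s0 eta1; have n1 : (0 < 1 <= n)%N by [].
have [[_ i2 _] [_ h2 _]] := moments n1.
have /andP[q0 q1] := q_itv n1.
have M20 : 0 <= M2.
  rewrite -(pmulr_rge0 _ q0) -h2; apply: Rintegral_ge0 => w _; exact: sqr_ge0.
rewrite lt_neqAle M20 andbT; apply/eqP => M2E.
move: h2; rewrite -M2E mulr0 => h2.
have e0 : (\int[P]_w `|(X 1 w ^+ 2)%:E| = 0)%E.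
  under eq_integral do rewrite gee0_abs ?lee_fin ?sqr_ge0//.
  by rewrite -[LHS]fineK ?[fine _]h2//; exact: integrable_fin_num i2.
have mX2 : measurable_fun setT (fun w => (X 1 w ^+ 2)%:E).
  by apply/measurable_EFinP; exact: measurable_funX.
have aeX := (ae_eq_integral_abs P measurableT mX2).1 e0.
move: eta1; rewrite /cond_expectation (_ : \int[P]_(w in one 1) _ = 0)%E.
  by rewrite mule0 => /esym/eqP; rewrite onee_eq0.
rewrite -(integral0 P (one 1)); apply: ae_eq_integral => //.
  apply/measurable_EFinP; apply: measurable_funTS.
  exact: measurable_funX.
apply: filterS aeX => w /(_ I) /= [/eqP]; rewrite sqrf_eq0 => /eqP Xw aw.
move: Xw; rewrite /X /r/= /observed_return /latent_return [a 1%N w]aw mul1r => /powR_eq0_eq0.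
by move=> /normr0_eq0/eqP; rewrite mulf_eq0 (negbTE s0)/= => /eqP->; rewrite expr0n.
Qed.

End returns_moments.

Lemma joint_cdf_mvnormal (R : realType) (m : nat) (c : R) (x : 'rV[R]_m) : 0 < c ->
  joint_cdf (mvnormal 0 c%:M) x = \prod_(i < m) normal_cdf (x ord0 i / c).
Proof.
move=> c0; transitivity (fine (iid_law (normal_prob (0 : R) 1) m
    [set z | forall i, (`]-oo, x ord0 i / c]%classic : set R) (tnth z i)])).
  congr (fine (iid_law _ _ _)).
  apply/seteqP; split => z /= H i; have := H i; rewrite tnth_mktuple mxE add0r.
    rewrite (bigD1 i)//= mxE eqxx mulr1n big1 ?addr0 => [|j ji].
      by rewrite in_itv/= ler_pdivlMr// mulrC.
    by rewrite mxE eq_sym (negbTE ji) mulr0n mul0r.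
  rewrite (bigD1 i)//= mxE eqxx mulr1n big1 ?addr0 => [|j ji].
    by rewrite in_itv/= ler_pdivlMr// mulrC.
  by rewrite mxE eq_sym (negbTE ji) mulr0n mul0r.
rewrite (@iid_lawE _ _ _ (normal_prob 0 1) m (fun i => `]-oo, x ord0 i / c]%classic))//.
rewrite -[RHS]/(fine (\prod_(i < m) normal_cdf (x ord0 i / c))%:E) -prodEFin.
by congr fine; apply: eq_bigr => i _; rewrite fineK// fin_num_measure.
Qed.

Section conditional_moments.
Context d (T : measurableType d) (R : realType) (P : probability T R)
  (eta : nat -> {mfun T >-> R}) (a : nat -> {mfun T >-> bool}) (delta sigma : R).
Let one t : set T := a t @^-1` [set true].
Let r t : {mfun T >-> R} := observed_return (fun=> sigma) eta a t.

Lemma cond_expectation_observed t s :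
  cond_expectation P (fun w => `|r t w| `^ s) (one t) =
  cond_expectation P ((fun x : R => `|sigma * x| `^ s) \o eta t) (one t).
Proof.
rewrite /cond_expectation; congr (_ * _)%E; apply: eq_integral => w /set_mem/= aw.
by rewrite /observed_return aw mul1r.
Qed.

(** Moments are defined through [fine], which sends infinite values to 0; finiteness, from
    [x^k <= 1 + x^4], makes them faithful. *)
Lemma cond_expectation_observed_fin_num t k : 0 < sigma -> (k <= 4)%N ->
  ('E_P[(fun w => `|eta t w| `^ (4 * delta))%R] < +oo)%E ->
  cond_expectation P (fun w => `|r t w| `^ (k%:R * delta)) (one t) \is a fin_num.
Proof.
move=> sigma0 k4; rewrite unlock => eta4.
have mone : measurable (one t).
  by rewrite -[X in measurable X]setTI; exact: measurable_funP.
rewrite cond_expectation_observed /cond_expectation fin_numM//.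
have meta s : measurable_fun setT (fun w => `|eta t w| `^ s).
  by apply: (measurableT_comp (measurable_powR s)); exact: measurableT_comp.
have i4 : intg P (fun w => 1 + sigma `^ (4 * delta) * `|eta t w| `^ (4 * delta)).
  apply: intgD; first exact: intg_cst.
  apply: intgZ; apply/integrableP; split; first exact/measurable_EFinP.
  under eq_integral do rewrite /= ger0_norm ?powR_ge0//.
  exact: eta4.
have i : intg P (fun w => `|sigma * eta t w| `^ (k%:R * delta)).
  apply: intg_le i4 _ => [|w].
    apply: (measurableT_comp (measurable_powR _)); apply: measurableT_comp => //.
    exact: measurable_funM.
  rewrite ger0_norm ?powR_ge0// -{2}(gtr0_norm sigma0) -powRM// -normrM.
  have e (l : nat) : `|sigma * eta t w| `^ (l%:R * delta) = (`|sigma * eta t w| `^ delta) ^+ l.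
    by rewrite (mulrC l%:R) powRrM powR_mulrn ?powR_ge0.
  rewrite !e -[X in X ^+ k]ger0_norm ?powR_ge0//; exact: norm_expr_le.
apply: integrable_fin_num => //.
by apply: (integrableS measurableT) => //.
Qed.

End conditional_moments.

(** * Limits of the averaged variances *)

Section riemann_limits.
Context (R : realType) (g : R -> R) (A B : R).
Hypothesis mg : measurable_fun (`]0, 1]%classic : set R) g.
Hypothesis g01 : forall u, u \in `]0, 1] -> 0 < g u < 1.
Hypothesis plg : piecewise_lipschitz g.

Let mu := @lebesgue_measure R.
Let I (k : nat) : R := (\int[mu]_(s in `[0%R, 1%R]) (g s ^+ k))%R.

(** With [A = M2] and [B = M1^2], the variance of a power of an observed return as a function of the
    probability [x] of being observed. *)
Definition variance_of (x : R) : R := A * x - B * x ^+ 2.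

Lemma variance_of_bound u : u \in `]0, 1] -> `|variance_of (g u)| <= `|A| + `|B|.
Proof.
move=> /g01/andP[g0 g1]; rewrite (le_trans (ler_normB _ _))//.
rewrite (normrM A) (normrM B) normrX (ger0_norm (ltW g0)) lerD// ler_piMr//; first exact: ltW.
by rewrite exprn_ile1// ltW.
Qed.

Let tn_itv n t : (0 < t <= n)%N -> t%:R / n%:R \in (`]0, 1] : interval R).
Proof.
move=> /andP[t0 tn]; have n0 : 0 < n%:R :> R by rewrite ltr0n (leq_trans t0).
rewrite in_itv/=; apply/andP; split; first by rewrite divr_gt0// ltr0n.
by rewrite ler_pdivrMr// mul1r ler_nat.
Qed.

Let mgk (f : R -> R) : measurable_fun setT f -> measurable_fun (`]0, 1]%classic : set R) (f \o g).
Proof. by move=> mf; apply: (measurableT_comp mf mg). Qed.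

Let cont_comp (f : R -> R) (s : R) (i : nat) : continuous f ->
  0 < s -> {for s, continuous g} ->
  f (g (((Num.truncn (n%:R * s)).+1 - i)%N%:R / n%:R)) @[n --> \oo] --> f (g s).
Proof.
move=> cf s0 cg.
have h : g (((Num.truncn (n%:R * s)).+1 - i)%N%:R / n%:R) @[n --> \oo] --> g s.
  exact: (continuous_cvg _ cg (truncn_lag_cvg i s0)).
exact: (continuous_cvg _ (cf _) h).
Qed.

Lemma mean_riemann_cvg (f : R -> R) (C : R) : continuous f ->
  (forall u, u \in `]0, 1] -> `|f (g u)| <= C) ->
  n%:R^-1 * \sum_(t < n) f (g (t.+1%:R / n%:R)) @[n --> \oo] -->
    \int[mu]_(s in `[0%R, 1%R]) f (g s).
Proof.
move=> cf fC; have [E fE cE] := piecewise_lipschitz_continuous plg.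
apply: (@riemann_sum_cvg _ (fun n t => f (g (t%:R / n%:R))) (f \o g) C E) => //.
- by apply: mgk; exact: continuous_measurable_fun.
- by move=> n t tn; apply: fC; exact: tn_itv.
- by move=> s /andP[s0 s1] Es; apply: (cont_comp 0) => //; apply: cE => //; rewrite s0.
Qed.

(** At a continuity point of [g] a fixed lag disappears in the limit, and the product of lagged
    values tends to a square. *)
Lemma lag_riemann_cvg (f : R -> R) (C : R) (i : nat) : continuous f ->
  (forall u, u \in `]0, 1] -> `|f (g u)| <= C) ->
  n%:R^-1 * \sum_(t < n) f (g (t.+1%:R / n%:R)) *
     (if (t - i)%N is t'.+1 then f (g ((t'.+1)%:R / n%:R)) else 0) @[n --> \oo] -->
    \int[mu]_(s in `[0%R, 1%R]) (f (g s)) ^+ 2.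
Proof.
move=> cf fC; have [E fE cE] := piecewise_lipschitz_continuous plg.
have C0 : 0 <= C.
  by apply: le_trans (fC 1 _); rewrite ?normr_ge0// in_itv/= ltr01 lexx.
(* The array is evaluated at [t.+1] in the Riemann sum, and [t.+1 - i.+1] is the required
   [t - i]. *)
pose c n t := f (g (t%:R / n%:R)) *
     (if (t - i.+1)%N is t'.+1 then f (g ((t'.+1)%:R / n%:R)) else 0).
have := @riemann_sum_cvg _ c (fun s => f (g s) ^+ 2) (C * C) E.
apply => //.
- apply: (mgk (f := fun x => f x ^+ 2)); apply: measurable_funX.
  exact: continuous_measurable_fun.
- move=> n t tn; rewrite /c normrM ler_pM//; first by apply: fC; exact: tn_itv.
  case e : (t - i.+1)%N => [|t']; first by rewrite normr0.
  apply: fC; apply: tn_itv; rewrite /= -e (leq_trans (leq_subr _ _))//.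
  by case/andP: tn.
- move=> s /andP[s0 s1] Es.
  have cs : {for s, continuous g} by apply: cE => //; rewrite s0.
  have h1 := cont_comp 0 cf s0 cs; have h2 := cont_comp i.+1 cf s0 cs.
  rewrite expr2; apply: cvg_trans (cvgM h1 h2); apply: near_eq_cvg.
  near=> n; rewrite /c /= subn0; congr (_ * _).
  have n0 : 0 < n%:R :> R by rewrite ltr0n; near: n; exact: nbhs_infty_gt.
  have : (i < Num.truncn (n%:R * s))%N.
    by rewrite truncn_gt_nat -ler_pdivrMr//; near: n; exact: nbhs_infty_ger.
  by rewrite subSS -subn_gt0; case: (_ - _)%N.
Unshelve. all: by end_near. Qed.

Let mg' : measurable_fun (`[0, 1]%classic : set R) g.
Proof. exact/measurable_fun_itv_obnd_cbndP. Qed.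

Let g_bound : exists C, forall s, 0 <= s <= 1 -> `|g s| <= C.
Proof.
(* The bounds on [g] concern []0, 1]], so the value at 0 is counted separately. *)
exists (1 + `|g 0|) => s /andP[s0 s1].
move: s0; rewrite le_eqVlt => /orP[/eqP<-|s0]; first by rewrite lerDr.
have /g01/andP[gs0 gs1] : s \in `]0, 1] by rewrite in_itv/= s0.
by rewrite ger0_norm ?(ltW gs0)// (le_trans (ltW gs1))// lerDl.
Qed.

Lemma integrable_continuous_comp (f : R -> R) : continuous f ->
  mu.-integrable (`[0, 1]%classic : set R) (EFin \o (f \o g)).
Proof.
move=> cf; have [C gC] := g_bound.
have C0 : 0 <= C by apply: le_trans (gC 0 _); rewrite // lexx ler01.
have mfg : measurable_fun (`[0, 1]%classic : set R) (f \o g).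
  by apply: measurableT_comp => //; exact: continuous_measurable_fun.
have [M HM] : exists M, forall x, - C <= x <= C -> `|f x| <= M.
  have := @segment_compact R (- C) C.
  move=> /(continuous_compact (continuous_subspaceT cf))/compact_bounded[M [_ HM]].
  exists (`|M| + 1) => x xC; apply: (HM (`|M| + 1)).
    by rewrite ltr_pwDr// ler_norm.
  by exists x => //=; rewrite in_itv.
apply: (@le_integrable _ _ _ mu _ (measurable_itv _) _ (fun=> M%:E)).
- exact/measurable_EFinP.
- move=> s /=; rewrite in_itv/= => s01; rewrite lee_fin.
  by rewrite (le_trans (HM _ _)) ?ler_norm// -ler_norml gC.
- apply/integrableP; split => //.
  rewrite integral_cst//= lebesgue_measure_itv/= lte_fin ltr01 -EFinB -EFinM.
  exact: ltry.
Qed.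

(** If the integral were 0, [f] would vanish almost everywhere, yet it is positive on an interval of
    measure 1. *)
Lemma Rintegral_gt0 (f : R -> R) :
  mu.-integrable (`[0, 1]%classic : set R) (EFin \o f) ->
  (forall s, s \in `]0, 1] -> 0 < f s) -> 0 < \int[mu]_(s in `[0%R, 1%R]) f s.
Proof.
move=> fi f0.
have fi' : mu.-integrable (`]0, 1]%classic : set R) (EFin \o f).
  apply: (integrableS _ _ _ fi) => //.
  by apply: subset_itvr; rewrite bnd_simp.
rewrite -Rintegral_itv_obnd_cbnd// lt_neqAle; apply/andP; split; last first.
  by apply: Rintegral_ge0 => s /= s01; rewrite ltW// f0.
apply/eqP => f_0.
have e0 : (\int[mu]_(s in `]0%R, 1%R]) `|(f s)%:E| = 0)%E.
  transitivity (\int[mu]_(s in `]0%R, 1%R]) (f s)%:E)%E.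
    apply: eq_integral => s; rewrite inE/= => s01.
    by rewrite ger0_norm// ltW// f0.
  rewrite -[LHS]fineK; last exact: integrable_fin_num fi'.
  by congr EFin; exact: esym f_0.
have mf : measurable_fun (`]0, 1]%classic : set R) (EFin \o f) by exact: (measurable_int mu).
have [N [mN N0 sub]] := (ae_eq_integral_abs mu (measurable_itv _) mf).1 e0.
have : mu (`]0, 1]%classic : set R) = 0%E.
  apply/eqP; rewrite eq_le measure_ge0 andbT -N0 le_measure ?inE//.
  apply: subset_trans sub => s /= s01 /(_ s01) [fs0].
  by have := f0 s s01; rewrite fs0 ltxx.
by rewrite /mu lebesgue_measure_itv/= lte_fin ltr01 oppr0 adde0 => /eqP; rewrite onee_eq0.
Qed.

Lemma continuous_variance_of : continuous variance_of.
Proof.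
move=> x; apply: cvgB; first by apply: cvgM; [exact: cvg_cst|exact: cvg_id].
by apply: cvgM; [exact: cvg_cst|exact: exprn_continuous].
Qed.

Let iI k : mu.-integrable (`[0, 1]%classic : set R) (EFin \o (fun s => g s ^+ k)).
Proof. by apply: (@integrable_continuous_comp (fun x => x ^+ k)); exact: exprn_continuous. Qed.

Let iZ k c : mu.-integrable (`[0, 1]%classic : set R) (EFin \o (fun s => c * g s ^+ k)).
Proof. by have := @integrableZl _ _ _ mu _ (measurable_itv _) c _ (iI k). Qed.

Lemma Rintegral_variance_of :
  \int[mu]_(s in `[0%R, 1%R]) variance_of (g s) = A * I 1 - B * I 2.
Proof.
rewrite /I -!RintegralZl//; try exact: iI.
by rewrite -RintegralB//; try exact: iZ.
Qed.

Lemma Rintegral_variance_of_square :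
  \int[mu]_(s in `[0%R, 1%R]) variance_of (g s) ^+ 2 =
  A ^+ 2 * I 2 - 2 * A * B * I 3 + B ^+ 2 * I 4.
Proof.
rewrite /I -!RintegralZl//; try exact: iI.
have iB : mu.-integrable (`[0, 1]%classic : set R)
    (EFin \o (fun s => A ^+ 2 * g s ^+ 2 - 2 * A * B * g s ^+ 3)).
  by have := @integrableB _ _ _ mu _ (measurable_itv _) _ _ (iZ 2 (A ^+ 2)) (iZ 3 (2 * A * B)).
rewrite -RintegralB//; try exact: iZ.
rewrite -RintegralD//; try exact: iZ.
by apply: eq_Rintegral => s _; rewrite /variance_of; ring.
Qed.

Hypothesis A0 : 0 < A.
Hypothesis BA : B <= A.

(** [B <= A] makes the value at least [A x (1 - x)] with [x = g u]; this is where the strict bound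
    [g < 1] enters. *)
Lemma variance_of_gt0 u : u \in `]0, 1] -> 0 < variance_of (g u).
Proof.
move=> /g01/andP[g0 g1]; rewrite /variance_of.
have : B * g u ^+ 2 <= A * g u ^+ 2 by rewrite ler_wpM2r ?sqr_ge0.
have : 0 < A * (g u * (1 - g u)) by rewrite !mulr_gt0// subr_gt0.
lra.
Qed.

Lemma mean_variance_gt0 : 0 < A * I 1 - B * I 2.
Proof.
rewrite -Rintegral_variance_of; apply: Rintegral_gt0 => [|s]; last exact: variance_of_gt0.
exact: integrable_continuous_comp continuous_variance_of.
Qed.

Lemma mean_square_variance_gt0 : 0 < A ^+ 2 * I 2 - 2 * A * B * I 3 + B ^+ 2 * I 4.
Proof.
rewrite -Rintegral_variance_of_square; apply: Rintegral_gt0 => [|s s01].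
  apply: (@integrable_continuous_comp (fun x => variance_of x ^+ 2)) => x.
  have h := @continuous_variance_of x; rewrite /continuous_at.
  under eq_fun do rewrite expr2.
  by rewrite expr2; exact: (cvgM h h).
by rewrite exprn_gt0// variance_of_gt0.
Qed.

End riemann_limits.

(** * Convergence of the ratios *)

Section triangular_array.
Context (R : realType) (m : nat) (d : nat -> measure_display)
  (T : forall n, measurableType (d n)) (P : forall n, probability (T n) R)
  (Y : forall n, nat -> {mfun T n >-> R}) (kappa : R).
Hypothesis Y0 : forall n w, Y n 0%N w = 0.
Hypothesis indY : forall n, independent_below (P n) (Y n) n.+1.
Hypothesis intY4 : forall n t, (t <= n)%N -> intg (P n) (fun w => 1 + Y n t w ^+ 4).
Hypothesis kappaY : forall n t, (t <= n)%N ->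
  \int[P n]_w (1 + Y n t w ^+ 4) <= kappa.
Hypothesis meanY : forall n t, (t <= n)%N -> \int[P n]_w Y n t w = 0.

Let inv_sqrt_cvg0 : (Num.sqrt (n%:R : R))^-1 @[n --> \oo] --> (0 : R).
Proof.
apply/cvgrPdist_le => e e0; near=> n; rewrite sub0r normrN.
have ne : e^-1 ^+ 2 <= n%:R by near: n; exact: nbhs_infty_ger.
have n0 : 0 < n%:R :> R by rewrite (lt_le_trans _ ne)// exprn_gt0// invr_gt0.
rewrite ger0_norm ?invr_ge0// -[leRHS]invrK lef_pV2 ?posrE ?invr_gt0 ?sqrtr_gt0//.
by rewrite -(ger0_norm (_ : 0 <= e^-1)) ?invr_ge0 ?(ltW e0)// -sqrtr_sqr ler_wsqrtr.
Unshelve. all: by end_near. Qed.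

(** The test function with final time [h^2] is fixed by [h] and [y], so the Lindeberg constant does
    not depend on [n]. Its initial value is a product of normal distribution functions with
    variances [h^2] plus [lag_variance], which tend to [h^2 + V]. *)
Theorem lag_sum_clt (V : R) : 0 < V ->
  (forall i : 'I_m, lag_variance (P n) (Y n) n i @[n --> \oo] --> V) ->
  forall y : 'I_m -> R,
    fine (P n [set w | forall i, lag_sum (Y n) n n w i <= y i]) @[n --> \oo] -->
    \prod_(i < m) normal_cdf (y i / Num.sqrt V).
Proof.
move=> V0 lagV y.
apply: (@joint_cdf_cvg R m d T P (fun n => lag_sum (Y n) n n) V V0) => [n i|h {}y h0].
  exact: measurable_lag_sum.
have h20 : 0 < h ^+ 2 by rewrite exprn_gt0.
have [K [D1 [D2 uh]]] := normal_product_heat_solution h20 y.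
pose C := lindeberg_const m kappa K.
have lin n := lindeberg (@Y0 n) (@indY n) (@intY4 n) (@kappaY n) (@meanY n) h20 uh.
pose a n i := (y i - 0) / Num.sqrt (h ^+ 2 + lag_variance (P n) (Y n) n i).
have acvg i : a n i @[n --> \oo] --> y i / Num.sqrt (h ^+ 2 + V).
  rewrite /a subr0; apply: cvgM; first exact: cvg_cst.
  apply: cvgV; first by rewrite gt_eqF// sqrtr_gt0 addr_gt0.
  apply: continuous_cvg; first exact: sqrt_continuous.
  by apply: cvgD; [exact: cvg_cst|exact: lagV].
apply/cvgrPdist_le => e e0.
pose c := @gauss_const R.
have c0 : 0 <= c by exact: gauss_const_ge0.
pose e1 := e / 2 / ((c + 1) * (m%:R + 1)).
have m1 : 0 < m%:R + 1 :> R by rewrite ltr_wpDl.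
have c1 : 0 < c + 1 by rewrite ltr_wpDl.
have e10 : 0 < e1 by rewrite !divr_gt0// mulr_gt0.
have e1E : e / 2 = (c + 1) * ((m%:R + 1) * e1).
  by rewrite /e1; field; rewrite !gt_eqF.
have Ce0 : 0 < e / 2 / (`|C| + 1) by rewrite !divr_gt0// ltr_wpDl.
have nearA : \forall n \near \oo, forall i : 'I_m, `|y i / Num.sqrt (h ^+ 2 + V) - a n i| <= e1.
  by apply: filter_forall => i; have /cvgrPdist_le/(_ _ e10) := @acvg i.
have /cvgrPdist_le/(_ _ Ce0) nearS := inv_sqrt_cvg0.
near=> n.
have ha : forall i : 'I_m, `|y i / Num.sqrt (h ^+ 2 + V) - a n i| <= e1 by near: n.
have hn : `|0 - (Num.sqrt (n%:R : R))^-1| <= e / 2 / (`|C| + 1) by near: n.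
move: hn; rewrite sub0r normrN => hn.
have := lin n; rewrite -/C.
have -> : \int[P n]_w (\prod_i normal_cdf ((y i - lag_sum (Y n) n n w i) / Num.sqrt (h ^+ 2))) =
    \int[P n]_w (\prod_i normal_cdf ((y i - lag_sum (Y n) n n w i) / h)).
  by apply: eq_Rintegral => w _; rewrite sqrtr_sqr ger0_norm// ltW.
have hC : C / Num.sqrt n%:R <= e / 2.
  apply: le_trans (ler_norm _) _; rewrite normrM.
  apply: le_trans (_ : `|C| * (e / 2 / (`|C| + 1)) <= _); first by rewrite ler_wpM2l.
  have C10 : 0 < `|C| + 1 by rewrite ltr_wpDl.
  rewrite mulrA ler_pdivrMr// mulrC ler_wpM2l//; first by rewrite divr_ge0// ltW.
  by rewrite lerDl.
have hL := normal_prod_lipschitz (index_enum 'I_m) (fun i => y i / Num.sqrt (h ^+ 2 + V)) (a n).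
have {}hL : `|\prod_i normal_cdf (y i / Num.sqrt (h ^+ 2 + V)) - \prod_i normal_cdf (a n i)| <= e / 2.
  apply: le_trans hL _; rewrite e1E -/c ler_pM ?lerDl ?sumr_ge0//.
  apply: (@le_trans _ _ (\sum_(i < m) e1)); first exact: ler_sum.
  by rewrite sumr_const card_ord -[leLHS]mulr_natl ler_wpM2r ?lerDl// ltW.
move=> hlin; have {}hlin := le_trans hlin hC.
move: hlin hL; rewrite -/(a n) !ler_norml => /andP[h1 h2] /andP[h3 h4].
apply/andP; move: h1 h2 h3 h4; set I := Rintegral _ _ _; set L := \prod_i _.
set L' := \prod_i _; clearbody I L L' => h1 h2 h3 h4;
by split; lra.
Unshelve. all: by end_near. Qed.

Section ratio.
Variables (c : nat -> nat -> R) (C : nat -> R) (Cinf D V : R)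
  (rho : forall n, T n -> 'I_m -> R).
Hypothesis cC : forall n t, (0 < t <= n)%N -> `|c n t| <= C n.
Hypothesis C_cvg : C n @[n --> \oo] --> Cinf.
Hypothesis D0 : 0 < D.
Hypothesis V0 : 0 < V.
Hypothesis mean_cvg :
  n%:R^-1 * \sum_(t < n) second_moment (P n) (Y n) t.+1 @[n --> \oo] --> D.
Hypothesis lag_cvg :
  forall i : 'I_m, lag_variance (P n) (Y n) n i @[n --> \oo] --> V.

(** The form taken by [gamma_ns] once the powers are centred, with [c n t] standing for
    [q t / a_mean]. *)
Definition corrected_cov n h (w : T n) : R :=
  n%:R^-1 * \sum_(h.+1 <= t < n.+1)
    (Y n t w - n%:R^-1 * (\sum_(1 <= t < n.+1) Y n t w) * c n t) *
    (Y n (t - h)%N w - n%:R^-1 * (\sum_(1 <= t < n.+1) Y n t w) * c n (t - h)%N).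

Hypothesis mrho : forall n i, measurable_fun setT (fun w => @rho n w i).
Hypothesis rhoE : forall n w i,
  @rho n w i = Num.sqrt n%:R * corrected_cov i.+1 w / corrected_cov 0 w.

Let defect n h (w : T n) : R :=
  corrected_cov h w - n%:R^-1 * \sum_(h.+1 <= t < n.+1) Y n t w * Y n (t - h)%N w.

Let W n (w : T n) : R :=
  n%:R^-1 * \sum_(t < n.+1) (Y n t w ^+ 2 - second_moment (P n) (Y n) t).

Let mv n : R := n%:R^-1 * \sum_(t < n) second_moment (P n) (Y n) t.+1.

Let second_moment0 n : second_moment (P n) (Y n) 0 = 0.
Proof.
rewrite /second_moment; under eq_Rintegral do rewrite Y0 expr0n/=.
exact: Rintegral_const.
Qed.

Let diagonalE n (w : T n) : corrected_cov 0 w - D = defect 0 w + W w + (mv n - D).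
Proof.
rewrite /defect /W /mv.
have -> : \sum_(1 <= t < n.+1) Y n t w * Y n (t - 0)%N w = \sum_(t < n.+1) Y n t w ^+ 2.
  rewrite [RHS]big_ord_recl/= Y0 expr0n add0r big_add1/= big_mkord.
  by apply: eq_bigr => t _; rewrite subn0 expr2.
have -> : \sum_(t < n.+1) (Y n t w ^+ 2 - second_moment (P n) (Y n) t) =
    \sum_(t < n.+1) Y n t w ^+ 2 - \sum_(t < n) second_moment (P n) (Y n) t.+1.
  rewrite sumrB; congr (_ - _).
  by rewrite big_ord_recl/= second_moment0 add0r.
ring.
Qed.

Let off_diagonalE n (w : T n) (i : 'I_m) :
  Num.sqrt n%:R * corrected_cov i.+1 w - lag_sum (Y n) n n w i =
  Num.sqrt n%:R * defect i.+1 w.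
Proof.
rewrite /defect mulrBr; congr (_ - _); rewrite /lag_sum mulrA.
have -> : Num.sqrt n%:R * n%:R^-1 = (Num.sqrt n%:R)^-1 :> R.
  have [->|n0] := posnP n; first by rewrite sqrtr0 mul0r invr0.
  have nR : 0 < Num.sqrt n%:R :> R by rewrite sqrtr_gt0 ltr0n.
  rewrite -[X in _ * X^-1](@sqr_sqrtr R)//; field; exact: lt0r_neq0.
congr (_ * _); rewrite (@big_nat_ord_if R _ _ n.+1)//; apply: eq_bigr => t _.
case: ifPn => //; rewrite ltn_ord andbT -leqNgt => ti.
by rewrite (eqP (_ : (t - i.+1)%N == 0%N)) ?subn_eq0// Y0 mulr0.
Qed.

Let K n : R := 2 * kappa * (1 + 2 * C n ^+ 2).

Let defect_bound n h : (0 < n)%N -> intg (P n) (@defect n h) /\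
  \int[P n]_w `|defect h w| <= K n / n%:R.
Proof.
by move=> n0; exact: (covariance_approx (@Y0 n) (@indY n) (@intY4 n) (@kappaY n)
  (@meanY n) h n0 (@cC n)).
Qed.

Let Z n (w : T n) : R := `|corrected_cov 0 w - D| +
  \sum_(i < m) `|Num.sqrt n%:R * corrected_cov i.+1 w - lag_sum (Y n) n n w i|.

Let Z_intg n : intg (P n) (@Z n).
Proof.
(* For [n = 0] the inverse of [n%:R] is 0 by convention and the square root is 0, so that [Z]
   reduces to a constant. *)
have [n0|n0] := posnP n.
  have Z_cst w : @Z n w = `|D|.
    rewrite /Z (_ : corrected_cov 0 w = 0) ?sub0r ?normrN; last first.
      by rewrite /corrected_cov; move: (n%:R^-1 : R) (congr1 (fun k => k%:R^-1 : R) n0)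
        => x ->; rewrite invr0 mul0r.
    rewrite big1 ?addr0// => i _; rewrite off_diagonalE.
    by rewrite [X in Num.sqrt X](_ : n%:R = 0) ?sqrtr0 ?mul0r ?normr0// n0.
  rewrite (_ : @Z n = fun=> `|D|); first exact: intg_cst.
  by apply/funext => w.
have lln := second_moment_lln (@indY n) (@intY4 n) (@kappaY n) n0.
apply: intgD.
  apply: intg_norm; rewrite (_ : (fun w => _) = fun w => defect 0 w + W w + (mv n - D)).
    apply: intgD; last exact: intg_cst.
    by apply: intgD; [exact: (defect_bound 0 n0).1|exact: lln.1].
  by apply/funext => w; exact: diagonalE.
apply: intg_sum => i _; apply: intg_norm.
rewrite (_ : (fun w => _) = fun w => Num.sqrt n%:R * defect i.+1 w).
  by apply: intgZ; exact: (defect_bound _ n0).1.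
by apply/funext => w; exact: off_diagonalE.
Qed.

Let Z_bound n : (0 < n)%N -> \int[P n]_w Z w <=
  K n * (Num.sqrt n%:R)^-1 ^+ 2 + (kappa + 1) * (Num.sqrt n%:R)^-1 + `|mv n - D| +
  m%:R * (K n * (Num.sqrt n%:R)^-1).
Proof.
move=> n0; have nR : 0 < Num.sqrt n%:R :> R by rewrite sqrtr_gt0 ltr0n.
have nn : n%:R = Num.sqrt n%:R ^+ 2 :> R by rewrite sqr_sqrtr.
have lln := second_moment_lln (@indY n) (@intY4 n) (@kappaY n) n0.
have db h := defect_bound h n0.
have iD : intg (P n) (fun w => `|defect 0 w| + `|W w|).
  by apply: intgD; apply: intg_norm; [exact: (db _).1|exact: lln.1].
have iDc : intg (P n) (fun w => `|defect 0 w| + `|W w| + `|mv n - D|).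
  by apply: intgD => //; exact: intg_cst.
have iS : intg (P n) (fun w => \sum_(i < m) Num.sqrt n%:R * `|defect i.+1 w|).
  by apply: intg_sum => i _; apply: intgZ; apply: intg_norm; exact: (db _).1.
have iH := intgD iDc iS.
have le_Z (w : T n) : Z w <= `|defect 0 w| + `|W w| + `|mv n - D| +
    \sum_(i < m) Num.sqrt n%:R * `|defect i.+1 w|.
  rewrite /Z; apply: lerD.
    rewrite diagonalE; apply: le_trans (ler_normD _ _) _; apply: lerD => //; exact: ler_normD.
  apply: ler_sum => i _; rewrite off_diagonalE normrM ger0_norm//; exact: ltW.
apply: le_trans (Rintegral_le (Z_intg n) iH le_Z) _.
rewrite Rintegral_add// Rintegral_add//; last exact: intg_cst.
rewrite Rintegral_add; [|by apply: intg_norm; exact: (db _).1|by apply: intg_norm; exact: lln.1].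
rewrite Rintegral_const; apply: lerD; first (apply: lerD => //; apply: lerD).
- by rewrite exprVn -nn; exact: (db 0%N).2.
- exact: lln.2.
- rewrite Rintegral_sumr => [|i _]; last by apply: intgZ; apply: intg_norm; exact: (db _).1.
  apply: (@le_trans _ _ (\sum_(i < m) K n * (Num.sqrt n%:R)^-1)).
    apply: ler_sum => i _; rewrite Rintegral_scale; last by apply: intg_norm; exact: (db _).1.
    have -> : K n * (Num.sqrt n%:R)^-1 = Num.sqrt n%:R * (K n / n%:R).
      move: nn nR; set s := Num.sqrt _ => -> s0; field; exact: lt0r_neq0.
    by rewrite ler_wpM2l// ?(ltW nR)//; exact: (db _).2.
  by rewrite sumr_const card_ord -[leLHS]mulr_natl.
Qed.

(** [K n] stays bounded because [C n] converges, and the defect, of order [1 / n], is still of order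
    [1 / sqrt n] after multiplication by [sqrt n]. *)
Let Z_cvg0 : \int[P n]_w Z w @[n --> \oo] --> 0.
Proof.
have K_cvg : K n @[n --> \oo] --> 2 * kappa * (1 + 2 * Cinf ^+ 2).
  apply: cvgM; first exact: cvg_cst.
  apply: cvgD; first exact: cvg_cst.
  apply: cvgM; first exact: cvg_cst.
  exact: (cvgM C_cvg C_cvg).
have s_cvg := inv_sqrt_cvg0.
have mD : `|mv n - D| @[n --> \oo] --> 0.
  rewrite -(@normr0 R R); apply: cvg_norm; rewrite -(subrr D).
  by apply: cvgB; [exact: mean_cvg|exact: cvg_cst].
apply: (@squeeze_cvgr _ _ _ _ (fun=> 0) (fun n => K n * (Num.sqrt n%:R)^-1 ^+ 2 +
  (kappa + 1) * (Num.sqrt n%:R)^-1 + `|mv n - D| + m%:R * (K n * (Num.sqrt n%:R)^-1))).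
- near=> n; rewrite Rintegral_ge0/=; last by move=> w _; rewrite addr_ge0// sumr_ge0.
  by apply: Z_bound; near: n; exact: nbhs_infty_gt.
- exact: cvg_cst.
- rewrite (_ : 0 = 2 * kappa * (1 + 2 * Cinf ^+ 2) * 0 ^+ 2 + (kappa + 1) * 0 + 0 +
    m%:R * (2 * kappa * (1 + 2 * Cinf ^+ 2) * 0)); last by ring.
  apply: cvgD; last by apply: cvgM; [exact: cvg_cst|exact: cvgM].
  apply: cvgD => //; apply: cvgD; last by apply: cvgM => //; exact: cvg_cst.
  apply: cvgM => //.
  exact: (cvgM s_cvg s_cvg).
Unshelve. all: by end_near. Qed.

Theorem corrected_ratio_clt (x : 'I_m -> R) :
  fine (P n [set w | forall i, rho w i <= x i]) @[n --> \oo] -->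
    \prod_(i < m) normal_cdf (x i * D / Num.sqrt V).
Proof.
apply: (@slutsky_ratio R m d T P (fun n => lag_sum (Y n) n n)
  (fun n w i => Num.sqrt n%:R * corrected_cov i.+1 w) rho
  (fun n => corrected_cov 0) D V D0) => //.
- by move=> n i; exact: measurable_lag_sum.
- by move=> y; exact: lag_sum_clt.
Qed.

End ratio.
End triangular_array.

(** * The corrected autocorrelations as ratios for a triangular array *)

Theorem proposition3p1 (R : realType)
  (d : nat -> measure_display) (T : forall n, measurableType (d n))
  (P : forall n, probability (T n) R)
  (eta : forall n, nat -> {RV (P n) >-> R})
  (a : forall n, nat -> {RV (P n) >-> bool})
  (delta sigma : R) (g : R -> R)
  (m : nat) :
  let one n t : set (T n) := a n t @^-1` [set true] in
  let r n t : {RV (P n) >-> R} :=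
    observed_return (fun=> sigma) (eta n) (a n) t in
  let q n t : R := fine (P n (one n t)) in
  let M n t s := fine (cond_expectation (P n)
    (fun w => `|r n t w| `^ s) (one n t)) in
  0 < delta ->
  0 < sigma ->
  (forall n, mutually_independent (P n) [set t | (1 <= t <= n)%N]
    (fun t w => (eta n t w, a n t w))) ->
  (forall n t, (1 <= t <= n)%N ->
    cond_expectation (P n) (eta n t) (one n t) = 0%E) ->
  (forall n t, (1 <= t <= n)%N ->
    cond_expectation (P n) (fun w => eta n t w ^+ 2) (one n t) = 1%E) ->
  (forall n t n' t' (B : set R), (1 <= t <= n)%N -> (1 <= t' <= n')%N ->
    measurable B ->
    cond_prob (P n) (eta n t @^-1` B) (one n t) =
    cond_prob (P n') (eta n' t' @^-1` B) (one n' t')) ->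
  (forall n t, (1 <= t <= n)%N -> P n (one n t) = (g (t%:R / n%:R))%:E) ->
  measurable_fun (`]0, 1]%classic : set R) g ->
  (exists u v, [/\ u \in `]0, 1], v \in `]0, 1] & g u != g v]) ->
  (forall u, u \in `]0, 1] -> 0 < g u < 1) ->
  piecewise_lipschitz g ->
  g u @[u --> 0^'+] --> g 0 ->
  (forall u, u <= 0 -> g u = g 0) ->
  (forall n t, (1 <= t <= n)%N ->
    ('E_(P n)[(fun w => `|eta n t w| `^ (4 * delta))%R] < +oo)%E) ->
  (1 <= m)%N ->
  forall n0 t0, (1 <= t0 <= n0)%N ->
  cvg_in_distribution P (fun n => sqrtn_Gamma_ns delta (r n) (q n) n m)
    (mvnormal 0 (Num.sqrt (avar (M n0 t0 delta) (M n0 t0 (2 * delta)) g))%:M).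
Proof.
move=> one r q M delta0 sigma0 ind _ eta2 condlaw Pg mg _ g01 plg _ _ eta4 _ n0 t0 t0n.
have qE n t : (0 < t <= n)%N -> q n t = g (t%:R / n%:R).
  by move=> tn; rewrite /q /one Pg.
have tn_itv n t : (0 < t <= n)%N -> t%:R / n%:R \in (`]0, 1] : interval R).
  move=> /andP[t_gt0 tn]; have n_gt0 : 0 < n%:R :> R by rewrite ltr0n (leq_trans t_gt0).
  rewrite in_itv/=; apply/andP; split; first by rewrite divr_gt0// ltr0n.
  by rewrite ler_pdivrMr// mul1r ler_nat.
have q_itv n t : (0 < t <= n)%N -> 0 < q n t <= 1.
  by move=> tn; rewrite qE//; have /andP[-> /ltW] := g01 _ (tn_itv _ _ tn).
(* The conditional laws agree over all pairs [(n, t)], so the moments taken at [(n0, t0)] serve for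
   the whole array. *)
have condE k n t : (k <= 4)%N -> (0 < t <= n)%N ->
    cond_expectation (P n) (fun w => `|r n t w| `^ (k%:R * delta)) (one n t) =
    (M n0 t0 (k%:R * delta))%:E.
  move=> k4 tn; rewrite /M fineK; last exact: cond_expectation_observed_fin_num (eta4 _ _ t0n).
  rewrite /r /one !cond_expectation_observed.
  apply: cond_expectation_eq_law => [B mB||x].
  - exact: condlaw.
  - apply: (measurableT_comp (measurable_powR _)); apply: measurableT_comp => //.
  - exact: powR_ge0.
set M1 := M n0 t0 delta; set M2 := M n0 t0 (2 * delta).
pose M4 := M n0 t0 (4 * delta).
have condM n t : (0 < t <= n)%N ->
  [/\ cond_expectation (P n) (fun w => `|r n t w| `^ delta) (one n t) = M1%:E,
      cond_expectation (P n) (fun w => `|r n t w| `^ (2 * delta)) (one n t) = M2%:E &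
      cond_expectation (P n) (fun w => `|r n t w| `^ (4 * delta)) (one n t) = M4%:E].
  move=> tn; split; [|exact: (condE 2)|exact: (condE 4)].
  by have := condE 1%N n t isT tn; rewrite mul1r.
pose Y n (t : nat) : {mfun T n >-> R} := centered_power delta (r n) (fun t => M1 * q n t) t.
have indY n : independent_below (P n) (Y n) n.+1.
  exact: independent_centered_power (ind n).
have momY n := centered_power_moments delta0 (q_itv n) (condM n).
pose kappa := 1 + 8 * (`|M4| + M1 ^+ 4).
have n0_gt0 : (0 < n0)%N by case/andP: t0n => /leq_trans; exact.
have M12 : M1 ^+ 2 <= M2 by exact: square_cond_moment_le delta0 (q_itv n0) (condM n0) n0_gt0.
have M2_gt0 : 0 < M2.
  apply: (second_cond_moment_gt0 delta0 (q_itv n0) (condM n0) n0_gt0).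
    by rewrite gt_eqF.
  exact: eta2.
pose I k : R := (\int[@lebesgue_measure R]_(s in `[0%R, 1%R]) (g s ^+ k))%R.
pose D := M2 * I 1 - M1 ^+ 2 * I 2.
pose V := M2 ^+ 2 * I 2 - 2 * M2 * M1 ^+ 2 * I 3 + (M1 ^+ 2) ^+ 2 * I 4.
have D0 : 0 < D by exact: mean_variance_gt0.
have V0 : 0 < V by exact: mean_square_variance_gt0.
pose f := variance_of M2 (M1 ^+ 2).
have cf : continuous f by exact: continuous_variance_of.
have fb u : u \in `]0, 1] -> `|f (g u)| <= `|M2| + `|M1 ^+ 2| by exact: variance_of_bound.
have secE n t : (0 < t <= n)%N -> second_moment (P n) (Y n) t = f (g (t%:R / n%:R)).
  move=> tn; have [_ _ _ /(_ t tn) h] := momY n.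
  rewrite /second_moment h (qE n t tn : fine (P n (a n t @^-1` [set true])) = _).
  by rewrite /f /variance_of; ring.
have sec0 n : second_moment (P n) (Y n) 0 = 0.
  rewrite /second_moment (_ : (fun w => _) = fun=> 0); first exact: Rintegral_const.
  by apply/funext => w; rewrite expr0n.
have mean_cvg : n%:R^-1 * \sum_(t < n) second_moment (P n) (Y n) t.+1 @[n --> \oo] --> D.
  rewrite /D -(Rintegral_variance_of _ _ mg g01) (_ : (fun n => _) =
    fun n => n%:R^-1 * \sum_(t < n) f (g (t.+1%:R / n%:R))).
    exact: (@mean_riemann_cvg R g mg plg f (`|M2| + `|M1 ^+ 2|) cf fb).
  by apply/funext => n; congr (_ * _); apply: eq_bigr => t _; rewrite secE/=.
have lag_cvg (i : 'I_m) : lag_variance (P n) (Y n) n i @[n --> \oo] --> V.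
  rewrite /V -(Rintegral_variance_of_square _ _ mg g01) (_ : (fun n => _) =
    fun n => n%:R^-1 * \sum_(t < n) f (g (t.+1%:R / n%:R)) *
     (if (t - i)%N is t'.+1 then f (g ((t'.+1)%:R / n%:R)) else 0)).
    exact: (@lag_riemann_cvg R g mg plg f (`|M2| + `|M1 ^+ 2|) i cf fb).
  apply/funext => n; congr (_ * _); apply: eq_bigr => t _; rewrite secE//=.
  congr (_ * _); case e : (t - i)%N => [|t']; first exact: sec0.
  by rewrite secE//= -e (leq_trans (leq_subr _ _))// ltnW.
(* The weight of the empirical mean of [Y] in the corrected power. Since [q <= 1] it is bounded by
   [C n], which converges because [a_mean] is a Riemann sum with positive limit [I 1]. *)
pose c n t := q n t / a_mean (q n) n.
pose C n := (a_mean (q n) n)^-1.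
have a_gt0 n : (0 < n)%N -> 0 < a_mean (q n) n.
  move=> n_gt0; rewrite /a_mean mulr_gt0 ?invr_gt0 ?ltr0n//.
  rewrite big_add1/= big_mkord; case: n n_gt0 => // n _.
  rewrite big_ord_recl/= ltr_pwDl//; first by have /andP[] := q_itv n.+1 1%N isT.
  by apply: sumr_ge0 => t _; have /andP[/ltW] := q_itv n.+1 t.+2 (ltn_ord t).
have cC n t : (0 < t <= n)%N -> `|c n t| <= C n.
  move=> tn; have n_gt0 : (0 < n)%N by case/andP: tn => /leq_trans; exact.
  have /andP[q0 q1] := q_itv n t tn; have a0 := a_gt0 n n_gt0.
  rewrite /c /C ger0_norm; last by rewrite divr_ge0// ltW.
  by rewrite ler_piMl// invr_ge0 ltW.
have I1_gt0 : 0 < I 1.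
  apply: Rintegral_gt0 => [|s s01]; last by rewrite expr1; case/andP: (g01 s s01).
  by apply: (integrable_continuous_comp mg g01 (f := fun x => x ^+ 1)); exact: exprn_continuous.
have C_cvg : C n @[n --> \oo] --> (I 1)^-1.
  apply: cvgV; first by rewrite gt_eqF.
  have -> : I 1 = (\int[@lebesgue_measure R]_(s in `[0%R, 1%R]) id (g s))%R.
    by apply: eq_Rintegral => s _; rewrite expr1.
  rewrite (_ : (fun n => _) = fun n => n%:R^-1 * \sum_(t < n) id (g (t.+1%:R / n%:R))).
    apply: (@mean_riemann_cvg R g mg plg id 1) => [x|u /g01/andP[gu0 gu1]].
      exact: cvg_id.
    by rewrite ger0_norm ltW.
  apply/funext => n; rewrite /a_mean big_add1/= big_mkord; congr (_ * _).
  by apply: eq_bigr => t _; rewrite qE//=.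
(* [power_mean] is the mean of [Y] plus [M1 a_mean]; multiplied by [c n t], the second part is
   exactly the centring [M1 q t] of [Y]. *)
have corrE n t w : (0 < t <= n)%N -> corrected_power delta (r n) (q n) n t w =
    Y n t w - n%:R^-1 * (\sum_(1 <= s < n.+1) Y n s w) * c n t.
  move=> tn; have n_gt0 : (0 < n)%N by case/andP: tn => /leq_trans; exact.
  have YE s : (0 < s)%N -> `|r n s w| `^ delta = Y n s w + M1 * q n s.
    by case: s => // s _; rewrite [Y n s.+1 w]/(_ - _) subrK.
  have pmE : power_mean delta (r n) n w =
      n%:R^-1 * (\sum_(1 <= s < n.+1) Y n s w) + M1 * a_mean (q n) n.
    rewrite /power_mean /a_mean mulrCA -mulrDr; congr (_ * _).
    rewrite mulr_sumr -big_split/= big_nat_cond [RHS]big_nat_cond.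
    by apply: eq_bigr => s /andP[/andP[s0 _] _]; rewrite YE.
  rewrite /corrected_power pmE YE; last by case/andP: tn.
  by rewrite /c; field; rewrite pnatr_eq0 -lt0n n_gt0 andbT gt_eqF// a_gt0.
have covE n h w : gamma_ns delta (r n) (q n) n h w = corrected_cov Y c h w.
  rewrite /gamma_ns /corrected_cov; congr (_ * _).
  rewrite big_nat_cond [RHS]big_nat_cond; apply: eq_bigr => t /andP[/andP[ht tn] _].
  rewrite !corrE//; first by rewrite subn_gt0 ht (leq_trans (leq_subr _ _)).
  by rewrite (leq_ltn_trans _ ht).
pose rho n (w : T n) (i : 'I_m) := Num.sqrt n%:R * rho_ns delta (r n) (q n) n i.+1 w.
have rho_cvg := @corrected_ratio_clt R m d T P Y kappa (fun n w => erefl) indY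
  (fun n => let: And4 h _ _ _ := momY n in h) (fun n => let: And4 _ h _ _ := momY n in h)
  (fun n => let: And4 _ _ h _ := momY n in h) c C (I 1)^-1 D V rho cC C_cvg D0 V0
  mean_cvg lag_cvg.
move=> x _.
(* [avar_den] is the expanded square of [D], and [avar_num] is [V]. *)
have avarE : avar M1 M2 g = V / D ^+ 2.
  rewrite /avar /avar_num /avar_den /V /D /I; congr (_ / _); ring.
rewrite joint_cdf_mvnormal; last by rewrite sqrtr_gt0 avarE divr_gt0// exprn_gt0.
have -> : \prod_(i < m) normal_cdf (x ord0 i / Num.sqrt (avar M1 M2 g)) =
    \prod_(i < m) normal_cdf (x ord0 i * D / Num.sqrt V).
  apply: eq_bigr => i _; congr normal_cdf.
  rewrite avarE sqrtrM ?(ltW V0)// sqrtrV ?sqr_ge0// sqrtr_sqr ger0_norm ?(ltW D0)//.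
  by field; rewrite !gt_eqF// sqrtr_gt0.
rewrite (_ : (fun n => _) = fun n => fine (P n [set w | forall i, rho n w i <= x ord0 i])).
  apply: rho_cvg => [n i|n w i].
    by apply: measurable_funM => //; exact: measurable_rho_ns.
  by rewrite /rho /rho_ns !covE mulrA.
apply/funext => n; rewrite /joint_cdf /distribution /pushforward; congr (fine (P n _)).
by apply/seteqP; split => w /= H i; have := H i; rewrite tnth_mktuple.
Qed.
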